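(* Let $H\le\mathfrak{S}_n$ be a transitive permutation group, let $K/k$ be an extension of number fields of degree $n$ with Galois group $H$, and let $\ell$ be a prime. Then for every finite set $S\subset\mathbb{P}(k)$ of primes which are unramified in $K/k$ there exists a constant $c=c(k,S,\ell,H)>0$ such that $$c\,x^{\frac{1}{\ell-1}}\le Z(k,S,C_\ell\wr H;x)$$ for all sufficiently large $x$.
   Context: All number fields lie in a fixed algebraic closure of $\mathbb{Q}$; $\mathbb{P}(k)$ is the set of prime ideals of $k$. For a transitive permutation group $G\le\mathfrak{S}_N$, a degree $N$ extension $L/k$ ''has Galois group $G$'' if the Galois group of the normal closure of $L/k$, acting on the $N$ embeddings of $L$ (equivalently on the cosets of the stabilizer of $L$), is permutation isomorphic to $G$. $Z(k,S,G;x)$ is the number of such extensions $L/k$ inside $\bar{\mathbb Q}$ which are unramified at all primes of $S$ and satisfy $\mathcal{N}_{k/\mathbb{Q}}(d_{L/k})\le x$. $C_\ell$ is the cyclic group of order $\ell$ and $C_\ell\wr H=C_\ell^n\rtimes H$ is the wreath product in its natural imprimitive transitive action on $\ell n$ points. *)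

(* Defs.v *)
(* Number fields are subfields of algC, which serves as the fixed algebraic
   closure of the rationals. *)
From HB Require Import structures.
From mathcomp Require Import all_boot all_order all_algebra all_fingroup.
From mathcomp Require Import all_solvable all_field.
From mathcomp Require Import all_classical all_reals all_analysis.

Set Implicit Arguments.
Unset Strict Implicit.
Unset Printing Implicit Defensive.

Import Order.TTheory GRing.Theory Num.Theory.

Local Open Scope classical_set_scope.
Local Open Scope ring_scope.

Implicit Types k L M F I p : set algC.

Definition subfield F : Prop := GRing.divring_closed [in F].

Definition number_field F : Prop :=
  subfield F /\ exists X : seq algC, F = [set x | x \in Crat_span X].

Definition basis_over k L (n : nat) (b : 'I_n -> algC) : Prop :=
  [/\ forall i, L (b i),
      forall x, L x -> exists2 a : 'I_n -> algC,
        (forall i, k (a i)) & x = \sum_i a i * b i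
    & forall a : 'I_n -> algC, (forall i, k (a i)) ->
        \sum_i a i * b i = 0 -> forall i, a i = 0].

Definition has_degree k L (n : nat) : Prop :=
  exists b : 'I_n -> algC, basis_over k L b.

(* A k-embedding of L into algC is a function on algC of which only the
   restriction to L is relevant. *)
Definition embedding k L (s : algC -> algC) : Prop :=
  [/\ {in k, forall x, s x = x},
      {in L &, {morph s : x y / x + y}}
    & {in L &, {morph s : x y / x * y}}].

Definition enumerates_embeddings k L (T : Type) (e : T -> algC -> algC) : Prop :=
  [/\ forall i, embedding k L (e i),
      forall i j, {in L, e i =1 e j} -> i = j
    & forall s, embedding k L s -> exists i, {in L, e i =1 s}].

Definition automorphism k M (s : algC -> algC) : Prop :=
  embedding k M s /\ s @` M = M.

Definition normal_extension k M : Prop :=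
  [/\ subfield M, k `<=` M & forall s, embedding k M s -> s @` M = M].

Definition normal_closure k L : set algC := smallest (normal_extension k) L.

(* The degree #|T| extension L/k has Galois group the permutation group G of T:
   for some labelling by T of the k-embeddings of L, the permutations of the
   labels induced by Gal(M/k), with M the normal closure of L/k, are exactly the
   elements of G. The action of Gal(M/k) on the embeddings of L being faithful,
   this is permutation isomorphism with G. *)
Definition has_galois_group k L (T : finType) (G : {group {perm T}}) : Prop :=
  has_degree k L #|T| /\
  exists2 e : T -> algC -> algC, enumerates_embeddings k L e &
    forall t : {perm T}, t \in G <->
      exists2 s, automorphism k (normal_closure k L) s &
        forall i, {in L, forall x, s (e i x) = e (t i) x}.

Definition integers F : set algC := [set x | F x /\ x \in Aint].

Definition ideal F I : Prop :=
  [/\ I `<=` integers F, I 0, forall x y, I x -> I y -> I (x + y)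
    & forall a x, integers F a -> I x -> I (a * x)].

Definition ideal_generated F (D : set algC) : set algC := smallest (ideal F) D.

Definition ideal_mul F I J : set algC :=
  ideal_generated F [set z | exists x y, [/\ I x, J y & z = x * y]].

(* The zero ideal is excluded: these are the finite places of F. *)
Definition prime_ideals F : set (set algC) :=
  [set p | [/\ ideal F p, p <> [set 0], ~ p 1
    & forall x y, integers F x -> integers F y -> p (x * y) -> p x \/ p y]].

(* p O_L is a product of pairwise distinct primes; residue extensions of number
   fields are always separable. *)
Definition unramified L p : Prop :=
  exists Ps : seq (set algC),
    [/\ uniq Ps, {in Ps, forall P, prime_ideals L P}
      & ideal_generated L p = foldr (ideal_mul L) (integers L) Ps].

(* Generated by the det(e_i(b_j))^2 for b a basis of L/k made of integers of L
   and e_1, ..., e_n the k-embeddings of L. *)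
Definition discriminant k L : set algC :=
  ideal_generated k
    [set d | exists (n : nat) (b : 'I_n -> algC) (e : 'I_n -> algC -> algC),
      [/\ basis_over k L b, forall j, b j \in Aint,
          enumerates_embeddings k L e
        & d = (\det (\matrix_(i, j) e i (b j))) ^+ 2]].

(* The absolute norm, i.e. the cardinality of O_F / I. *)
Definition ideal_norm (R : realType) F I : \bar R :=
  counting [set [set x + y | y in I] | x in integers F].

(* Z(k, S, G; x); counting is the cardinality of a set, +oo if it is infinite. *)
Definition count_extensions (R : realType) k (S : set (set algC))
    (T : finType) (G : {group {perm T}}) (x : R) : \bar R :=
  counting [set L | [/\ number_field L, k `<=` L, has_galois_group k L G,
    forall p, S p -> unramified L p
    & (ideal_norm R k (discriminant k L) <= x%:E)%E]].

(* C_l acting regularly on l points: ordS is i |-> i + 1 mod l. *)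
Definition cyclic_perm_group (l : nat) : {group {perm 'I_l}} :=
  <[perm (@ordS_inj l)]>%G.

(* A wr H in its imprimitive action: (f, h) maps (i, a) to (h i, f_i a). *)
Section Wreath.
Variables (T U : finType) (A : {group {perm U}}) (H : {group {perm T}}).

Definition wreath_set : {set {perm T * U}} :=
  [set s : {perm T * U} |
    [exists h in H, exists f : {ffun T -> {perm U}},
      [forall i, f i \in A] && [forall z, s z == (h z.1, f z.1 z.2)]]]%SET.

Lemma wreathP (s : {perm T * U}) :
  reflect (exists2 h, h \in H & exists2 f : {ffun T -> {perm U}},
             forall i, f i \in A & forall z, s z = (h z.1, f z.1 z.2))
          (s \in wreath_set).
Proof.
rewrite inE; apply: (iffP exists_inP) => -[h hH].
  by case/existsP => f /andP[/forallP fA /forallP sE]; exists h => //; exists f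
     => // z; apply/eqP.
case=> f fA sE; exists h => //; apply/existsP; exists f; apply/andP.
by split; apply/forallP => // z; apply/eqP.
Qed.

Lemma wreath_group_set : group_set wreath_set.
Proof.
apply/group_setP; split=> [|s t /wreathP[h hH [f fA sE]] /wreathP[g gH [f' fA' tE]]].
  apply/wreathP; exists 1%g => //; exists [ffun=> 1%g] => [i|[i a]].
    by rewrite ffunE group1.
  by rewrite !perm1 ffunE perm1.
apply/wreathP; exists (h * g)%g; first exact: groupM.
exists [ffun i => f i * f' (h i)]%g => [i|[i a]]; first by rewrite ffunE groupM.
by rewrite permM sE tE /= ffunE !permM.
Qed.

Definition wreath : {group {perm T * U}} := Group wreath_group_set.

End Wreath.

(* Main.v *)
Require Import Defs.
From HB Require Import structures.
From mathcomp Require Import all_boot all_order all_algebra all_fingroup.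
From mathcomp Require Import all_solvable all_field.
From mathcomp Require Import all_classical all_reals all_analysis.
From mathcomp Require Import ring lra zify.

Set Implicit Arguments.
Unset Strict Implicit.
Unset Printing Implicit Defensive.

Import Order.TTheory GRing.Theory Num.Theory.

Local Open Scope classical_set_scope.
Local Open Scope ring_scope.

(** Let zeta be a primitive l-th root of unity, F = K(zeta) and E the Galois closure of F over Q.
    An integer alpha of F defines, by Kummer theory over F and descent, the extension L/K such that
    L F = F(beta^(1/l)), where beta is the product of the conjugates nu_b(alpha)^b of alpha over
    K, with nu_b(zeta)^b = zeta. If alpha = 1 modulo l^2, then L has a basis of integers over K,
    permuted cyclically by Gal(L/K), whose discriminant is N_{F/K}(alpha)^(l-1). If the norm of
    alpha is moreover squarefree and only involves primes unramified in E, then comparing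
    valuations modulo l shows that the conjugates of L over k are as independent as possible, so
    that L/k has Galois group C_l wr H, and that alpha is determined by L up to a unit and a choice
    among l exponents.

    With D = [F : Q], a sieve over a box of side T in the integers of F, centered far from 0,
    gives about T^D such alpha congruent to 1 modulo any given m, which makes L/K unramified at
    S. The conjugates of alpha all have size about T, which rules out the unit ambiguity, and the
    absolute norm of the discriminant of L/k is O(T^(D (l-1))). *)

(** The exponent dictates the choice of alpha. Its norm is about T^D and enters the discriminant to
    the power l - 1, so T^D has to be about x^(1/(l-1)) and a fixed proportion of the box has to
    survive. Prime norms would lose a logarithm, whereas squarefree norms have positive density by
    an elementary sieve. A single prime p dividing the norm exactly once already gives the Galois
    group: if a prime P of E above p contains alpha, it contains no other conjugate of alpha, so a
    product of conjugate Kummer elements with exponents not all divisible by l cannot be an l-th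
    power in E. The comparison is made in E, and not in F, because all conjugates of alpha over Q
    live there and because normality lets automorphisms over E be conjugated freely. The congruence
    modulo l^2 pays for the factor 1/l of a Fourier transform: without it the basis of L over K need
    not be integral. Parametrizing by elements rather than by ideals avoids class groups, at the
    price of units. *)

Implicit Types (nu mu : {rmorphism algC -> algC}) (F I J P : set algC).

Local Notation pQtoC := (map_poly (ratr : rat -> algC)).

(** * Number fields as fixed fields *)

(** The isomorphism between the fields generated by [x] and [y] is extended twice: to the splitting
    field of the minimal polynomial by [kHom_extends], then to [algC] by
    [extend_algC_subfield_aut]. *)
Lemma conjugate_aut (x y : algC) :
  root (minCpoly x) y -> exists nu, nu x = y.
Proof.
move=> xy; have [p [Dp mon_p] dv_p] := minCpolyP x.
have [r Dr] := closed_field_poly_normal (minCpoly x).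
rewrite (monicP (minCpoly_monic x)) scale1r in Dr.
have xr : x \in r by rewrite -root_prod_XsubC -Dr root_minCpoly.
have yr : y \in r by rewrite -root_prod_XsubC -Dr.
have [Qr [QrC [rr Drr genQr]]] := num_field_exists r.
have [x1 Dx]: {x1 | QrC x1 = x}.
  by move: xr; rewrite -Drr => /mapP/sig2_eqW[xx]; exists xx.
have [y1 Dy]: {y1 | QrC y1 = y}.
  by move: yr; rewrite -Drr => /mapP/sig2_eqW[yy]; exists yy.
have QrC_poly q : map_poly QrC (map_poly (in_alg Qr) q) = pQtoC q.
  rewrite -map_poly_comp; apply: eq_map_poly => a.
  by rewrite /= rmorphZ_num rmorph1 mulr1.
have hom1 : kHom 1 1 (\1%VF : 'End(Qr)) by rewrite kHom1.
have root1 : root (map_poly \1%VF (minPoly 1 x1)) y1.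
  rewrite map_poly_id; last by move=> a _; rewrite lfunE.
  have : minPoly 1 x1 \is a polyOver 1%VS by apply: minPolyOver.
  move=> /polyOverP aP.
  have {aP} a_ i := sig_eqW (vlineP _ _ (aP i)).
  have Dq : minPoly 1 x1 = map_poly (in_alg Qr)
              (\poly_(i < size (minPoly 1 x1)) sval (a_ i)).
    apply/polyP=> i; rewrite coef_map coef_poly /=.
    by case: ltnP => [_|/leq_sizeP->//]; [case: (a_ i) | rewrite scale0r].
  set q := \poly_(_ < _) _ in Dq.
  rewrite -(fmorph_root QrC) Dy Dq QrC_poly.
  have : root (pQtoC q) x by rewrite -QrC_poly -Dq -Dx fmorph_root root_minPoly.
  rewrite dv_p => /dvdpP[w ->]; rewrite rmorphM rootM /=.
  by rewrite -Dp xy orbT.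
pose phi := kHomExtend 1 \1 x1 y1.
have hom_phi : kHom 1 <<1; x1>> phi by apply: kHomExtendP.
pose pr := map_poly (in_alg Qr) p.
have Qpr: pr \is a polyOver 1%VS.
  by apply/polyOverP=> i; rewrite coef_map memvZ ?memv_line.
have splitQr: splittingFieldFor <<1; x1>>%AS pr fullv.
  apply: (splittingFieldForS (sub1v _) (subvf _)); exists rr => //.
  congr (_ %= _): (eqpxx pr); apply/(map_poly_inj QrC).
  rewrite QrC_poly -Dp Dr -Drr big_map rmorph_prod /=; apply: eq_bigr => zz _.
  by rewrite map_polyXsubC.
have [f1 hom_f1 Df1] := kHom_extends (sub1v <<1; x1>>%AS) hom_phi Qpr splitQr.
pose f1M := GRing.isMonoidMorphism.Build _ _ f1 (kHom_monoid_morphism hom_f1).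
pose f1R : {rmorphism _ -> _} := HB.pack (fun_of_lfun f1) f1M.
have [nu Dnu] := extend_algC_subfield_aut QrC f1R.
exists nu; rewrite -Dx -Dnu /= -Df1 ?memv_adjoin // -Dy; congr (QrC _).
rewrite -{1}[x1]hornerX /phi (kHomExtend_poly hom1) ?polyOverX //.
by rewrite map_polyX hornerX.
Qed.

(** The roots of the minimal polynomial are conjugates of [x], hence all equal to [x]; their sum, a
    positive multiple of [x], is a rational coefficient up to sign. *)
Lemma fixed_Crat (x : algC) : (forall nu, nu x = x) -> x \in Crat.
Proof.
move=> fx; have [p [Dp mon_p] _] := minCpolyP x.
have [r Dr] := closed_field_poly_normal (minCpoly x).
rewrite (monicP (minCpoly_monic x)) scale1r in Dr.
have rx : forall y, y \in r -> y = x.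
  move=> y yr; have [|nu <-] := @conjugate_aut x y; last by rewrite fx.
  by rewrite Dr root_prod_XsubC.
have r_n : (0 < size r)%N.
  have : x \in r by rewrite -root_prod_XsubC -Dr root_minCpoly.
  by case: (r).
have := coefPn_prod_XsubC (negbT (gtn_eqF r_n)); rewrite -Dr Dp coef_map.
have -> : \sum_(z <- r) z = x *+ size r.
  rewrite big_seq (eq_bigr (fun=> x)) => [|i /rx -> //].
  by rewrite -big_seq big_const_seq count_predT iter_addr_0.
move=> /(congr1 (fun z => - z / (size r)%:R)); rewrite opprK -(mulr_natr x).
rewrite mulfK ?pnatr_eq0 -?lt0n // => <-.
by rewrite rpred_div ?rpredN ?Crat_rat ?rpred_nat.
Qed.

(* Cramer's rule expresses the coefficients of [x] by the conjugates, which [mu] permutes. *)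
Section Cramer.
Variables (P : {rmorphism algC -> algC} -> Prop) (r : nat).
Variables (s : 'I_r -> {rmorphism algC -> algC}) (w : 'I_r -> algC) (x : algC).
Hypothesis det_w : \det (\matrix_(i, j) s i (w j)) != 0.
Hypothesis perm_s : forall mu, P mu -> forall i', exists i,
  mu (s i x) = s i' x /\ forall j, mu (s i (w j)) = s i' (w j).

Lemma cramer_fixed : exists a : 'I_r -> algC,
  (forall mu, P mu -> forall j, mu (a j) = a j) /\
  forall i, s i x = \sum_j a j * s i (w j).
Proof.
pose W := \matrix_(i, j) s i (w j).
have uW : W \in unitmx by rewrite unitmxE unitfE.
pose c : 'cV_r := \col_i s i x.
have solP (b : 'I_r -> algC) :
    (forall i, s i x = \sum_j b j * s i (w j)) <-> (\col_j b j = invmx W *m c).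
  split=> [bP|bE i].
    rewrite -[LHS](mulKmx uW); congr (_ *m _).
    by apply/colP=> i; rewrite !mxE bP; apply: eq_bigr => j _; rewrite !mxE mulrC.
  have /colP/(_ i) : W *m (\col_j b j) = c by rewrite bE mulKVmx.
  by rewrite !mxE => <-; apply: eq_bigr => j _; rewrite !mxE mulrC.
pose a j := (invmx W *m c) j 0.
have aE : \col_j a j = invmx W *m c by apply/colP=> j; rewrite mxE.
have aP := (solP a).2 aE.
exists a; split=> // mu Pmu j.
have : \col_j mu (a j) = invmx W *m c.
  apply/(solP (fun j => mu (a j))) => i'; have [i [ix iw]] := perm_s Pmu i'.
  by rewrite -ix aP rmorph_sum; apply: eq_bigr => j' _; rewrite rmorphM iw.
by move/colP/(_ j); rewrite mxE => ->.
Qed.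

End Cramer.

(* A number field is represented as the field fixed by the automorphisms of [algC] fixing a
   generator, so that statements on fields become statements on automorphisms of [algC]. *)
Definition Fix (kap : algC) : set algC :=
  [set x | forall nu, nu kap = kap -> nu x = x].

Lemma Fix_gen kap : Fix kap kap. Proof. by move=> nu. Qed.

Lemma Fix_subfield kap : subfield (Fix kap).
Proof.
split=> [|x y|x y]; rewrite ?inE //=.
- by move=> nu _; rewrite rmorph1.
- by move=> Fx Fy nu nuk; rewrite rmorphB Fx ?Fy.
- by move=> Fx Fy nu nuk; rewrite fmorph_div Fx ?Fy.
Qed.

Lemma aut_inv nu : exists mu, cancel nu mu /\ cancel mu nu.
Proof. by exists (algC_invaut nu); split; [apply: algC_autK|apply: algC_invautK]. Qed.

Lemma aut_eq_Fix kap nu mu x : Fix kap x -> nu kap = mu kap -> nu x = mu x.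
Proof.
move=> Fx e; have [mu' [K1 K2]] := aut_inv mu.
apply: (can_inj K2); rewrite K1.
by apply: (Fx (mu' \o nu : {rmorphism _ -> _})); rewrite /= e K1.
Qed.

Section NumberField.
Variables (kap : algC).

Lemma Fix_embeddings : exists D (s : 'I_D -> {rmorphism algC -> algC}),
  injective (fun i => s i kap) /\ forall nu, exists i, nu kap = s i kap.
Proof.
have [r Dr] := closed_field_poly_normal (minCpoly kap).
rewrite (monicP (minCpoly_monic kap)) scale1r in Dr.
pose u : seq algC := undup r.
have uP (i : 'I_(size u)) : {nu : {rmorphism algC -> algC} | nu kap = u`_i}.
  apply: cid; have : u`_i \in u by exact: mem_nth.
  rewrite mem_undup -root_prod_XsubC -Dr; exact: conjugate_aut.
exists (size u), (fun i => sval (uP i)); split=> [i j|nu].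
  case: (uP i) (uP j) => nu /= -> [mu /= ->] /eqP.
  by rewrite nth_uniq ?undup_uniq // => /eqP/val_inj.
have nu_u : nu kap \in u.
  rewrite mem_undup -root_prod_XsubC -Dr.
  by rewrite -(minCpoly_aut nu) root_minCpoly.
have lt_u : (index (nu kap) u < size u)%N by rewrite index_mem.
by exists (Ordinal lt_u); case: (uP _) => mu /= ->; rewrite nth_index.
Qed.

Variables (D : nat) (s : 'I_D -> {rmorphism algC -> algC}).
Hypothesis s_inj : injective (fun i => s i kap).
Hypothesis s_all : forall nu, exists i, nu kap = s i kap.

Lemma Fix_det : \det (\matrix_(i, j < D) s i (kap ^+ j)) != 0.
Proof.
rewrite -det_tr.
have -> : (\matrix_(i, j < D) s i (kap ^+ j))^T = Vandermonde D (\row_i s i kap).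
  by apply/matrixP=> i j; rewrite !mxE rmorphXn.
rewrite det_Vandermonde; apply/prodf_neq0 => i _; apply/prodf_neq0 => j ij.
rewrite !mxE subr_eq0; apply/eqP => /s_inj e.
by rewrite e ltnn in ij.
Qed.

(** The coordinates given by Cramer's rule are fixed by every automorphism of [algC], and so are
    rational by [fixed_Crat]. *)
Lemma Fix_repr x : Fix kap x -> exists a : 'I_D -> algC,
  (forall j, a j \in Crat) /\ x = \sum_j a j * kap ^+ j.
Proof.
move=> Fx.
have [|a [aP sx]] := @cramer_fixed xpredT D s (fun j => kap ^+ j) x Fix_det.
  move=> mu _ i'; have [mu' [K1 K2]] := aut_inv mu.
  have [i ik] := s_all (mu' \o s i' : {rmorphism _ -> _}); exists i.
  have ee y : Fix kap y -> mu (s i y) = s i' y.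
    move=> Fy; rewrite -[RHS]K2; congr (mu _).
    exact/esym/(aut_eq_Fix (nu := mu' \o s i') Fy).
  split=> [|j]; first exact: ee.
  by apply: ee => nu nuk; rewrite rmorphXn nuk.
exists a; split=> [j|]; first by apply: fixed_Crat => nu; apply: aP.
have [i ik] := s_all (idfun : {rmorphism _ -> _}).
have e y : Fix kap y -> s i y = y.
  by move=> Fy; rewrite (aut_eq_Fix (nu := s i) (mu := idfun) Fy).
rewrite -[LHS]e // sx; apply: eq_bigr => j _.
by rewrite e // => nu nuk; rewrite rmorphXn nuk.
Qed.

End NumberField.

Lemma Aint_integralOver x : x \in Aint <-> integralOver (intr : int -> algC) x.
Proof.
split=> [Ax|[p mon_p px0]].
  have /floorpP[q Dq] : minCpoly x \is a polyOver Num.int by [].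
  exists q; last by rewrite -Dq root_minCpoly.
  have := minCpoly_monic x; rewrite Dq !monicE lead_coef_map_inj //; last exact: intr_inj.
  by rewrite -[1]/(1%:~R) eqr_int.
apply: root_monic_Aint px0 _ _; first by rewrite monic_map.
by apply/polyOverP => i; rewrite coef_map intr_int.
Qed.

Lemma Aint_root_monic (p : {poly algC}) x :
  p \is monic -> root p x -> p \is a polyOver Aint -> x \in Aint.
Proof.
move=> mon_p px0 /polyOverP Ap; apply/Aint_integralOver.
apply: (integral_root_monic mon_p px0) => _ /(nthP 0)[i _ <-].
exact/Aint_integralOver.
Qed.

Lemma Aint_exp_root (n : nat) (x : algC) :
  (0 < n)%N -> x ^+ n \in Aint -> x \in Aint.
Proof.
move=> n0 Ax; apply: (@Aint_root_monic ('X^n - (x ^+ n)%:P)).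
- exact: monicXnsubC.
- by rewrite /root !hornerE subrr.
- by rewrite rpredB ?rpredX ?polyOverX ?polyOverC.
Qed.

Lemma Aint_scale (z : algC) : exists N : nat, (0 < N)%N /\ N%:R * z \in Aint.
Proof.
have [p [Dp mon_p] _] := minCpolyP z.
have pz : root (map_poly ratr p) z by rewrite -Dp root_minCpoly.
pose n := (size p).-1.
have pn : size p = n.+1 by rewrite prednK // lt0n size_poly_eq0 monic_neq0.
have [N N0 Np] : exists2 N : nat, (0 < N)%N &
    forall i, (i <= n)%N -> (N%:R : rat) * p`_i \is a Num.int.
  elim: n.+1 {-2}n (ltnSn n) {pn} => // m IH [_|i].
    exists (`|denq p`_0|)%N; first by rewrite absz_gt0 denq_neq0.
    move=> i; rewrite leqn0 => /eqP->.
    have := numqE p`_0; rewrite mulrC -[denq p`_0]gez0_abs ?denq_ge0 //.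
    by move=> <-; rewrite intr_int.
  rewrite ltnS => /IH[N N0 NP].
  exists (N * `|denq p`_i.+1|)%N; first by rewrite muln_gt0 N0 absz_gt0 denq_neq0.
  move=> j; rewrite leq_eqVlt => /predU1P[->|]; last first.
    by rewrite ltnS => /NP ?; rewrite natrM mulrAC rpredM ?rpred_nat.
  have := numqE p`_i.+1; rewrite mulrC -[denq p`_i.+1]gez0_abs ?denq_ge0 //.
  by move=> e; rewrite natrM -mulrA -e rpredM ?rpred_nat ?intr_int.
exists N; split=> //.
(* The monic polynomial of which [N%:R * z] is a root; in degrees [i < n] one of the factors [N]
   clears the denominator of the coefficient. *)
pose q : {poly algC} := \poly_(i < n.+1) (ratr p`_i * N%:R ^+ (n - i)).
have qn : q`_n = 1.
  by rewrite coef_poly ltnSn subnn expr0 mulr1 /n -lead_coefE (monicP mon_p) rmorph1.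
have sq : size q = n.+1.
  apply/eqP; rewrite eqn_leq size_poly /=.
  by apply: contraT; rewrite -leqNgt => /leq_sizeP/(_ n (leqnn n))/eqP; rewrite qn oner_eq0.
apply: (@root_monic_Aint q).
- rewrite /root horner_poly; apply/eqP.
  move/rootP: pz => /(congr1 (fun y => N%:R ^+ n * y)); rewrite mulr0.
  apply: etrans; rewrite horner_coef size_map_poly pn mulr_sumr; apply: eq_bigr => i _.
  rewrite coef_map exprMn /=.
  have -> : N%:R ^+ n = N%:R ^+ (n - i) * N%:R ^+ i :> algC.
    by rewrite -exprD subnK // -ltnS.
  by ring.
- by rewrite monicE lead_coefE sq qn.
apply/polyOverP=> i; rewrite coef_poly; case: ltnP => [lei|_]; last exact: rpred0.
have [->|ltin] := eqVneq i n; first by rewrite subnn expr0 mulr1 /n -lead_coefE (monicP mon_p)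
  rmorph1 rpred1.
rewrite ltnS in lei; have lt_in : (i < n)%N by rewrite ltn_neqAle ltin.
rewrite -(subnSK lt_in) exprS mulrA rpredM ?rpredX ?rpred_nat //.
have -> : (ratr p`_i : algC) * N%:R = ratr (N%:R * p`_i) by rewrite rmorphM rmorph_nat mulrC.
by rewrite Cint_rat Np.
Qed.

(** The generator is an integral combination of [X], which puts it in every subfield containing [X],
    and conversely [X] consists of rational polynomials in it. A positive integer factor makes it an
    algebraic integer. *)
Lemma primitive_element (X : seq algC) : exists2 kap, kap \in Aint &
  (forall F : set algC, subfield F -> {in X, forall x, F x} -> F kap) /\
  forall nu, nu kap = kap <-> {in X, forall x, nu x = x}.
Proof.
have [z [a Dz] [ps Dps]] := algC_PET X.
have [N [N0 AN]] := Aint_scale z.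
have zsum (P : {pred algC}) : zmod_closed P -> {in X, forall x, x \in P} -> z \in P.
  move=> clP XP; rewrite Dz.
  pose PZ := GRing.isZmodClosed.Build _ _ clP.
  pose Q : zmodClosed algC := HB.pack P PZ.
  rewrite (_ : P = Q) // rpred_sum // => i _; rewrite rpredMn //.
  by apply: XP; rewrite mem_nth.
exists (N%:R * z) => //; split.
  move=> F FP XF.
  pose P : {pred algC} := [in F].
  have divP : divring_closed P by [].
  have -> : F (N%:R * z) = (N%:R * z \in P) by rewrite -[RHS]/(is_true (_ \in F)) in_setE.
  pose PZ := GRing.isDivringClosed.Build _ _ divP.
  pose Q : divringClosed algC := HB.pack P PZ.
  rewrite (_ : P = Q) // rpredM ?rpred_nat //.
  apply: zsum; last by move=> x /XF; rewrite -in_setE.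
  by split=> [|x y]; [apply: rpred0 | apply: rpredB].
move=> nu; split=> [nuz x|nuX].
  have {}nuz : nu z = z.
    have N_n0 : N%:R != 0 :> algC by rewrite pnatr_eq0 -lt0n.
    by apply: (mulfI N_n0); rewrite -[RHS]nuz rmorphM rmorph_nat.
  rewrite {1}Dps => /mapP[p _ ->]; rewrite -horner_map nuz -map_poly_comp.
  by congr (_.[_]); apply: eq_map_poly => y /=; rewrite fmorph_rat.
rewrite rmorphM rmorph_nat; congr (_ * _).
suff : z \in [pred x | nu x == x] by rewrite inE => /eqP.
apply: zsum => [|x /nuX]; last by rewrite inE => ->.
by split=> [|x y]; rewrite !inE ?rmorph0 // rmorphB => /eqP-> /eqP->.
Qed.

Section Subfield.
Variables (F : set algC) (FP : subfield F).

Let P : {pred algC} := [in F].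
Let PZ := GRing.isDivringClosed.Build _ P FP.
Let Q : divringClosed algC := HB.pack P PZ.
Let QE x : F x <-> x \in Q. Proof. by rewrite -[x \in Q]/(x \in F) in_setE. Qed.

Lemma sub0 : F 0. Proof. exact/QE/rpred0. Qed.
Lemma sub1 : F 1. Proof. exact/QE/rpred1. Qed.
Lemma subD x y : F x -> F y -> F (x + y).
Proof. by move=> /QE ? /QE ?; apply/QE/rpredD. Qed.
Lemma subB x y : F x -> F y -> F (x - y).
Proof. by move=> /QE ? /QE ?; apply/QE/rpredB. Qed.
Lemma subN x : F x -> F (- x).
Proof. by move=> /QE ?; apply/QE; rewrite rpredN. Qed.
Lemma subM x y : F x -> F y -> F (x * y).
Proof. by move=> /QE ? /QE ?; apply/QE/rpredM. Qed.
Lemma subV x : F x -> F x^-1.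
Proof. by move=> /QE ?; apply/QE; rewrite rpredV. Qed.
Lemma subX x n : F x -> F (x ^+ n).
Proof. by move=> /QE ?; apply/QE/rpredX. Qed.
Lemma sub_nat n : F n%:R. Proof. exact/QE/rpred_nat. Qed.
Lemma sub_int n : F n%:~R. Proof. exact/QE/rpred_int. Qed.
Lemma sub_sum (I : Type) (r : seq I) (p : pred I) f : (forall i, p i -> F (f i)) ->
  F (\sum_(i <- r | p i) f i).
Proof. by move=> Ff; apply/QE/rpred_sum => i /Ff/QE. Qed.
Lemma sub_prod (I : Type) (r : seq I) (p : pred I) f : (forall i, p i -> F (f i)) ->
  F (\prod_(i <- r | p i) f i).
Proof. by move=> Ff; apply/QE/rpred_prod => i /Ff/QE. Qed.
Lemma sub_Crat x : x \in Crat -> F x.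
Proof. by move=> /(@rpred_Crat Q)/QE. Qed.

End Subfield.

Lemma number_field_Fix k : number_field k -> exists2 kap, kap \in Aint & k = Fix kap.
Proof.
move=> [kP [X kX]]; have [kap Ak [genk fixk]] := primitive_element X.
have XP x : x \in X -> k x by move=> /mem_Crat_span xX; rewrite kX.
exists kap => //; apply/seteqP; split=> x.
  rewrite kX => /Crat_spanP[a ->] nu /fixk nuX.
  rewrite rmorph_sum; apply: eq_bigr => i _.
  by rewrite rmorphM fmorph_rat nuX // mem_nth.
have [D [s [s_inj s_all]]] := Fix_embeddings kap.
move=> /(Fix_repr s_inj s_all)[a [aQ ->]].
apply: sub_sum => // j _; apply: subM => //; first exact: sub_Crat.
by apply: subX => //; apply: genk.
Qed.

Lemma Fix_number_field kap : number_field (Fix kap).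
Proof.
split; first exact: Fix_subfield.
have [D [s [s_inj s_all]]] := Fix_embeddings kap.
exists [seq kap ^+ i | i <- iota 0 D]; apply/seteqP; split=> x /=.
  move=> /(Fix_repr s_inj s_all)[a [aQ ->]].
  apply: rpred_sum => j _; apply: Crat_spanM => //.
  by apply/mem_Crat_span/map_f; rewrite mem_iota /=.
move=> /Crat_spanP[a ->]; have FP := Fix_subfield kap.
apply: (sub_sum FP) => j _; apply: (subM FP); first exact: (sub_Crat FP (Crat_rat _)).
set y := nth _ _ _; have /mapP[i _ ->] : y \in [seq kap ^+ i | i <- iota 0 D] by apply: mem_nth.
by apply: (subX FP); apply: Fix_gen.
Qed.

(** [s] sends [kap] to one of its conjugates; an automorphism of [algC] doing the same agrees with
    [s] on all rational polynomials in [kap]. *)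
Lemma embedding_aut k kap s : subfield k -> k `<=` Fix kap ->
  embedding k (Fix kap) s -> exists nu, {in Fix kap, s =1 nu}.
Proof.
move=> kP kF [sk sD sM]; have FP := Fix_subfield kap.
have s1 : s 1 = 1 by apply: sk; rewrite in_setE; apply: (sub1 kP).
have s0 : s 0 = 0 by apply: sk; rewrite in_setE; apply: (sub0 kP).
have FX n : Fix kap (kap ^+ n) by apply: (subX FP); apply: Fix_gen.
have sX n : s (kap ^+ n) = s kap ^+ n.
  elim: n => [|n IH]; first by rewrite !expr0.
  by rewrite !exprS sM ?IH // in_setE //; apply: (FX 1).
have ssum (I : eqType) (r : seq I) (f : I -> algC) : (forall i, Fix kap (f i)) ->
    s (\sum_(i <- r) f i) = \sum_(i <- r) s (f i).
  move=> Ff; elim: r => [|i r IH]; first by rewrite !big_nil.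
  by rewrite !big_cons sD ?IH // in_setE //; apply: (sub_sum FP).
have spoly n (a : 'I_n -> algC) : (forall i, a i \in Crat) ->
    s (\sum_(i < n) a i * kap ^+ i) = \sum_(i < n) a i * s kap ^+ i.
  move=> aQ; rewrite ssum => [|i]; last first.
    by apply: (subM FP); [apply: (sub_Crat FP)|apply: FX].
  apply: eq_bigr => i _; rewrite sM ?sX.
  - by rewrite sk // in_setE; apply: sub_Crat.
  - by rewrite in_setE; apply: (sub_Crat FP).
  - by rewrite in_setE; apply: FX.
have [|nu nuk] := @conjugate_aut kap (s kap).
  have [p [Dp _] _] := minCpolyP kap; have := root_minCpoly kap.
  rewrite Dp /root horner_coef [X in _ -> X == 0]horner_coef !size_map_poly.
  have aQ (i : 'I_(size p)) : (map_poly (ratr : rat -> algC) p)`_i \in Crat.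
    by rewrite coef_map Crat_rat.
  by move/eqP => e; rewrite -(spoly _ (fun i => (map_poly ratr p)`_i) aQ) e s0.
exists nu => x; rewrite in_setE.
have [D [t [t_inj t_all]]] := Fix_embeddings kap.
move=> /(Fix_repr t_inj t_all)[a [aQ ->]]; rewrite spoly // rmorph_sum.
by apply: eq_bigr => j _; rewrite rmorphM rmorphXn nuk (aut_Crat _ (aQ j)).
Qed.

Lemma nat_bound (I : finType) (f : I -> algC) :
  exists C : nat, forall i, `|f i| <= C%:R.
Proof.
exists (\sum_i Num.bound `|f i|)%N => i.
rewrite (le_trans (ltW (archi_boundP (normr_ge0 _)))) // ler_nat.
by rewrite (bigD1 i) //= leq_addr.
Qed.

(** An incomplete list can be extended, at most [n] times; the auxiliary [m] counts the extensions
    still possible. *)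
Lemma listing (T : choiceType) (P : T -> Prop) (n : nat) :
  (forall X : seq T, uniq X -> {in X, forall x, P x} -> (size X <= n)%N) ->
  exists X : seq T, uniq X /\ forall x, P x <-> x \in X.
Proof.
move=> Pn.
suff H m : (m <= n)%N ->
    (exists X : seq T, [/\ uniq X, {in X, forall x, P x} & size X = (n - m)%N]) ->
    exists X : seq T, uniq X /\ forall x, P x <-> x \in X.
  by apply: (H n) => //; exists [::]; rewrite subnn.
elim: m => [|m IH] mn [X [uX XP sX]]; have [Xall|] := pselect (forall x, P x -> x \in X).
- by exists X; split=> // x; split=> [/Xall|/XP].
- move=> /existsNP[x] /not_implyP[Px xX].
  have := Pn (x :: X); rewrite /= (introN idP xX) uX sX subn0 ltnn => H.
  by suff: false by []; apply: H => // y; rewrite inE => /predU1P[->|/XP].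
- by exists X; split=> // x; split=> [/Xall|/XP].
- move=> /existsNP[x] /not_implyP[Px xX].
  apply: IH; first exact: ltnW.
  exists (x :: X); split; rewrite /= ?(introN idP xX) ?uX ?sX ?subnSK //.
  by move=> y; rewrite inE => /predU1P[->|/XP].
Qed.

Section Norm.
Variables (kap : algC) (D : nat) (s : 'I_D -> {rmorphism algC -> algC}).
Hypothesis s_inj : injective (fun i => s i kap).
Hypothesis s_all : forall nu, exists i, nu kap = s i kap.

Local Notation F := (Fix kap).
Let FP := Fix_subfield kap.

(** On F this is the norm from F to Q, independent of how the automorphisms [s i] extend the
    embeddings of F. *)
Definition nrm x := \prod_i s i x.

Lemma Fix_pow j : F (kap ^+ j).
Proof. by apply: (subX FP); apply: Fix_gen. Qed.

Lemma s_id : exists i0, forall x, F x -> s i0 x = x.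
Proof.
have [i ik] := s_all (idfun : {rmorphism _ -> _}); exists i => x Fx.
by rewrite (aut_eq_Fix (nu := s i) (mu := idfun) Fx).
Qed.

Lemma s_allF nu : exists i, forall x, F x -> nu x = s i x.
Proof. by have [i ik] := s_all nu; exists i => x Fx; apply: (aut_eq_Fix Fx). Qed.

Lemma nrm_fixed x mu : F x -> mu (nrm x) = nrm x.
Proof.
move=> Fx; have sP i : {i' | mu (s i kap) = s i' kap}.
  exact/cid/(s_all (mu \o s i : {rmorphism _ -> _})).
pose p i := sval (sP i).
have pE i : mu (s i kap) = s (p i) kap by rewrite /p; case: (sP i).
have p_inj : injective p.
  by move=> i j e; apply/s_inj/(fmorph_inj mu); rewrite !pE e.
rewrite /nrm rmorph_prod [RHS](reindex_inj p_inj); apply: eq_bigr => i _.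
exact: (aut_eq_Fix (nu := mu \o s i) Fx (pE i)).
Qed.

Lemma nrm_int x : integers F x -> nrm x \in Num.int.
Proof.
move=> [Fx Ax]; apply: Cint_rat_Aint.
  by apply: fixed_Crat => mu; apply: nrm_fixed.
by apply: rpred_prod => i _; rewrite Aint_aut.
Qed.

Lemma nrm_eq0 x : nrm x = 0 -> x = 0.
Proof. by move/eqP/prodf_eq0 => [i _]; rewrite fmorph_eq0 => /eqP. Qed.

Lemma nrm_le x (B : algC) : (forall i, `|s i x| <= B) -> `|nrm x| <= B ^+ D.
Proof.
move=> xB; rewrite /nrm normr_prod -[D in B ^+ D]card_ord -prodr_const.
by apply: ler_prod => i _; rewrite normr_ge0 xB.
Qed.

Lemma D_gt0 : (0 < D)%N.
Proof. by have [i _] := s_id; case: (D) i => [[]|]. Qed.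

(** Otherwise the norm would be a nonzero integer of absolute value less than 1. *)
Lemma small_eq0 x : integers F x -> (forall i, `|s i x| < 1) -> x = 0.
Proof.
move=> Ox xlt; apply: nrm_eq0; apply/eqP; rewrite -[_ == _]negbK.
apply/negP => /(norm_intr_ge1 (nrm_int Ox)).
apply/negP; rewrite -real_ltNge ?ger0_real ?normr_ge0 //.
have [i0 _] := s_id.
rewrite /nrm normr_prod (bigD1 i0) //= (le_lt_trans _ (xlt i0)) //.
rewrite -[leRHS]mulr1 ler_wpM2l ?normr_ge0 //.
by apply: prodr_ile1 => i _; rewrite normr_ge0 ltW.
Qed.

Lemma coord_bound : exists C : nat, forall (a : 'I_D -> algC) (B : algC),
  (forall j, a j \in Crat) -> 0 <= B ->
  (forall i, `|s i (\sum_j a j * kap ^+ j)| <= B) -> forall j, `|a j| <= C%:R * B.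
Proof.
pose W := \matrix_(i, j < D) s i (kap ^+ j).
have uW : W \in unitmx by rewrite unitmxE unitfE; apply: Fix_det.
have [C CP] := nat_bound (fun ij : 'I_D * 'I_D => invmx W ij.1 ij.2).
exists (C * D)%N => a B aQ B0 aB j.
pose c : 'cV_D := \col_i s i (\sum_j a j * kap ^+ j).
have aE : \col_j a j = invmx W *m c.
  rewrite -[LHS](mulKmx uW); congr (_ *m _).
  apply/colP=> i; rewrite !mxE rmorph_sum; apply: eq_bigr => j' _.
  by rewrite !mxE rmorphM (aut_Crat _ (aQ j')) mulrC.
have /colP/(_ j) := aE; rewrite mxE => ->; rewrite mxE.
apply: (le_trans (ler_norm_sum _ _ _)).
rewrite natrM -mulrA [D%:R * B]mulrC [B * _]mulr_natr mulrnAr.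
rewrite -[D in leRHS]card_ord -sumr_const.
apply: ler_sum => i _; rewrite normrM.
by apply: ler_pM; rewrite ?normr_ge0 // ?(CP (j, i)) // mxE aB.
Qed.

Lemma pow_bound : exists C : nat, forall (a : 'I_D -> algC) (B : algC) nu,
  (forall j, a j \in Crat) -> 0 <= B -> (forall j, `|a j| <= B) ->
  `|nu (\sum_j a j * kap ^+ j)| <= C%:R * B.
Proof.
have [C CP] := nat_bound (fun ij : 'I_D * 'I_D => s ij.1 (kap ^+ ij.2)).
exists (C * D)%N => a B nu aQ B0 aB.
rewrite rmorph_sum (le_trans (ler_norm_sum _ _ _)) //.
rewrite natrM -mulrA [D%:R * B]mulrC [B * _]mulr_natr mulrnAr.
rewrite -[D in leRHS]card_ord -sumr_const.
apply: ler_sum => j _; rewrite rmorphM normrM mulrC (aut_Crat _ (aQ j)).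
have [i ik] := s_allF nu.
by apply: ler_pM; rewrite ?normr_ge0 // ik ?(CP (i, j)) //; apply: Fix_pow.
Qed.

(** The powers of [kap] need not generate the ring of integers, so the coordinates are merely
    rational. They are rounded down to multiples of [1 / M]; as [M] exceeds [C2], two integers with
    the same rounding have a difference whose conjugates are less than 1, and they coincide by
    [small_eq0]. *)
Lemma small_count : exists C : nat, forall (B : nat) (X : seq algC),
  (0 < B)%N -> uniq X ->
  {in X, forall x, integers F x /\ forall i, `|s i x| <= B%:R} ->
  (size X <= C * B ^ D)%N.
Proof.
have [C1 C1P] := coord_bound; have [C2 C2P] := pow_bound.
pose M := C2.+1; pose C3 := (M * C1).+1.
exists ((2 * C3) ^ D)%N => B X B0 uX XP.
have [->|[x0 Xx0]] : X = [::] \/ exists x0, x0 \in X.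
    by case: (X) => [|x l]; [left|right; exists x; rewrite inE eqxx].
  by [].
pose good (x : algC) (a : 'I_D -> algC) := (forall j, a j \in Crat) /\ x = \sum_j a j * kap ^+ j.
have a_ex (x : algC) : {a : 'I_D -> algC | x \in X -> good x a}.
  apply: cid; have [/XP[[Fx _] _]|_] := boolP (x \in X); last by exists (fun=> 0).
  by have [a aP] := Fix_repr s_inj s_all Fx; exists a.
pose a x := sval (a_ex x).
have aP x : x \in X -> good x (a x) by rewrite /a; case: (a_ex x).
have a_le x j : x \in X -> `|a x j| <= C1%:R * B%:R.
  move=> Xx; have [aQ xE] := aP x Xx.
  by apply: C1P => // i; rewrite -xE; apply: (XP x Xx).2.
have aR x j : x \in X -> M%:R * a x j \is Num.real.
  move=> /aP[aQ _]; apply: Creal_Crat.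
  by rewrite rpredM ?aQ // rpred_nat.
(* The summand [C3 * B] makes the rounded coordinates nonnegative, so that they index a box of side
   [2 * C3 * B]. *)
pose f x j := (Num.floor (M%:R * a x j) + (C3 * B)%:Z)%R.
have f_ge x j : x \in X -> 0 <= f x j < (2 * C3 * B)%:Z.
  move=> Xx; have := real_floor_itv (aR x j Xx); move=> /andP[h1 h2].
  have h3 : `|M%:R * a x j| <= (M * C1 * B)%:R.
    by rewrite normrM normr_nat !natrM -mulrA ler_wpM2l // a_le.
  have h4 := h3; rewrite real_ler_norml ?aR // in h4; move/andP: h4 => [h4 h5].
  have h6 : (Num.floor (M%:R * a x j))%:~R <= (M * C1 * B)%:Z%:~R :> algC.
    by apply: le_trans h1 h5.
  have h7 : (- (M * C1 * B)%:Z)%:~R < (Num.floor (M%:R * a x j) + 1)%:~R :> algC.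
    by apply: le_lt_trans h2; rewrite rmorphN.
  rewrite ler_int in h6; rewrite ltr_int in h7.
  rewrite /f /C3; move: h6 h7; set y := Num.floor _; set z := (M * C1)%N.
  by move: B0; clear; move=> B0 h6 h7; nia.
pose N := (2 * C3 * B).-1.
have NE : N.+1 = (2 * C3 * B)%N by rewrite prednK // !muln_gt0 B0.
pose g (x : algC) : {ffun 'I_D -> 'I_N.+1} := [ffun j => inord `|f x j|%N].
have g_inj : {in X &, injective g}.
  move=> x y Xx Xy gxy.
  have fxy j : f x j = f y j.
    have := congr1 (fun h : {ffun 'I_D -> 'I_N.+1} => val (h j)) gxy.
    move: (f_ge x j Xx) (f_ge y j Xy) => /andP[x0' xN] /andP[y0 yN].
    rewrite /= !ffunE !inordK ?NE -?ltz_nat ?gez0_abs // => e.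
    by rewrite -(gez0_abs x0') -(gez0_abs y0) e.
  apply/eqP; rewrite -subr_eq0; apply/eqP.
  have [[Fx Ax] _] := XP x Xx; have [[Fy Ay] _] := XP y Xy.
  have [axQ xE] := aP x Xx; have [ayQ yE] := aP y Xy.
  apply: small_eq0.
    by split; [apply: (subB FP)|apply: rpredB].
  have -> : x - y = \sum_j (a x j - a y j) * kap ^+ j.
    by rewrite {1}xE {1}yE -sumrB; apply: eq_bigr => j _; rewrite mulrBl.
  move=> i; apply: (@le_lt_trans _ _ (C2%:R * M%:R^-1)).
    apply: C2P => [j||j]; first by rewrite rpredB ?axQ ?ayQ.
      by rewrite invr_ge0 ler0n.
    rewrite -[leRHS]mul1r ler_pdivlMr ?ltr0n // -[M%:R]normr_nat -normrM.
    have := real_floor_itv (aR x j Xx); move=> /andP[h1 h2].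
    have := real_floor_itv (aR y j Xy); move=> /andP[h3 h4].
    have := fxy j; rewrite /f => /addIr e.
    rewrite real_ler_norml ?mulrBl; last first.
      by rewrite rpredB // mulrC ?aR.
    rewrite ![_ * M%:R]mulrC; rewrite e in h1 h2.
    move: h1 h2 h3 h4; set u := _ * a x j; set v := _ * a y j; set w := _%:~R.
    rewrite intrD rmorph1 => h1 h2 h3 h4.
    have h2' := ltW h2; have h4' := ltW h4; rewrite -/w in h2' h4'.
    rewrite lerBlDr lerBrDr; apply/andP; split.
      by rewrite addrC lerBlDr (le_trans h4') // lerD2r.
    by rewrite (le_trans h2') // addrC lerD2l.
  by rewrite ltr_pdivrMr ?ltr0n // mul1r ltr_nat.
have -> : size X = #|[seq g x | x <- X]|.
  by rewrite (card_uniqP _) ?size_map // map_inj_in_uniq.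
rewrite (leq_trans (max_card _)) // card_ffun !card_ord NE.
by rewrite expnMn.
Qed.

End Norm.

(** * Ideals of rings of integers *)

Section Integers.
Variables (F : set algC) (FP : subfield F).
Local Notation O := (integers F).

Lemma int0 : O 0. Proof. by split; [apply: (sub0 FP)|apply: rpred0]. Qed.
Lemma int1 : O 1. Proof. by split; [apply: (sub1 FP)|apply: rpred1]. Qed.
Lemma intD x y : O x -> O y -> O (x + y).
Proof. by move=> [? ?] [? ?]; split; [apply: (subD FP)|apply: rpredD]. Qed.
Lemma intB x y : O x -> O y -> O (x - y).
Proof. by move=> [? ?] [? ?]; split; [apply: (subB FP)|apply: rpredB]. Qed.
Lemma intN x : O x -> O (- x).
Proof. by move=> [? ?]; split; [apply: (subN FP)|rewrite rpredN]. Qed.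
Lemma intM x y : O x -> O y -> O (x * y).
Proof. by move=> [? ?] [? ?]; split; [apply: (subM FP)|apply: rpredM]. Qed.
Lemma intX x n : O x -> O (x ^+ n).
Proof. by move=> [? ?]; split; [apply: (subX FP)|apply: rpredX]. Qed.
Lemma int_nat n : O n%:R.
Proof. by split; [apply: (sub_nat FP)|apply: rpred_nat]. Qed.
Lemma int_int n : O n%:~R.
Proof. by split; [apply: (sub_int FP)|apply: rpred_int]. Qed.
Lemma int_sum (T : Type) (r : seq T) (p : pred T) f : (forall i, p i -> O (f i)) ->
  O (\sum_(i <- r | p i) f i).
Proof.
by move=> Of; split; [apply: (sub_sum FP)|apply: rpred_sum] => i /Of[].
Qed.
Lemma int_prod (T : Type) (r : seq T) (p : pred T) f : (forall i, p i -> O (f i)) ->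
  O (\prod_(i <- r | p i) f i).
Proof.
by move=> Of; split; [apply: (sub_prod FP)|apply: rpred_prod] => i /Of[].
Qed.

Lemma idealB I x y : ideal F I -> I x -> I y -> I (x - y).
Proof.
move=> [_ _ ID IM] Ix Iy; apply: ID => //; rewrite -mulN1r.
by apply: IM => //; apply: intN; apply: int1.
Qed.

Lemma ideal_sum I (T : Type) {r : seq T} {p : pred T} f : ideal F I ->
  (forall i, p i -> I (f i)) -> I (\sum_(i <- r | p i) f i).
Proof.
move=> [_ I0 ID _] If; elim: r => [|i r IH]; first by rewrite big_nil.
by rewrite big_cons; case: ifP => // /If ?; apply: ID.
Qed.

Lemma idealMr I x a : ideal F I -> O a -> I x -> I (x * a).
Proof. by move=> [_ _ _ IM] ? ?; rewrite mulrC; apply: IM. Qed.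

Lemma ideal_prod I (T : eqType) (r : seq T) f i : ideal F I ->
  (forall i, O (f i)) -> i \in r -> I (f i) -> I (\prod_(i <- r) f i).
Proof.
move=> iI Of ir Ii; rewrite (perm_big _ (perm_to_rem ir)) big_cons.
by apply: idealMr => //; apply: int_prod.
Qed.

Lemma ideal_integers : ideal F O.
Proof.
by split=> // [|x y|x y]; [apply: int0|apply: intD|apply: intM].
Qed.

Lemma ideal_one I : ideal F I -> I 1 -> I = O.
Proof.
move=> [IO _ _ IM] I1; apply/seteqP; split=> // x Ox.
by rewrite -[x]mulr1; apply: IM.
Qed.

Definition mult (d : algC) : set algC := [set d * y | y in O].

Lemma ideal_mult d : O d -> ideal F (mult d).
Proof.
move=> Od; split.
- by move=> _ [y Oy <-]; apply: intM.
- by exists 0; rewrite ?mulr0 //; apply: int0.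
- by move=> _ _ [y Oy <-] [z Oz <-]; exists (y + z); rewrite ?mulrDr //; apply: intD.
- by move=> a _ Oa [y Oy <-]; exists (a * y); rewrite 1?mulrCA //; apply: intM.
Qed.

Lemma sub_generated D : D `<=` ideal_generated F D.
Proof. exact: sub_smallest. Qed.

Lemma generated_least D I : ideal F I -> D `<=` I -> ideal_generated F D `<=` I.
Proof. by move=> iI DI; apply: smallest_sub. Qed.

Lemma ideal_generated_ideal D : D `<=` O -> ideal F (ideal_generated F D).
Proof.
move=> DO; split.
- exact: (generated_least ideal_integers).
- by move=> I [[_ I0 _ _] _].
- by move=> x y Gx Gy I [iI DI]; case: (iI) => _ _ ID _; apply: ID; [apply: Gx|apply: Gy].
- by move=> a x Oa Gx I [iI DI]; case: (iI) => _ _ _ IM; apply: IM => //; apply: Gx.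
Qed.

Lemma ideal_mul_ideal I J : ideal F I -> ideal F J -> ideal F (ideal_mul F I J).
Proof.
move=> [IO _ _ _] [JO _ _ _]; apply: ideal_generated_ideal.
by move=> z [x [y [/IO ? /JO ? ->]]]; apply: intM.
Qed.

Lemma ideal_mulP I J x y : I x -> J y -> ideal_mul F I J (x * y).
Proof. by move=> Ix Jy; apply: sub_generated; exists x, y. Qed.

Lemma ideal_mul_subl I J : ideal F I -> ideal F J -> ideal_mul F I J `<=` I.
Proof.
move=> iI iJ; apply: generated_least => // z [x [y [Ix Jy ->]]].
by apply: idealMr => //; case: iJ => + _ _ _; apply.
Qed.

Lemma ideal_mul_subr I J : ideal F I -> ideal F J -> ideal_mul F I J `<=` J.
Proof.
move=> iI iJ; apply: generated_least => // z [x [y [Ix Jy ->]]].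
by case: (iJ) => _ _ _; apply => //; case: iI => + _ _ _; apply.
Qed.

Lemma foldr_ideal Ps : {in Ps, forall P, ideal F P} ->
  ideal F (foldr (ideal_mul F) O Ps).
Proof.
elim: Ps => [_|P Ps IH PsP] /=; first exact: ideal_integers.
apply: ideal_mul_ideal; first by apply: PsP; rewrite mem_head.
by apply: IH => Q QPs; apply: PsP; rewrite inE QPs orbT.
Qed.

Lemma foldr_sub Ps : {in Ps, forall P, ideal F P} ->
  {in Ps, forall P, foldr (ideal_mul F) O Ps `<=` P}.
Proof.
elim: Ps => [//|P Ps IH PsP] Q /=.
have iP : ideal F P by apply: PsP; rewrite mem_head.
have PsP' : {in Ps, forall P, ideal F P}.
  by move=> Q' Q'Ps; apply: PsP; rewrite inE Q'Ps orbT.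
have iPs := foldr_ideal PsP'.
rewrite inE => /predU1P[->|QPs]; first exact: ideal_mul_subl.
by apply: subset_trans (IH PsP' Q QPs); apply: ideal_mul_subr.
Qed.

(* For a nonzero ideal this means having no repeated prime factor, see
   [radical_factorization] and [prod_primes_radical]. *)
Definition radical I := forall x, O x -> I (x ^+ 2) -> I x.

Lemma radicalX I x n : ideal F I -> radical I -> O x -> I (x ^+ n.+1) -> I x.
Proof.
move=> iI rI; have [_ _ _ IM] := iI.
have [m le_n] : exists m, (n.+1 <= 2 ^ m)%N by exists n.+1; apply: ltnW; apply: ltn_expl.
move=> Ox Ixn; have : I (x ^+ (2 ^ m)).
  by rewrite -(subnK le_n) exprD; apply: IM => //; apply: intX.
elim: m {le_n} => [|m IH]; first by rewrite expn0 expr1.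
by rewrite expnS mulnC exprM => ?; apply: IH; apply: rI => //; apply: intX.
Qed.

Lemma prime_X P x n : prime_ideals F P -> O x -> P (x ^+ n) -> P x.
Proof.
move=> [iP _ P1 PM] Ox; elim: n => [|n IH]; first by rewrite expr0 => /P1.
by rewrite exprS => /PM[] //; apply: intX.
Qed.

Lemma prime_prodN P (T : Type) (r : seq T) (f : T -> algC) (p : pred T) :
  prime_ideals F P -> (forall i, O (f i)) -> (forall i, p i -> ~ P (f i)) ->
  ~ P (\prod_(i <- r | p i) f i).
Proof.
move=> [iP _ P1 PM] Of Pf; elim: r => [|i r IH]; first by rewrite big_nil.
rewrite big_cons; case: ifP => // pi /PM[] //; last exact: Pf.
by apply: int_prod.
Qed.

End Integers.

Section NumberFieldIdeals.
Variables (kap : algC) (Akap : kap \in Aint).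
Local Notation F := (Fix kap).
Local Notation O := (integers F).
Let FP : subfield F := Fix_subfield kap.

(** A division whose remainder is bounded in terms of [d]: the quotient [y] is [x / d] with its
    rational coordinates rounded down. *)
Lemma reduce_mod D (s : 'I_D -> {rmorphism algC -> algC}) :
  injective (fun i => s i kap) -> (forall nu, exists i, nu kap = s i kap) ->
  exists C : nat, forall d x (B : algC), O d -> d != 0 -> O x ->
    (forall i, `|s i d| <= B) ->
    exists2 y, O y & forall i, `|s i (x - d * y)| <= C%:R * B.
Proof.
move=> s_inj s_all; have [C CP] := pow_bound s_all.
exists C => d x B [Fd Ad] d0 [Fx Ax] dB.
have [a [aQ aE]] := Fix_repr s_inj s_all (subM FP Fx (subV FP Fd)).
have aR j : a j \is Num.real by apply: Creal_Crat.
pose y := \sum_j (Num.floor (a j))%:~R * kap ^+ j.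
have Oy : O y.
  split; last by apply: rpred_sum => j _; rewrite rpredM ?rpredX ?rpred_int.
  by apply: (sub_sum FP) => j _; apply: (subM FP); [apply: (sub_int FP)|apply: Fix_pow].
exists y => // i.
have -> : x - d * y = d * (\sum_j (a j - (Num.floor (a j))%:~R) * kap ^+ j).
  rewrite -[x in LHS](divfK d0) aE mulrC -mulrBr -sumrB; congr (_ * _).
  by apply: eq_bigr => j _; rewrite mulrBl.
rewrite rmorphM normrM mulrC -[C%:R]mulr1.
apply: ler_pM; rewrite ?normr_ge0 //; apply: CP => // j.
  by rewrite rpredB ?rpred_int.
have /andP[h1 h2] := real_floor_itv (aR j).
rewrite ger0_norm ?subr_ge0 //; rewrite intrD rmorph1 in h2.
by rewrite lerBlDr addrC ltW.
Qed.

Lemma finite_reps (m : nat) : (0 < m)%N -> exists2 l : seq algC,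
  {in l, forall r, O r} & forall x, O x -> exists2 r, r \in l & mult F m%:R (x - r).
Proof.
move=> m0; have [D [s [s_inj s_all]]] := Fix_embeddings kap.
have [C CP] := reduce_mod s_inj s_all.
have [C' C'P] := small_count s_inj s_all.
have [] := @listing _ (fun x => O x /\ forall i, `|s i x| <= (C * m).+1%:R)
             (C' * (C * m).+1 ^ D)%N.
  by move=> X uX XP; apply: C'P.
move=> l [ul lP]; exists l => [r /lP[]//|x Ox].
have [||i|y Oy yP] := CP m%:R x m%:R _ _ Ox _.
- exact: int_nat.
- by rewrite pnatr_eq0 -lt0n.
- by rewrite rmorph_nat normr_nat.
exists (x - m%:R * y); last by exists y => //; rewrite opprB addrC subrK.
apply/lP; split; first by apply: intB => //; apply: intM => //; apply: int_nat.
by move=> i; rewrite (le_trans (yP i)) // -natrM ler_nat leqnSn.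
Qed.

Lemma ideal_int I x : ideal F I -> I x -> x != 0 -> exists2 m : nat, (0 < m)%N & I m%:R.
Proof.
move=> iI Ix x0; have [IO _ _ IM] := iI.
have [Fx Ax] := IO x Ix.
have [D [s [s_inj s_all]]] := Fix_embeddings kap.
have Nint := nrm_int s_inj s_all (IO x Ix).
have N0 : nrm s x != 0 by apply/eqP => /nrm_eq0 /eqP; rewrite (negPf x0).
have IN : I (nrm s x).
  have [i0 i0P] := s_id s_all.
  have Nx : nrm s x / x \in Aint.
    rewrite /nrm (bigD1 i0) //= i0P // mulrC mulKf //.
    by apply: rpred_prod => i _; rewrite Aint_aut.
  rewrite -(divfK x0 (nrm s x)); apply: IM => //; split=> //.
  apply: (subM FP); last by apply: (subV FP).
  by move=> nu _; apply: (nrm_fixed s_inj s_all).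
move: N0 IN; have /intrP[z ->] := Nint; rewrite intr_eq0 => z0 Iz.
exists `|z|%N; first by rewrite absz_gt0.
have [z_ge0|z_lt0] := leP 0 z.
  by rewrite -[_%:R]/((`|z|%N : int)%:~R) gez0_abs.
rewrite -[_%:R]/((`|z|%N : int)%:~R) ltz0_abs // rmorphN -[- _]sub0r.
by apply: (idealB FP) => //; case: iI.
Qed.

Lemma prime_int P : prime_ideals F P -> exists2 m : nat, (0 < m)%N & P m%:R.
Proof.
move=> [iP P0 _ _].
have [x [Px /eqP x0]] : exists x, P x /\ x <> 0.
  apply: contrapT => /forallNP H; apply: P0; apply/seteqP; split=> x.
    by move=> Px; apply: contrapT => x0; apply: (H x).
  by move=> ->; case: iP.
exact: ideal_int iP Px x0.
Qed.

(** Pigeonhole among the powers of [x] modulo [m]. This stands in for the structure of finite rings: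
    it yields inverses modulo a prime in [prime_max] and elements separating primes in
    [coprime_multiplier]. *)
Lemma pow_period (m : nat) x : (0 < m)%N -> O x ->
  exists a h : nat, mult F m%:R (x ^+ a * (1 - x ^+ h.+1)).
Proof.
move=> m0 Ox; have [l lO lP] := finite_reps m0.
have fP (j : 'I_(size l).+1) : {r : 'I_(size l) | mult F m%:R (x ^+ j - l`_r)}.
  apply: cid; have [r rl xr] := lP _ (intX FP j Ox).
  have lt_r : (index r l < size l)%N by rewrite index_mem.
  by exists (Ordinal lt_r); rewrite nth_index.
pose f j := sval (fP j).
have /injectivePn[i [j ij fij]] : ~~ injectiveb f.
  apply/injectiveP => /leq_card; rewrite !card_ord ltnn //.
wlog lt_ij : i j ij fij / (i < j)%N.
  move=> H; have [|] := ltnP i j; first exact: H.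
  by rewrite leq_eqVlt eq_sym (inj_eq val_inj) (negPf ij); apply: H; rewrite // eq_sym.
exists i, (j - i).-1; rewrite prednK ?subn_gt0 // mulrBr mulr1 -exprD subnKC 1?ltnW //.
have iM := ideal_mult FP (int_nat FP m).
have -> : x ^+ i - x ^+ j = (x ^+ i - l`_(f i)) - (x ^+ j - l`_(f j)).
  by rewrite fij opprB addrA subrK.
by apply: (idealB FP) => //; rewrite /f; case: (fP _).
Qed.

Lemma mult_sub I d : ideal F I -> I d -> mult F d `<=` I.
Proof. by move=> iI Id _ [y Oy <-]; apply: (@idealMr F). Qed.

Lemma prime_max P x : prime_ideals F P -> O x -> ~ P x -> exists2 r, O r & P (1 - x * r).
Proof.
move=> PP Ox Px; have [m m0 Pm] := prime_int PP.
have [iP _ _ PM] := PP.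
have [a [h /(mult_sub iP Pm)]] := pow_period m0 Ox.
have Oh : O (1 - x ^+ h.+1) by apply: intB => //; [apply: int1|apply: intX].
move=> /PM[] //; first exact: intX.
  by move=> /(prime_X FP PP Ox).
by exists (x ^+ h); [apply: intX|rewrite -exprS].
Qed.

Lemma prime_sub_eq P Q : prime_ideals F P -> prime_ideals F Q -> P `<=` Q -> P = Q.
Proof.
move=> PP PQ sPQ; apply/seteqP; split=> // x Qx; apply: contrapT => Px.
have [[iQ _ Q1 _] [iP _ _ _]] := (PQ, PP).
have Ox : O x by case: iQ => + _ _ _; apply.
have [r Or /sPQ Qr] := prime_max PP Ox Px; apply: Q1.
rewrite -(subrK (x * r) 1); have [_ _ QD _] := iQ; apply: QD => //.
exact: (@idealMr F).
Qed.

Section Modulus.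
Variables (m : nat) (m0 : (0 < m)%N).

(** [w] counts the representatives modulo [m] that lie in the ideal; it is the measure for ascending
    inductions on ideals containing [m]. *)
Lemma ideal_measure : exists (N : nat) (w : set algC -> nat),
  (forall I, (w I <= N)%N) /\ forall I J, ideal F I -> ideal F J -> I m%:R ->
     I `<=` J -> (exists2 x, J x & ~ I x) -> (w I < w J)%N.
Proof.
have [l lO lP] := finite_reps m0.
exists (size l), (fun I => count (fun r => `[< I r >]) l); split=> [I|I J iI iJ Im IJ [x Jx Ix]].
  exact: count_size.
have [r rl /(mult_sub iI Im) xr] : exists2 r, r \in l & mult F m%:R (x - r).
  by apply: lP; case: iJ => + _ _ _; apply.
have Jr : J r by rewrite -(subKr x r); apply: (idealB FP) => //; apply: IJ.
have Ir : ~ I r by move=> Ir; apply: Ix; rewrite -(subrK r x); case: iI => _ _ + _; apply.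
rewrite !(seq.permP (perm_to_rem rl)) /= (asboolT Jr) (asboolF Ir) ltnS.
by apply: sub_count => y /asboolP/IJ/asboolP.
Qed.

Lemma ideal_adjoin I x : ideal F I -> O x ->
  ideal F [set z | exists a r, [/\ I a, O r & z = a + x * r]].
Proof.
move=> iI Ox; have [IO I0 ID IM] := iI; split.
- by move=> _ [a [r [/IO Oa Or ->]]]; apply: intD => //; apply: intM.
- by exists 0, 0; rewrite mulr0 addr0; split=> //; apply: int0.
- move=> _ _ [a [r [Ia Or ->]]] [b [t [Ib Ot ->]]]; exists (a + b), (r + t).
  by split; [apply: ID|apply: intD|rewrite mulrDr addrACA].
- move=> c _ Oc [a [r [Ia Or ->]]]; exists (c * a), (c * r).
  by split; [apply: IM|apply: intM|rewrite mulrDr [x * (c * r)]mulrCA].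
Qed.

(** If [I] contains [x * y] but neither factor, then [x] is adjoined. The result is still proper:
    from [1 = a + x * r] with [a] in [I] one gets [y = y * a + x * y * r] in [I]. *)
Lemma maximal_exists I : ideal F I -> I m%:R -> ~ I 1 ->
  exists2 P, prime_ideals F P & I `<=` P.
Proof.
have [N [w [wN w_lt]]] := ideal_measure.
have [n] := ubnP (N - w I); elim: n I => // n IH I lt_n iI Im I1.
have [IO I0 ID IM] := iI.
have [PI|] := pselect (forall x y, O x -> O y -> I (x * y) -> I x \/ I y).
  exists I => //; split=> // I_0; have := Im; rewrite I_0 => /eqP.
  by rewrite pnatr_eq0 => /eqP m_0; move: (m0); rewrite m_0.
move=> /existsNP[x /existsNP[y /not_implyP[Ox /not_implyP[Oy /not_implyP[Ixy]]]]].
move=> /not_orP[Ix Iy].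
pose J : set algC := [set z | exists a r, [/\ I a, O r & z = a + x * r]].
have iJ : ideal F J by apply: ideal_adjoin.
have IJ : I `<=` J.
  by move=> a Ia; exists a, 0; rewrite mulr0 addr0; split=> //; apply: int0.
have Jx : J x by exists 0, 1; rewrite add0r mulr1; split=> //; apply: int1.
have lt_w : (w I < w J)%N by apply: w_lt => //; exists x.
have [||P PP JP] := IH J _ iJ (IJ _ Im).
- by move: lt_n (wN J) lt_w; lia.
- move=> [a [r [Ia Or e]]]; apply: Iy; rewrite -[y]mulr1 e mulrDr.
  apply: ID; first exact: IM.
  by rewrite mulrA [y * x]mulrC; apply: (@idealMr F).
- by exists P => //; apply: subset_trans JP.
Qed.

(* Multiplication by [s] replaces localization at [P]: the radical ideal [I] becomes [P]
   away from the other primes. *)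
Lemma coprime_multiplier I P : ideal F I -> radical F I -> I m%:R ->
  prime_ideals F P -> I `<=` P ->
  exists s, [/\ O s, ~ P s & forall x, P x -> I (s * x)].
Proof.
move=> iI rI Im PP IP; have [IO I0 ID IM] := iI; have [iP _ P1 PM] := PP.
have [l lO lP] := finite_reps m0.
suff [s [Os Ps sP]] : exists s, [/\ O s, ~ P s & {in l, forall r, P r -> I (s * r)}].
  exists s; split=> // x Px; have Ox : O x by case: iP => + _ _ _; apply.
  have [r rl /(mult_sub iI Im) xr] := lP x Ox.
  have Pr : P r by rewrite -(subKr x r); apply: (idealB FP) => //; apply: IP.
  by rewrite -(subrK r x) mulrDr; apply: ID; [apply: IM|apply: sP].
elim: l lO {lP} => [_|r l IH lO]; first by exists 1; split=> //; apply: int1.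
have [|s [Os Ps sP]] := IH; first by move=> x xl; apply: lO; rewrite inE xl orbT.
have Or : O r by apply: lO; rewrite mem_head.
have [Pr|Pr] := pselect (P r); last first.
  by exists s; split=> // x; rewrite inE => /predU1P[->//|]; apply: sP.
(* As [r] is in [P], the element [e] below is 1 modulo [P]. A power of [e * r] is a multiple of
   [r ^+ a * e], hence in [I], and radicality puts [e * r] itself in [I]. *)
have [a [h /(mult_sub iI Im) Ia]] := pow_period m0 Or.
pose e := 1 - r ^+ h.+1.
have Oe : O e by apply: intB => //; [apply: int1|apply: intX].
have Pe : ~ P e.
  move=> Pe; apply: P1; rewrite -(subrK (r ^+ h.+1) 1).
  have [_ _ PD _] := iP; apply: PD => //.
  by rewrite exprS; apply: (@idealMr F) => //; apply: intX.
exists (s * e); split; first exact: intM.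
  by move=> /PM[].
move=> x; rewrite inE => /predU1P[-> _|xl Px]; last first.
  by rewrite mulrAC; apply: (@idealMr F) => //; apply: sP.
rewrite -mulrA; apply: IM => //.
have Oer : O (e * r) by apply: intM.
apply: (@radicalX _ FP I _ a) => //.
have -> : (e * r) ^+ a.+1 = (e ^+ a * r) * (r ^+ a * e) by rewrite exprMn !exprS; ring.
by have [_ _ _] := iI; apply => //; apply: intM => //; apply: intX.
Qed.

(** The prime [P] is split off by the ideal quotient [J] of [I] by [P], again radical. It contains
    the multiplier [s], which is outside [P]: so [J] is strictly larger than [I], [P] does not occur
    in it again, and inverting [s] modulo [P] gives [I = P J]. *)
Lemma radical_factorization I : ideal F I -> radical F I -> I m%:R ->
  exists Ps : seq (set algC), [/\ uniq Ps, {in Ps, forall P, prime_ideals F P}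
      & I = foldr (ideal_mul F) O Ps].
Proof.
have [N [w [wN w_lt]]] := ideal_measure.
have [n] := ubnP (N - w I); elim: n I => // n IH I lt_n iI rI Im.
have [I1|I1] := pselect (I 1); first by exists [::]; split=> //; apply: ideal_one.
have [P PP IP] := maximal_exists iI Im I1.
have [s [Os Ps sP]] := coprime_multiplier iI rI Im PP IP.
have [IO I0 ID IM] := iI; have [iP _ P1 PM] := PP; have [PO P0 PD PMl] := iP.
pose J : set algC := [set x | O x /\ forall y, P y -> I (x * y)].
have iJ : ideal F J.
  split.
  - by move=> x [].
  - by split=> [|y _]; [apply: int0|rewrite mul0r].
  - move=> x y [Ox Jx] [Oy Jy]; split=> [|z Pz]; first exact: intD.
    by rewrite mulrDl; apply: ID; [apply: Jx|apply: Jy].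
  - move=> a x Oa [Ox Jx]; split=> [|z Pz]; first exact: intM.
    by rewrite -mulrA; apply: IM => //; apply: Jx.
have IJ : I `<=` J by move=> x Ix; split=> [|y /PO Oy]; [apply: IO|apply: (@idealMr F)].
have rJ : radical F J.
  move=> x Ox [_ Jx]; split=> // y Py; have Oy := PO y Py.
  apply: rI; first exact: intM.
  by rewrite exprMn expr2 mulrA -expr2; apply: (@idealMr F) => //; apply: Jx.
have Js : J s by [].
have lt_w : (w I < w J)%N by apply: w_lt => //; exists s => // /IP.
have [|Qs [uQs QsP JE]] := IH J _ iJ rJ (IJ _ Im).
  by move: lt_n (wN J) lt_w; lia.
have iQs : {in Qs, forall Q, ideal F Q} by move=> Q /QsP[].
exists (P :: Qs); split.
- rewrite /= uQs andbT; apply/negP => PQs; apply: Ps.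
  by apply: (foldr_sub FP iQs PQs); rewrite -JE.
- by move=> Q; rewrite inE => /predU1P[->//|/QsP].
rewrite /= -JE; apply/seteqP; split; last first.
  apply: (generated_least iI) => z [x [y [Px [Oy Jy] ->]]].
  by rewrite mulrC; apply: Jy.
move=> x Ix; have [r Or Psr] := prime_max PP Os Ps.
have iPJ := ideal_mul_ideal FP iP iJ; have [_ _ PJD _] := iPJ.
have -> : x = (1 - s * r) * x + x * (s * r).
  by rewrite mulrBl mul1r [x * _]mulrC subrK.
apply: PJD; first by apply: ideal_mulP => //; apply: IJ.
apply: ideal_mulP; first exact: IP.
exact: (@idealMr F).
Qed.

End Modulus.

(** Chinese remaindering: the product [c] of elements of the other primes, chosen outside [P], lies
    in the product of these primes and is invertible modulo [P]. *)
Lemma prod_primes_mem Ps : uniq Ps -> {in Ps, forall P, prime_ideals F P} ->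
  forall x, O x -> {in Ps, forall P, P x} -> foldr (ideal_mul F) O Ps x.
Proof.
elim: Ps => [//|P Ps IH] /= /andP[PPs uPs] PsP x Ox xP.
have PP : prime_ideals F P by apply: PsP; rewrite mem_head.
have [iP _ P1 PM] := PP.
have {}PsP : {in Ps, forall P, prime_ideals F P}.
  by move=> Q QPs; apply: PsP; rewrite inE QPs orbT.
have {}IH := IH uPs PsP.
have iPs : {in Ps, forall Q, ideal F Q} by move=> Q /PsP[].
have iJ := foldr_ideal FP iPs.
have b_ex (Q : set algC) : {b | Q \in Ps -> [/\ O b, Q b & ~ P b]}.
  apply: cid; have [QPs|_] := boolP (Q \in Ps); last by exists 0.
  apply: contrapT => /forallNP H.
  suff QP : Q = P by rewrite -QP QPs in PPs.
  apply: prime_sub_eq => //; first exact: PsP.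
  move=> b Qb; apply: contrapT => Pb; apply: (H b) => _; split=> //.
  by have [+ _ _ _] := iPs Q QPs; apply.
pose b Q := if Q \in Ps then sval (b_ex Q) else 1.
have bP Q : Q \in Ps -> [/\ O (b Q), Q (b Q) & ~ P (b Q)].
  by rewrite /b; case: (b_ex Q) => y /= yP QPs; have := yP QPs; rewrite QPs.
have Ob Q : O (b Q).
  by have [/bP[]//|QPs] := boolP (Q \in Ps); rewrite /b; case: ifP QPs => // _ _; apply: int1.
pose c := \prod_(Q <- Ps) b Q.
have Jc : foldr (ideal_mul F) O Ps c.
  apply: IH => [|Q QPs]; first exact: int_prod.
  by apply: (ideal_prod FP (iPs Q QPs) _ QPs) => //; case: (bP Q QPs).
have Pc : ~ P c.
  rewrite /c big_seq; apply: (prime_prodN FP PP) => // Q QPs.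
  by case: (bP Q QPs).
have Oc : O c by apply: int_prod.
have [r Or Pcr] := prime_max PP Oc Pc.
have -> : x = (1 - c * r) * x + x * (c * r).
  by rewrite mulrBl mul1r [x * _]mulrC subrK.
have [_ _ PJD _] := ideal_mul_ideal FP iP iJ; apply: PJD.
  apply: ideal_mulP => //; apply: IH => // Q QPs.
  by apply: xP; rewrite inE QPs orbT.
apply: ideal_mulP; first by apply: xP; rewrite mem_head.
exact: (@idealMr F).
Qed.

Lemma prod_primes_radical Ps : uniq Ps -> {in Ps, forall P, prime_ideals F P} ->
  radical F (foldr (ideal_mul F) O Ps).
Proof.
move=> uPs PsP x Ox Jx; apply: prod_primes_mem => // P PPs.
have iPs : {in Ps, forall Q, ideal F Q} by move=> Q /PsP[].
apply: (prime_X (n := 2) FP (PsP P PPs)) => //.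
exact: (foldr_sub FP iPs PPs).
Qed.

End NumberFieldIdeals.

Lemma ideal_nil_add F I x y n m : subfield F -> ideal F I ->
  integers F x -> integers F y -> I (x ^+ n) -> I (y ^+ m) -> I ((x + y) ^+ (n + m)).
Proof.
move=> FP iI Ox Oy Ix Iy; rewrite exprDn; apply: (ideal_sum iI) => i _.
have [_ _ _ IM] := iI.
rewrite -mulr_natl; apply: (IM); first exact: int_nat.
have [le_i|lt_i] := leqP m i.
  by rewrite -(subnK le_i) [y ^+ _]exprD mulrA; apply: (IM) => //; apply: intM => //; apply: intX.
have le_n : (n <= n + m - i)%N by rewrite -addnBA ?leq_addr // ltnW.
rewrite -(subnK le_n) exprD mulrAC; apply: (IM) => //.
by apply: intM => //; apply: intX.
Qed.

Lemma ideal_nil_sum F I (r : nat) (y : 'I_r -> algC) : subfield F -> ideal F I ->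
  (forall i, integers F (y i)) -> (forall i, I (y i ^+ 2)) ->
  exists n, I ((\sum_i y i) ^+ n).
Proof.
move=> FP iI; elim: r y => [|r IH] y Oy Iy.
  by exists 1; rewrite big_ord0 expr1; case: iI.
have [||n In] := IH (fun i => y (lift ord0 i)); [by move=> i|by move=> i|].
exists (2 + n); rewrite big_ord_recl; apply: (ideal_nil_add FP) => //.
exact: int_sum.
Qed.

(** * Radical ideals and discriminants *)

Section TraceForm.
Variables (K L : set algC) (KP : subfield K) (LP : subfield L) (KL : K `<=` L).
Variables (r : nat) (s : 'I_r -> {rmorphism algC -> algC}) (w : 'I_r -> algC).
Hypothesis sK : forall i x, K x -> s i x = x.
Hypothesis sL : forall i x, L x -> L (s i x).
Hypothesis wL : forall j, integers L (w j).
Hypothesis span : forall x, L x ->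
  exists a : 'I_r -> algC, (forall j, K (a j)) /\ x = \sum_j a j * w j.
Hypothesis trK : forall x, L x -> K (\sum_i s i x).
Variables (I : set algC) (iI : ideal K I) (rI : radical K I).
Local Notation R := (ideal_generated L I).
Hypothesis contraction : forall t, integers K t -> R t -> I t.

Lemma integers_sub x : integers K x -> integers L x.
Proof. by move=> [/KL Lx Ax]. Qed.

(* The conjugates of [x] are nilpotent modulo [R], hence the traces of the [x * w j] are nilpotent
   modulo [I] and lie in [I]; Cramer's rule recovers [x] from them up to [det^2]. *)
Lemma trace_radical x : integers L x -> R (x ^+ 2) ->
  R ((\det (\matrix_(i, j) s i (w j))) ^+ 2 * x).
Proof.
move=> Ox Rx; set W := \matrix_(i, j) _.
have IL : I `<=` integers L by case: iI => IK _ _ _ y /IK/integers_sub.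
have iR : ideal L R := ideal_generated_ideal LP IL.
have sO i y : integers L y -> integers L (s i y).
  by move=> [Ly Ay]; split; [apply: sL|rewrite Aint_aut].
have sR i : R `<=` [set y | integers L y /\ R (s i y)].
  apply: generated_least => [|y Iy]; last first.
    split; first exact: IL.
    case: iI => IK _ _ _; rewrite sK; last by case: (IK y Iy).
    exact: sub_generated.
  have [RO R0 RD RM] := iR; split.
  - by move=> y [].
  - by split; [apply: int0|rewrite rmorph0].
  - by move=> y z [Oy Ry] [Oz Rz]; split; [apply: intD|rewrite rmorphD; apply: RD].
  - move=> a y Oa [Oy Ry]; split; first exact: intM.
    by rewrite rmorphM; apply: RM => //; apply: sO.
have [_ _ RD RM] := iR.
have trO y : integers L y -> integers K (\sum_i s i y).
  move=> [Ly Ay]; split; first exact: trK.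
  by apply: rpred_sum => i _; rewrite Aint_aut.
pose t j := \sum_i s i (x * w j).
have It j : I (t j).
  have Oxw : integers L (x * w j) by apply: intM.
  have [||n Rn] := @ideal_nil_sum L R r (fun i => s i (x * w j)) LP iR.
  - by move=> i; apply: sO.
  - move=> i; have Rxw : R ((x * w j) ^+ 2).
      by rewrite exprMn; apply: (idealMr iR) => //; apply: intX.
    by rewrite -rmorphXn; have [_] := sR i _ Rxw.
  have Ot : integers K (t j) by apply: trO.
  apply: (@radicalX _ KP I _ n) => //.
  rewrite exprS; have [_ _ _ IM] := iI; apply: (IM) => //.
  by apply: contraction => //; apply: intX.
have [Lx _] := Ox; have [a [aK xE]] := span Lx.
pose G := W^T *m W.
have GE i j : G i j = \sum_k s k (w i * w j).
  by rewrite !mxE; apply: eq_bigr => k _; rewrite !mxE rmorphM.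
have GO i j : integers K (G i j).
  by rewrite GE; apply: trO; apply: intM.
have tE : \col_j t j = G *m \col_j a j.
  apply/colP=> j; rewrite !mxE /t.
  transitivity (\sum_k \sum_j' a j' * s k (w j' * w j)).
    apply: eq_bigr => k _; rewrite {1}xE mulr_suml rmorph_sum.
    by apply: eq_bigr => j' _; rewrite -mulrA rmorphM sK.
  rewrite exchange_big; apply: eq_bigr => j' _ /=.
  by rewrite GE mxE -mulr_sumr mulrC; congr (_ * _); apply: eq_bigr => k _; rewrite mulrC.
have detE : \det W ^+ 2 = \det G by rewrite det_mulmx det_tr expr2.
have daI j : I (\det W ^+ 2 * a j).
  have /colP/(_ j) : \adj G *m (\col_j t j) = \det G *: \col_j a j.
    by rewrite tE mulmxA mul_adj_mx mul_scalar_mx.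
  rewrite [in RHS]mxE [in RHS]mxE -detE => <-; rewrite mxE.
  apply: (ideal_sum iI) => i _; rewrite [in X in I (_ * X)]mxE.
  have [_ _ _ IM] := iI; apply: (IM) => //.
  rewrite mxE /cofactor.
  have Odet n (M : 'M[algC]_n) : (forall i j, integers K (M i j)) -> integers K (\det M).
    move=> OM; apply: (int_sum KP) => u _; apply: (intM KP).
      by apply: (intX KP); apply: (intN KP); apply: int1.
    exact: (int_prod KP).
  apply: (intM KP); first by apply: (intX KP); apply: (intN KP); apply: int1.
  by apply: Odet => i' j'; rewrite 2!mxE; apply: GO.
rewrite xE mulr_sumr; apply: (ideal_sum iR) => j _.
rewrite mulrA; apply: (idealMr iR) => //.
exact: sub_generated.
Qed.

End TraceForm.

Lemma Aint_det (n : nat) (W : 'M[algC]_n) : (forall i j, W i j \in Aint) -> \det W \in Aint.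
Proof.
move=> AW; rewrite /determinant; apply: rpred_sum => t _; rewrite rpredMsign.
by apply: rpred_prod => i _.
Qed.

Section Normal.
Variables (kap : algC) (Akap : kap \in Aint) (nkap : forall nu, Fix kap (nu kap)).
Local Notation E := (Fix kap).
Let EP : subfield E := Fix_subfield kap.

Lemma Fix_normal nu x : E x -> E (nu x).
Proof.
move=> Ex mu muk.
apply: (aut_eq_Fix (nu := mu \o nu : {rmorphism _ -> _}) Ex) => /=.
exact: nkap.
Qed.

Lemma int_normal nu x : integers E x -> integers E (nu x).
Proof. by move=> [Ex Ax]; split; [apply: Fix_normal|rewrite Aint_aut]. Qed.

(** [d] is the discriminant of the powers of [kap], up to sign. If [p] divides [x ^+ 2], then
    [trace_radical] over Q shows that [p] divides [d * x], and a Bezout relation between [p] and [d]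
    removes [d]. *)
Lemma unramified_radical : exists2 d : nat, (0 < d)%N &
  forall p, prime p -> ~~ (p %| d)%N -> radical E (mult E p%:R).
Proof.
have [D [s [s_inj s_all]]] := Fix_embeddings kap.
pose W := \matrix_(i, j < D) s i (kap ^+ j).
have W0 : \det W != 0 by apply: Fix_det.
have Wint : (\det W) ^+ 2 \in Num.int.
  apply: Cint_rat_Aint; last first.
    by apply/rpredX/Aint_det => i j; rewrite mxE Aint_aut rpredX.
  rewrite expr2 -{1}det_tr -det_mulmx; apply: fixed_Crat => mu.
  rewrite -det_map_mx; congr (\det _); apply/matrixP=> i j; rewrite !mxE.
  rewrite rmorph_sum.
  have sP i' : {j' | mu (s i' kap) = s j' kap}.
    exact/cid/(s_all (mu \o s i' : {rmorphism _ -> _})).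
  pose q i' := sval (sP i').
  have qE i' : mu (s i' kap) = s (q i') kap by rewrite /q; case: (sP i').
  have q_inj : injective q.
    by move=> i1 i2 e; apply/s_inj/(fmorph_inj mu); rewrite !qE e.
  rewrite [RHS](reindex_inj q_inj); apply: eq_bigr => k _.
  by rewrite !mxE rmorphM !rmorphXn qE.
have /intrP[z zE] := Wint.
have z0 : z != 0 by apply: contra_neq W0 => z0; move: zE; rewrite z0 => /eqP;
  rewrite expf_eq0 => /andP[_ /eqP].
exists `|z|%N; first by rewrite absz_gt0.
move=> p pp pz x Ox [y Oy xE].
have p0 : p%:R != 0 :> algC by rewrite pnatr_eq0 -lt0n prime_gt0.
pose Q := Fix 1; have QP : subfield Q := Fix_subfield 1.
have QE u : Q u <-> u \in Crat.
  split=> [Qu|/aut_Crat uQ nu _]; last exact: uQ.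
  by apply: fixed_Crat => nu; apply: Qu; rewrite rmorph1.
have QEs : Q `<=` E by move=> u /QE uQ nu _; apply: aut_Crat.
pose I := mult Q p%:R.
have iI : ideal Q I := ideal_mult QP (int_nat QP p).
have R_mult : ideal_generated E I `<=` mult E p%:R.
  apply: generated_least; first exact: (ideal_mult EP (int_nat EP p)).
  by move=> _ [u [/QEs Eu Au] <-]; exists u.
have multI t : integers Q t -> mult E p%:R t -> I t.
  move=> [Qt At] [u [Eu Au] tE]; exists u => //; split=> //.
  apply/QE; rewrite -[u](mulKf p0) tE rpredM ?rpredV ?rpred_nat //.
  exact/QE.
have Rx : ideal_generated E I (x ^+ 2).
  have iR : ideal E (ideal_generated E I).
    by apply: ideal_generated_ideal => // _ [u [/QEs Eu Au] <-]; apply: intM => //; apply: int_nat.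
  rewrite -xE; apply: (idealMr iR) => //.
  by apply: sub_generated; exists 1; rewrite ?mulr1 //; apply: int1.
have [v Ov vE] : mult E p%:R (z%:~R * x).
  apply: (R_mult); rewrite -zE.
  apply: (@trace_radical Q E QP EP QEs D s (fun j => kap ^+ j) _ _ _ _ _ I iI _ _ x Ox Rx).
  - by move=> i u /QE uQ; apply: aut_Crat.
  - by move=> i u; apply: Fix_normal.
  - by move=> j; apply: intX => //; split=> //; apply: Fix_gen.
  - move=> u Eu; have [a [aQ aE]] := Fix_repr s_inj s_all Eu.
    by exists a; split=> // j; apply/QE.
  - move=> u Eu; apply/QE; apply: fixed_Crat => mu; rewrite rmorph_sum.
    have sP i : {i' | forall v, E v -> mu (s i v) = s i' v}.
      apply: cid; have [i' iE] := s_allF s_all (mu \o s i : {rmorphism _ -> _}).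
      by exists i' => v /iE.
    pose q i := sval (sP i).
    have qE i v : E v -> mu (s i v) = s (q i) v by rewrite /q; case: (sP i) => i' /=; apply.
    have Ek : E kap := @Fix_gen kap.
    have q_inj : injective q.
      by move=> i1 i2 e; apply/s_inj/(fmorph_inj mu); rewrite !qE // e.
    by rewrite [RHS](reindex_inj q_inj); apply: eq_bigr => k _; rewrite qE.
  - move=> u [Qu Au] [v [Qv Av] uE].
    apply: multI => //.
    have /intrP[zu zuE] : u \in Num.int by apply: Cint_rat_Aint => //; apply/QE.
    have /intrP[zv zvE] : v \in Num.int by apply: Cint_rat_Aint => //; apply/QE.
    move: uE; rewrite zuE zvE -[p%:R]/((p%:Z)%:~R) -rmorphM -rmorphXn => /eqP.
    rewrite eqr_int => /eqP uE.
    have : (p %| zu ^+ 2)%Z by apply/dvdzP; exists zv; rewrite -uE mulrC.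
    rewrite dvdzE abszX Euclid_dvdX // => /andP[pu _].
    have /dvdzP[c cE] : (p %| zu)%Z by rewrite dvdzE.
    by exists c%:~R; [apply: int_int|rewrite cE rmorphM mulrC].
  - by move=> t Ot /R_mult/multI; apply.
have [uv uvE] : exists uv : int * int, uv.1 * p%:Z + uv.2 * z = 1.
  by apply/coprimezP; rewrite /coprimez /= /gcdz /= -[(_ == _)%Z]/(coprime p `|z|) prime_coprime.
have -> : x = p%:R * (uv.1%:~R * x + uv.2%:~R * v).
  rewrite mulrDr [p%:R * (_ * v)]mulrCA vE !mulrA -mulrDl -[p%:R]/((p%:Z)%:~R).
  by rewrite -!rmorphM -rmorphD [p%:Z * _]mulrC uvE mul1r.
exists (uv.1%:~R * x + uv.2%:~R * v) => //.
by apply: intD => //; apply: intM => //; apply: int_int.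
Qed.

End Normal.

(** * Kummer theory over K *)

Lemma inv_mod (l b : nat) : coprime b l -> exists c, (b * c = 1 %[mod l])%N.
Proof.
move=> cb; exists (b ^ (totient l).-1)%N.
have [l0|l0] := posnP l.
  by move: cb; rewrite l0 /coprime gcdn0 => /eqP->; rewrite exp1n.
by rewrite -expnS prednK ?totient_gt0 // Euler_exp_totient.
Qed.

Section RootsOfUnity.
Variables (l : nat) (zeta : algC) (l_prime : prime l).
Hypothesis z_prim : l.-primitive_root zeta.
Let l0 : (0 < l)%N. Proof. exact: prime_gt0. Qed.

Lemma zeta_modn a : zeta ^+ (a %% l) = zeta ^+ a.
Proof. exact: prim_expr_mod. Qed.

Lemma eq_zeta a b : (a = b %[mod l])%N -> zeta ^+ a = zeta ^+ b.
Proof. by move=> e; rewrite -(zeta_modn a) e zeta_modn. Qed.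

Lemma zeta_inj a b : zeta ^+ a = zeta ^+ b -> (a = b %[mod l])%N.
Proof. by move/eqP; rewrite (eq_prim_root_expr z_prim) => /eqP. Qed.

Lemma Aint_zeta : zeta \in Aint.
Proof. exact: Aint_prim_root z_prim. Qed.

Lemma aut_zeta nu : exists r r', [/\ nu zeta = zeta ^+ r, coprime r l & (r * r' = 1 %[mod l])%N].
Proof.
have nz : nu zeta ^+ l = 1 by rewrite -rmorphXn (prim_expr_order z_prim) rmorph1.
have [i iE] := prim_rootP z_prim nz.
have cr : coprime i l.
  rewrite coprime_sym prime_coprime //; apply/negP => /eqnP li.
  have : nu zeta = 1 by rewrite iE -zeta_modn li.
  move/eqP; rewrite fmorph_eq1 => /eqP z1.
  by have := prime_gt1 l_prime; have := prim_order_dvd z_prim 1;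
    rewrite z1 expr1 eqxx dvdn1 => /eqP->.
by have [r' rr'] := inv_mod cr; exists i, r'.
Qed.

Lemma aut_eq_zeta b nu mu : coprime b l -> nu (zeta ^+ b) = mu (zeta ^+ b) -> nu zeta = mu zeta.
Proof.
move=> /inv_mod[c bc] e; have zE : zeta = (zeta ^+ b) ^+ c.
  by rewrite -exprM (eq_zeta bc) expr1.
by rewrite zE !(rmorphXn _ c) e.
Qed.

Lemma coprime_ord (b : nat) : coprime b l = ~~ (l %| b)%N.
Proof. by rewrite coprime_sym prime_coprime. Qed.

Lemma sum_zeta j : \sum_(a < l) zeta ^+ (a * j) = if (l %| j)%N then l%:R else 0.
Proof.
case: ifP => [lj|lj].
  rewrite (eq_bigr (fun=> 1)) ?sumr_const ?card_ord // => a _.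
  by rewrite -zeta_modn (eqP (dvdn_mull a lj)).
have x1 : zeta ^+ j - 1 != 0.
  by rewrite subr_eq0 -(prim_order_dvd z_prim) lj.
apply: (mulfI x1); rewrite mulr0.
rewrite (eq_bigr (fun a : 'I_l => (zeta ^+ j) ^+ a)) => [|a _]; last by rewrite -exprM mulnC.
by rewrite -subrX1 exprAC (prim_expr_order z_prim) expr1n subrr.
Qed.

Definition negl (i : 'I_l) : 'I_l := Ordinal (ltn_pmod (l - i) l0).

Lemma negl_dvd (i j : 'I_l) : (l %| i + j)%N = (j == negl i).
Proof.
have lti := ltn_ord i; have ltj := ltn_ord j.
rewrite -val_eqE /=; have [i0|i0] := posnP i.
  rewrite i0 subn0 modnn add0n; have [->|j0] := posnP j; first by rewrite dvdn0.
  by rewrite gtnNdvd // (gtn_eqF j0).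
rewrite modn_small ?ltn_subrL ?i0 //; apply/idP/eqP => [/dvdnP[q]|->]; last first.
  by rewrite subnKC ?dvdnn // ltnW.
case: q => [|[|q]]; lia.
Qed.

Lemma neglK : involutive negl.
Proof.
move=> i; apply/eqP; rewrite eq_sym -negl_dvd addnC.
by rewrite negl_dvd.
Qed.

Definition dft : 'M[algC]_l := \matrix_(i, s) zeta ^+ (i * s).

(* [dft *m dft] is [l] times the permutation matrix of negation modulo [l]; the fourth power
   removes the sign of this permutation. *)
Lemma det_dft : \det dft ^+ 4 = (l%:R ^+ l) ^+ 2.
Proof.
have dft2 i j : (dft *m dft) i j = if j == negl i then l%:R else 0.
  rewrite mxE -negl_dvd -sum_zeta; apply: eq_bigr => s _.
  by rewrite !mxE -exprD; congr (_ ^+ _); rewrite mulnDr mulnC.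
have dft4 : (dft *m dft) *m (dft *m dft) = (l%:R ^+ 2)%:M.
  apply/matrixP=> i j; rewrite !mxE (bigD1 (negl i)) //= dft2 eqxx dft2 neglK.
  rewrite big1 ?addr0 => [|s /negPf si]; last by rewrite dft2 si mul0r.
  by rewrite eq_sym; case: eqP => _; rewrite ?mulr1n ?mulr0n ?mulr0 // expr2.
have := congr1 determinant dft4; rewrite det_scalar !det_mulmx exprAC.
by move=> <-; rewrite -!expr2 -exprM.
Qed.

End RootsOfUnity.

Section Kummer.
Variables (kapK kapF zeta : algC) (l : nat) (l_prime : prime l).
Hypothesis z_prim : l.-primitive_root zeta.
Hypothesis FK : forall nu, nu kapF = kapF <-> nu kapK = kapK /\ nu zeta = zeta.

Let l0 : (0 < l)%N. Proof. exact: prime_gt0. Qed.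
Let lC0 : l%:R != 0 :> algC. Proof. by rewrite pnatr_eq0 -lt0n. Qed.

Lemma FK_eq nu mu : nu kapK = mu kapK -> nu zeta = mu zeta -> nu kapF = mu kapF.
Proof.
have [mu' [K1 K2]] := aut_inv mu => eK ez.
have /FK fF : (mu' \o nu : {rmorphism _ -> _}) kapK = kapK /\
   (mu' \o nu : {rmorphism _ -> _}) zeta = zeta by rewrite /= eK ez !K1.
by apply: (can_inj K2); rewrite K1 -[RHS]fF.
Qed.

(* [Delta] encodes Gal(F/K): [b] stands for an automorphism [nub b] over K mapping [zeta ^+ b]
   to [zeta]. *)
Definition Delta (b : 'I_l) : bool :=
  `[< exists nu, nu kapK = kapK /\ nu (zeta ^+ b) = zeta >].

Lemma nub_ex (b : 'I_l) : {nu : {rmorphism algC -> algC} |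
  Delta b -> nu kapK = kapK /\ nu (zeta ^+ b) = zeta}.
Proof.
apply: cid; have [/asboolP[nu nuP]|_] := boolP (Delta b); first by exists nu.
by exists (idfun : {rmorphism _ -> _}).
Qed.

Definition nub b := sval (nub_ex b).

Lemma nubP b : Delta b -> nub b kapK = kapK /\ nub b (zeta ^+ b) = zeta.
Proof. by rewrite /nub; case: (nub_ex b). Qed.

Lemma Delta_coprime b : Delta b -> coprime b l.
Proof.
move=> /nubP[_ zb]; rewrite coprime_ord //; apply/negP => lb.
have z1 : zeta = 1.
  by rewrite -zb -(zeta_modn z_prim) (eqP lb) expr0 rmorph1.
have := prim_order_dvd z_prim 1; rewrite z1 expr1 eqxx dvdn1.
by move/eqP=> l1; have := prime_gt1 l_prime; rewrite l1.
Qed.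

Definition one_l : 'I_l := Ordinal (prime_gt1 l_prime).

Lemma Delta1 : Delta one_l.
Proof. by apply/asboolP; exists (idfun : {rmorphism _ -> _}); rewrite /= expr1. Qed.

Lemma nub1 x : Fix kapF x -> nub one_l x = x.
Proof.
have [nK nz] := nubP Delta1; move=> Fx.
by apply: Fx; apply/FK; rewrite expr1 in nz.
Qed.

Lemma nub_inj b b' : Delta b -> Delta b' -> nub b kapF = nub b' kapF -> b = b'.
Proof.
move=> Db Db' e; have [nK nz] := nubP Db; have [nK' nz'] := nubP Db'.
have [mu [K1 K2]] := aut_inv (nub b').
have /FK[_ ez] : (mu \o nub b : {rmorphism _ -> _}) kapF = kapF by rewrite /= e K1.
have {}ez : nub b zeta = nub b' zeta by rewrite -[LHS]K2; congr (nub b' _).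
have : nub b (zeta ^+ b) = nub b (zeta ^+ b').
  by rewrite nz rmorphXn ez -rmorphXn nz'.
move/fmorph_inj/(zeta_inj z_prim); rewrite !modn_small //.
exact: val_inj.
Qed.

Section Action.
Variable (nu : {rmorphism algC -> algC}) (nuK : nu kapK = kapK).
Variables (r r' : nat) (nuz : nu zeta = zeta ^+ r) (rr' : (r * r' = 1 %[mod l])%N).

(** On F, [nu] after [nub b] is [nub (shift b)]: it sends [zeta ^+ b] to [zeta ^+ r], hence
    [zeta ^+ (b * r')] to [zeta]. *)
Definition shift (b : 'I_l) : 'I_l := Ordinal (ltn_pmod (b * r') l0).

Lemma shiftE b : (r * shift b = b %[mod l])%N.
Proof. by rewrite /= modnMmr mulnCA -modnMmr rr' modnMmr muln1. Qed.

Lemma shift_inj : injective shift.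
Proof.
move=> b b' e; apply: val_inj.
by have := shiftE b; rewrite e shiftE !modn_small // => ->.
Qed.

Lemma Delta_shift b : Delta (shift b) = Delta b.
Proof.
apply/asboolP/asboolP => -[mu [muK muz]]; last first.
  exists (nu \o mu : {rmorphism _ -> _}); rewrite /= muK nuK; split=> //.
  rewrite (zeta_modn z_prim) exprM rmorphXn muz rmorphXn nuz.
  by rewrite -exprM (eq_zeta z_prim rr') expr1.
have [nu' [K1 K2]] := aut_inv nu.
exists (nu' \o mu : {rmorphism _ -> _}); rewrite /= muK -[in LHS]nuK K1; split=> //.
rewrite -(eq_zeta z_prim (shiftE b)) mulnC exprM rmorphXn muz -nuz.
by rewrite K1.
Qed.

Lemma nub_shift b x : Delta b -> Fix kapF x -> nu (nub b x) = nub (shift b) x.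
Proof.
move=> Db Fx; have [bK bz] := nubP Db.
have Db' : Delta (shift b) by rewrite Delta_shift.
have [b'K b'z] := nubP Db'.
apply: (aut_eq_Fix (nu := nu \o nub b : {rmorphism _ -> _}) Fx).
apply: (FK_eq (nu := nu \o nub b : {rmorphism _ -> _})); first by rewrite /= bK nuK b'K.
apply: (aut_eq_zeta (nu := nu \o nub b : {rmorphism _ -> _}) z_prim (Delta_coprime Db')).
rewrite b'z /= (zeta_modn z_prim) exprM [nub b _]rmorphXn bz rmorphXn nuz.
by rewrite -exprM (eq_zeta z_prim rr') expr1.
Qed.

End Action.

Section Alpha.
Variables (alpha : algC) (Falpha : Fix kapF alpha) (alpha0 : alpha != 0).

(* The weights [b] make [gam 1 ^+ l] a Kummer generator on which Gal(F/K) acts, modulo l-th powers,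
   as on [zeta]. Hence the [eps a], the inverse Fourier transform of the [gam j], are permuted
   cyclically by the automorphisms over K and generate a cyclic extension of K. Using exponents
   reduced modulo [l] in [gam j], and not [gam 1 ^+ j], keeps the discriminant small: see [gamM]. *)
Definition rho b := l.-root (nub b alpha).
Definition gam (j : nat) := \prod_(b | Delta b) rho b ^+ ((j * b) %% l).
Definition eps (a : nat) := l%:R^-1 * \sum_(j < l) zeta ^+ (a * j) * gam j.
Definition nual := \prod_(b | Delta b) nub b alpha.

Lemma rhoX b : rho b ^+ l = nub b alpha.
Proof. exact: rootCK. Qed.

Lemma rho0 b : rho b != 0.
Proof. by rewrite rootC_eq0 ?fmorph_eq0. Qed.

Lemma gam_mod j : gam (j %% l) = gam j.
Proof. by apply: eq_bigr => b _; rewrite modnMml. Qed.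

Lemma gam0 : gam 0 = 1.
Proof. by apply: big1 => b _; rewrite mul0n mod0n expr0. Qed.

Lemma eps_mod a : eps (a %% l) = eps a.
Proof.
congr (_ * _); apply: eq_bigr => j _; congr (_ * _).
by apply: (eq_zeta z_prim); rewrite modnMml.
Qed.

Lemma nual_fixed nu : nu kapK = kapK -> nu nual = nual.
Proof.
move=> nuK; have [r [r' [nuz cr rr']]] := aut_zeta l_prime z_prim nu.
rewrite /nual rmorph_prod [RHS](reindex_inj (shift_inj (r := r) rr')).
apply: eq_big => b; first by rewrite (Delta_shift nuK nuz rr').
by move=> Db; rewrite (nub_shift nuK nuz rr').
Qed.

(** [nu] permutes the [rho b] up to powers of [zeta], which gives [nu (gam j) = zeta ^+ (j * T) *
    gam (j * r)]. In the Fourier sum [zeta ^+ (a * j)] also acquires the exponent [r]; reindexing by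
    [j * r] leaves a translation of [a] by [r' * T]. *)
Lemma eps_action nu : nu kapK = kapK -> exists t : nat,
  (forall a, nu (eps a) = eps (a + t)) /\
  (nu zeta = zeta -> forall j, nu (gam j) = zeta ^+ (j * t) * gam j).
Proof.
move=> nuK; have [r [r' [nuz cr rr']]] := aut_zeta l_prime z_prim nu.
pose sh := shift r'.
have tP b : {t : 'I_l | Delta b -> nu (rho b) = zeta ^+ t * rho (sh b)}.
  apply: cid; have [Db|_] := boolP (Delta b); last by exists one_l.
  have y1 : (nu (rho b) / rho (sh b)) ^+ l = 1.
    rewrite exprMn exprVn rhoX -rmorphXn rhoX (nub_shift nuK nuz rr') //.
    by rewrite divff // fmorph_eq0.
  have [t tE] := prim_rootP z_prim y1; exists t => _.
  by rewrite -tE divfK ?rho0.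
pose t b := sval (tP b).
have tE b : Delta b -> nu (rho b) = zeta ^+ t b * rho (sh b).
  by rewrite /t; case: (tP b).
pose T := (\sum_(b | Delta b) t b * b)%N.
have nugam j : nu (gam j) = zeta ^+ (j * T) * gam (j * r).
  rewrite /gam rmorph_prod /T big_distrr /= -prodrXr.
  rewrite [X in _ = _ * X](reindex_inj (shift_inj (r := r) rr')) /=.
  rewrite [X in _ = _ * X](eq_bigl Delta) => [|b]; last first.
    by rewrite (Delta_shift nuK nuz rr').
  rewrite -big_split; apply: eq_bigr => b Db /=.
  rewrite rmorphXn tE // exprMn -exprM; congr (_ * _).
    by apply: (eq_zeta z_prim); rewrite modnMmr mulnCA.
  congr (_ ^+ _); rewrite -mulnA -[in RHS]modnMmr.
  by rewrite (shiftE rr' b) modnMmr.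
exists (r' * T)%N; split=> [a|nuz1 j]; last first.
  have r1 : (r = 1 %[mod l])%N.
    by apply: (zeta_inj z_prim); rewrite -nuz nuz1 expr1.
  rewrite nugam -(gam_mod (j * r)) -modnMmr r1 modnMmr muln1 gam_mod.
  congr (_ * _); apply: (eq_zeta z_prim).
  have r'1 : (r' = 1 %[mod l])%N by rewrite -rr' -modnMml r1 modnMml mul1n.
  by rewrite [in RHS]mulnCA -[in RHS]modnMml r'1 modnMml mul1n.
rewrite /eps rmorphM fmorphV rmorph_nat; congr (_ * _).
have r'r : (r' * r = 1 %[mod l])%N by rewrite mulnC.
rewrite rmorph_sum [RHS](reindex_inj (shift_inj (r := r') r'r)).
apply: eq_bigr => j _; rewrite rmorphM rmorphXn nuz nugam /= gam_mod mulrA.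
rewrite -exprM -exprD; congr (_ * _); apply: (eq_zeta z_prim).
rewrite modnMmr mulnDl -modnDmr -[in RHS]modnDmr; congr ((_ + _) %% l)%N.
  by rewrite mulnCA [(r * _)%N]mulnC mulnA.
have -> : (r' * T * (j * r) = r' * r * (j * T))%N by ring.
by rewrite -[in RHS]modnMml r'r modnMml mul1n.
Qed.

(** The two reduced exponents of [rho b] are not both 0, and their sum is a multiple of [l] less
    than [2 * l], hence equal to [l]. *)
Lemma gamM j : (0 < j < l)%N -> gam j * gam (l - j) = nual.
Proof.
move=> /andP[j0 jl]; rewrite /gam -big_split; apply: eq_bigr => b Db /=.
rewrite -exprD -rhoX; congr (_ ^+ _).
have lt1 := ltn_pmod (j * b) l0; have lt2 := ltn_pmod ((l - j) * b) l0.
have nz : (0 < (j * b) %% l)%N.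
  rewrite lt0n -/(dvdn _ _) Euclid_dvdM // negb_or gtnNdvd //=.
  by rewrite -(coprime_ord l_prime) Delta_coprime.
have : (l %| (j * b) %% l + ((l - j) * b) %% l)%N.
  by rewrite /dvdn modnDm -mulnDl subnKC ?modnMr // ?modnMr ?modnMl // ltnW.
by move=> /dvdnP[[|[|q]]]; lia.
Qed.

Lemma prod_gam : (\prod_(j < l) gam j) ^+ 2 = nual ^+ l.-1.
Proof.
have [l' lE] : exists l', l = l'.+1 by exists l.-1; rewrite prednK.
have e : \prod_(j < l) gam j = \prod_(j < l') gam j.+1.
  by rewrite lE big_ord_recl gam0 mul1r.
rewrite expr2 {1}e {}e [X in _ * X](reindex_inj rev_ord_inj) /= -big_split /=.
rewrite (eq_bigr (fun=> nual)) => [|j _]; first by rewrite prodr_const card_ord lE.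
have ltj := ltn_ord j; rewrite -(@gamM j.+1); last by lia.
by congr (_ * gam _); lia.
Qed.

(** Once [tau] sends each [eps a] to [eps a.+1], this is the matrix of the conjugates of the [eps j]
    under the powers of [tau], and its squared determinant is their discriminant. *)
Definition emx : 'M[algC]_l := \matrix_(i, j) eps (i + j).

(** [emx] is the diagonal matrix of the [gam j] between two Fourier matrices, divided by [l]; by
    [det_dft] the powers of [l] cancel. *)
Lemma det_emx : \det emx ^+ 2 = nual ^+ l.-1.
Proof.
pose g : 'rV_l := \row_j gam j; pose V := dft l zeta.
have -> : emx = l%:R^-1 *: (V *m (diag_mx g *m V)).
  apply/matrixP=> i j; rewrite !mxE /eps; congr (_ * _); apply: eq_bigr => s _.
  by rewrite mul_diag_mx !mxE mulnDl exprD [(j * s)%N]mulnC; ring.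
rewrite detZ !det_mulmx det_diag.
have -> : \prod_i g 0 i = \prod_(i < l) gam i by apply: eq_bigr => i _; rewrite mxE.
rewrite -prod_gam; set p := \prod_(_ < _) _; set d := \det V.
have -> : (l%:R^-1 ^+ l * (d * (p * d))) ^+ 2 = (l%:R^-1 ^+ l) ^+ 2 * d ^+ 4 * p ^+ 2.
  by ring.
by rewrite det_dft // !exprVn mulVf ?mul1r // !expf_neq0.
Qed.

Lemma sum_eps : \sum_(a < l) eps a = 1.
Proof.
rewrite -mulr_sumr exchange_big /=.
rewrite (bigD1 (Ordinal l0)) //= [X in _ + X]big1 => [|j j0]; last first.
  rewrite -mulr_suml sum_zeta // gtnNdvd ?mul0r // lt0n.
  by apply: contra_neq j0 => j0; apply: val_inj.
rewrite addr0 gam0 -mulr_suml mulr1 (eq_bigr (fun=> 1)) => [|a _].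
  by rewrite sumr_const card_ord mulVf.
by rewrite muln0.
Qed.

Hypothesis alpha1 : exists2 y, y \in Aint & alpha = 1 + (l ^ 2)%:R * y.

Lemma nub_cong b : exists2 y, y \in Aint & nub b alpha = 1 + (l ^ 2)%:R * y.
Proof.
have [y Ay ->] := alpha1; exists (nub b y); first by rewrite Aint_aut.
by rewrite rmorphD rmorph1 rmorphM rmorph_nat.
Qed.

Lemma Aint_nub b : nub b alpha \in Aint.
Proof.
by have [y Ay ->] := nub_cong b; rewrite rpredD ?rpred1 // rpredM ?rpred_nat.
Qed.

Lemma Aint_gam j : gam j \in Aint.
Proof.
apply: rpred_prod => b _; apply: rpredX; apply: (Aint_exp_root l0).
by rewrite rhoX Aint_nub.
Qed.

(** The exponents [j * b] and [(j * b) %% l] differ by a multiple of [l], so the quotient is a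
    product of powers of the [nub b alpha], which are 1 modulo [l ^ 2]. *)
Lemma gam_exp j : exists2 y, y \in Aint & gam 1 ^+ j = gam j + (l ^ 2)%:R * y.
Proof.
pose c1 x := exists2 y, y \in Aint & x = 1 + (l ^ 2)%:R * y.
have c11 : c1 1 by exists 0; rewrite ?mulr0 ?addr0 // rpred0.
have c1M x x' : c1 x -> c1 x' -> c1 (x * x').
  move=> [y Ay ->] [y' Ay' ->]; exists (y + y' + (l ^ 2)%:R * (y * y')); last by ring.
  by rewrite rpredD ?rpredD // rpredM ?rpred_nat // rpredM.
have c1X x n : c1 x -> c1 (x ^+ n).
  by move=> c1x; elim: n => [|n IH]; rewrite ?expr0 // exprS; apply: c1M.
have [y Ay yE] : c1 (\prod_(b | Delta b) nub b alpha ^+ ((j * b) %/ l)).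
  by apply: (big_ind c1) => // b _; apply/c1X/nub_cong.
exists (gam j * y); first by rewrite rpredM ?Aint_gam.
rewrite [RHS](_ : _ = gam j * (1 + (l ^ 2)%:R * y)); last by ring.
rewrite -yE /gam -prodrXl -big_split; apply: eq_bigr => b Db /=.
rewrite -rhoX -!exprM -exprD; congr (_ ^+ _).
by rewrite mul1n modn_small // [RHS]addnC [(l * _)%N]mulnC -divn_eq mulnC.
Qed.

(* Up to an algebraic integer, [eps a] is [A / l] with [A] the sum of the powers of a [u] such that
   [u ^+ l = 1] modulo [l^2]; then [A ^+ 2 = l * A] modulo [l^2], so [A / l] is integral. *)
Lemma Aint_eps a : eps a \in Aint.
Proof.
have Az := Aint_zeta z_prim.
pose u := zeta ^+ a * gam 1; pose A := \sum_(j < l) u ^+ j.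
have Au : u \in Aint by rewrite rpredM ?Aint_gam // rpredX.
have [y Ay yE] : exists2 y, y \in Aint & u ^+ l = 1 + (l ^ 2)%:R * y.
  have [y Ay yE] := gam_exp l; exists y => //.
  rewrite exprMn yE -(gam_mod l) modnn gam0 exprAC (prim_expr_order z_prim).
  by rewrite expr1n mul1r.
pose B := \sum_(i < l) \sum_(m < i) u ^+ m.
have AB : B \in Aint by apply: rpred_sum => i _; apply: rpred_sum => m _; apply: rpredX.
(* Sum over [i] of [u ^+ i * A = A + (u ^+ i - 1) * A], where [(u - 1) * A = u ^+ l - 1]. As
   [u ^+ l - 1] is [l ^ 2 * y], the quotient [A / l] is then a root of [X ^ 2 - X - y * B]. *)
have A2 : A ^+ 2 = l%:R * A + (u ^+ l - 1) * B.
  rewrite expr2 {1}/A mulr_suml.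
  have -> : l%:R * A = \sum_(i < l) A by rewrite sumr_const card_ord mulr_natl.
  rewrite /B mulr_sumr -big_split; apply: eq_bigr => i _ /=.
  have e1 := subrX1 u i; have e2 := subrX1 u l; rewrite -/A in e2.
  by rewrite e2 mulrAC -e1; ring.
have Av : l%:R^-1 * A \in Aint.
  apply: (@Aint_root_monic ('X^2 - ('X + (y * B)%:P))).
  - rewrite monicE lead_coefDl ?lead_coefXn // size_polyXn size_polyN.
    by rewrite (leq_ltn_trans (size_polyD _ _)) // size_polyX gtn_max /= (leq_ltn_trans
      (size_polyC_leq1 _)).
  - rewrite /root !hornerE exprMn A2 yE natrX.
    by apply/eqP; field.
  - by rewrite rpredB ?rpredX ?polyOverX // rpredD ?polyOverX // polyOverC rpredM.
pose yj j := sval (cid2 (gam_exp j)).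
have yjP j : yj j \in Aint /\ gam 1 ^+ j = gam j + (l ^ 2)%:R * yj j.
  by rewrite /yj; case: (cid2 _).
have -> : eps a = l%:R^-1 * A - l%:R * \sum_(j < l) zeta ^+ (a * j) * yj j.
  rewrite /eps /A (eq_bigr (fun j : 'I_l => u ^+ j - l%:R ^+ 2 * (zeta ^+ (a * j) * yj j))).
    by rewrite sumrB -mulr_sumr; field.
  move=> j _; rewrite /u exprMn (yjP j).2 -exprM natrX; ring.
rewrite rpredB // rpredM ?rpred_nat // rpred_sum // => j _.
by rewrite rpredM ?(yjP j).1 // rpredX.
Qed.

End Alpha.
End Kummer.

(** * Elements of squarefree norm *)

Lemma Aint_inv_prime p : prime p -> (p%:R^-1 : algC) \notin Aint.
Proof.
move=> pp; have pC0 : p%:R != 0 :> algC by rewrite pnatr_eq0 -lt0n prime_gt0.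
apply/negP => pV; have /intrP[q qE] : (p%:R^-1 : algC) \in Num.int.
  by apply: Cint_rat_Aint => //; rewrite rpredV rpred_nat.
have : (p%:Z * q)%:~R = 1 :> algC by rewrite intrM -qE divff.
move/eqP; rewrite -[1]/((1%:Z)%:~R) eqr_int => /eqP /(congr1 absz).
by rewrite abszM /= => /eqP; rewrite muln_eq1 => /andP[/eqP p1 _]; move: pp; rewrite p1.
Qed.

Lemma nrm_cong (D : nat) (s : 'I_D -> {rmorphism algC -> algC}) (m : nat) y : y \in Aint ->
  exists2 X, X \in Aint & nrm s (1 + m%:R * y) = 1 + m%:R * X.
Proof.
move=> Ay; apply: (big_ind (fun t => exists2 X, X \in Aint & t = 1 + m%:R * X)).
- by exists 0; rewrite ?rpred0 // mulr0 addr0.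
- move=> _ _ [X AX ->] [X' AX' ->]; exists (X + X' + m%:R * X * X'); last by ring.
  by rewrite !(rpredD, rpredM) ?rpred_nat.
- move=> i _; exists (s i y); first by rewrite Aint_aut.
  by rewrite rmorphD rmorph1 rmorphM rmorph_nat.
Qed.

Section LocalAtPrime.
Variables (kapE : algC) (AkapE : kapE \in Aint).
Local Notation E := (Fix kapE).
Local Notation O := (integers E).
Let EP : subfield E := Fix_subfield kapE.
Variables (p : nat) (p_prime : prime p) (radp : radical E (mult E p%:R)).
Variables (P : set algC) (PP : prime_ideals E P) (Pp : P p%:R).

Let p0 : (0 < p)%N. Proof. exact: prime_gt0. Qed.
Let pC0 : p%:R != 0 :> algC. Proof. by rewrite pnatr_eq0 -lt0n. Qed.
Let iP : ideal E P. Proof. by case: PP. Qed.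

Lemma prime_mul x y : O x -> O y -> P (x * y) -> P x \/ P y.
Proof. by case: PP => _ _ _; apply. Qed.

Lemma prime_mulN x y : O x -> O y -> ~ P x -> ~ P y -> ~ P (x * y).
Proof. by move=> Ox Oy Px Py /prime_mul[]. Qed.

Lemma prime_expN x n : O x -> ~ P x -> ~ P (x ^+ n).
Proof. by move=> Ox Px /(prime_X EP PP Ox). Qed.

Lemma prime_p_mul x y : O y -> x = p%:R * y -> P x.
Proof. by move=> Oy ->; apply: (idealMr iP). Qed.

Lemma prime_int_dvd (z : int) : P z%:~R -> (p %| `|z|)%N.
Proof.
move=> Pz; apply: contrapT => /negP pz.
have [uv uvE] : exists uv : int * int, uv.1 * p%:Z + uv.2 * z = 1.
  by apply/coprimezP; rewrite /coprimez /= /gcdz /= -[(_ == _)%Z]/(coprime p `|z|) prime_coprime.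
have [_ _ P1 _] := PP; apply: P1.
have -> : 1 = uv.1%:~R * p%:R + uv.2%:~R * z%:~R :> algC.
  by rewrite -[p%:R]/((p%:Z)%:~R) -!rmorphM -rmorphD uvE.
by case: iP => _ _ PD PM; apply: PD; apply: (PM) => //; apply: int_int.
Qed.

(** Up to this [s], a unit at [P], membership in [P] becomes divisibility by [p]; valuations at [P]
    are handled through such multipliers. *)
Lemma multiplier : exists s, [/\ O s, ~ P s &
  forall x, P x -> exists2 y, O y & s * x = p%:R * y].
Proof.
have iM := ideal_mult EP (int_nat EP p).
have Mp : mult E p%:R p%:R by exists 1; rewrite ?mulr1 //; apply: int1.
have [s [Os Ps sP]] := coprime_multiplier AkapE p0 iM radp Mp PP (mult_sub iP Pp).
by exists s; split=> // x /sP[y Oy <-]; exists y.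
Qed.

(* [a] has valuation one at the prime [P], which is unramified over [p]. *)
Definition uniformizer a := [/\ O a, P a &
  exists b m, [/\ O b, O m, ~ P m & a * b = p%:R * m]].

Lemma uniformizer_neq0 a : uniformizer a -> a != 0.
Proof.
move=> [Oa Pa [b [m [Ob Om Pm e]]]]; apply/eqP => a0; apply: Pm.
suff -> : m = 0 by case: iP.
by apply: (mulfI pC0); rewrite -e a0 mul0r mulr0.
Qed.

(** [y] is in [P] and [l] is at least 2, so [y ^+ l] has valuation at least 2, one more than [a]. In
    terms of the multiplier [s], the product [s ^+ 2 * y ^+ l * b = p * s ^+ 2 * m * u] is divisible
    by [p ^ 2]. *)
Lemma uniformizer_pow a y u l : (1 < l)%N -> uniformizer a -> O y -> O u ->
  y ^+ l = a * u -> P u.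
Proof.
move=> l1 [Oa Pa [b [m [Ob Om Pm abE]]]] Oy Ou yE.
have [s [Os Ps sP]] := multiplier.
have Py : P y.
  by apply: (prime_X (n := l) EP PP Oy); rewrite yE; apply: (idealMr iP).
have [v Ov vE] := sP y Py; apply: contrapT => Pu.
have : P (s ^+ 2 * (m * u)).
  apply: (@prime_p_mul _ (v ^+ 2 * y ^+ (l - 2) * b)).
    by apply: intM => //; apply: intM => //; apply: intX.
  apply: (mulfI pC0).
  have -> : p%:R * (p%:R * (v ^+ 2 * y ^+ (l - 2) * b)) = (p%:R * v) ^+ 2 * y ^+ (l - 2) * b by
    ring.
  rewrite -vE exprMn -[_ * y ^+ (l - 2)]mulrA -exprD subnKC // yE.
  have -> : s ^+ 2 * (a * u) * b = s ^+ 2 * u * (a * b) by ring.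
  by rewrite abE; ring.
apply: prime_mulN; [exact: intX|exact: intM|exact: prime_expN|].
exact: prime_mulN.
Qed.

(* The valuation of an l-th power is divisible by [l]. *)
Lemma uniformizer_val a y s w l e : prime l -> uniformizer a -> E y ->
  O s -> ~ P s -> O w -> ~ P w -> ~~ (l %| e)%N -> y ^+ l * s = a ^+ e * w -> False.
Proof.
move=> l_pr ua Ey Os Ps Ow Pw le yE.
have a0 := uniformizer_neq0 ua; have [Oa Pa _] := ua.
have l1 := prime_gt1 l_pr.
(* Raising to a power [f] inverse to [e] modulo [l] reduces to valuation one:
   [y ^+ f * s ^+ f / a ^+ g] is integral because its l-th power is [a * u], and [uniformizer_pow]
   applies to it. *)
have [f fE] : exists f, (e * f = 1 %[mod l])%N.
  by apply: inv_mod; rewrite coprime_sym prime_coprime.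
rewrite (modn_small l1) in fE.
have efE := divn_eq (e * f) l; rewrite fE in efE; set g := (_ %/ _)%N in efE.
pose u := w ^+ f * s ^+ (f * l.-1).
have Ou : O u by apply: intM => //; apply: intX.
have lE : l = l.-1.+1 by rewrite prednK // ltnW.
have YE : (y ^+ f * s ^+ f / a ^+ g) ^+ l = a * u.
  rewrite exprMn exprVn exprMn -!exprM.
  apply: (mulIf (expf_neq0 (g * l) a0)); rewrite divfK ?expf_neq0 //.
  rewrite [(f * l)%N]mulnC [y ^+ _]exprM.
  have -> : s ^+ (l * f) = s ^+ f * s ^+ (f * l.-1).
    by rewrite -exprD {1}lE mulSn [(l.-1 * f)%N]mulnC.
  rewrite mulrA -exprMn yE exprMn -exprM efE addn1 exprS /u.
  by ring.
have OY : O (y ^+ f * s ^+ f / a ^+ g).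
  split.
    apply: (subM EP); last by apply: (subV EP); apply: (subX EP); case: Oa.
    by apply: (subM EP); apply: (subX EP) => //; case: Os.
  apply: (Aint_exp_root (ltnW l1)); rewrite YE.
  by apply: rpredM; [case: Oa|case: Ou].
apply: (@prime_mulN (w ^+ f) (s ^+ (f * l.-1))); try exact: intX; try exact: prime_expN.
exact: uniformizer_pow l1 ua OY Ou YE.
Qed.

(** This allows one uniformizer to be exchanged for another up to units at [P], so that in
    [common_prime] the exponents of conjugates of two different elements can be added. *)
Lemma uniformizer_assoc a a' : uniformizer a -> uniformizer a' ->
  exists s w, [/\ O s, O w, ~ P s, ~ P w & s * a' = a * w].
Proof.
move=> ua ua'; have [Oa Pa [b [m [Ob Om Pm abE]]]] := ua.
have [Oa' Pa' [b' [m' [Ob' Om' Pm' abE']]]] := ua'.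
have [s [Os Ps sP]] := multiplier.
have [v Ov vE] := sP a' Pa'.
have Osm : O (s * m) by apply: intM.
have Obv : O (b * v) by apply: intM.
have e : s * m * a' = a * (b * v).
  have -> : s * m * a' = m * (s * a') by ring.
  by rewrite vE mulrCA mulrA -abE; ring.
have Psm : ~ P (s * m) by apply: prime_mulN.
exists (s * m), (b * v); split=> //.
move=> /sP[w' Ow' w'E].
have : P (s * (s * m) * m').
  have -> : s * (s * m) * m' = a * (w' * b').
    apply: (mulfI pC0).
    have -> : p%:R * (s * (s * m) * m') = s * (s * m) * (p%:R * m') by ring.
    rewrite -abE'.
    have -> : s * (s * m) * (a' * b') = s * (s * m * a') * b' by ring.
    rewrite e.
    have -> : s * (a * (b * v)) * b' = a * (s * (b * v)) * b' by ring.
    by rewrite w'E; ring.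
  by apply: (idealMr iP) => //; apply: intM.
apply: prime_mulN => //; [exact: intM|exact: prime_mulN].
Qed.

End LocalAtPrime.

Section NormUniformizer.
Variables (kapE : algC) (AkapE : kapE \in Aint) (nkapE : forall nu, Fix kapE (nu kapE)).
Local Notation E := (Fix kapE).
Local Notation O := (integers E).
Let EP : subfield E := Fix_subfield kapE.
Variables (kapF : algC) (FE : Fix kapE kapF).
Local Notation F := (Fix kapF).
Let FP : subfield F := Fix_subfield kapF.
Variables (D : nat) (s : 'I_D -> {rmorphism algC -> algC}).
Hypothesis s_all : forall nu, exists i, nu kapF = s i kapF.
Variables (p : nat) (p_prime : prime p) (radp : radical E (mult E p%:R)).
Variables (alpha : algC) (z : int) (Oalpha : integers F alpha).
Hypothesis nrmE : nrm s alpha = z%:~R.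
Hypothesis zp : (p %| `|z|)%N.
Hypothesis zp2 : ~~ (p ^ 2 %| `|z|)%N.

Let pC0 : p%:R != 0 :> algC.
Proof. by rewrite pnatr_eq0 -lt0n prime_gt0. Qed.

Lemma F_sub_E x : F x -> E x.
Proof.
move=> Fx nu nuk; apply: Fx; exact: FE.
Qed.

Lemma intF_E x : integers F x -> O x.
Proof. by move=> [/F_sub_E]. Qed.

Lemma norm_div : exists2 z' : int, z = z' * p%:Z & ~~ (p %| `|z'|)%N.
Proof.
have /dvdzP[z' zE] : (p %| z)%Z by rewrite dvdzE.
exists z' => //; apply: contra zp2 => pz'.
by rewrite zE abszM expnS expn1 dvdn_mul.
Qed.

Lemma prime_over : exists P, [/\ prime_ideals E P, P p%:R & P alpha].
Proof.
have iM := ideal_mult EP (int_nat EP p).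
have Oa := intF_E Oalpha.
have iJ := ideal_adjoin iM Oa.
have Mp : mult E p%:R p%:R by exists 1; rewrite ?mulr1 //; apply: int1.
set J := [set _ | _] in iJ.
have MJ : mult E p%:R `<=` J.
  by move=> a Ma; exists a, 0; rewrite mulr0 addr0; split=> //; apply: int0.
have [|P PP JP] := maximal_exists AkapE (prime_gt0 p_prime) iJ (MJ _ Mp).
  (* If [p] and [alpha] generated the unit ideal, the product of [alpha * y = 1 - p * x] over the
     [s i] would be [nrm s alpha * Y], congruent to 1 modulo [p]. As [Y] need not be rational, the
     contradiction is the integrality of the inverse of [p]. *)
  move=> [_ [y [[x Ox <-] Oy e]]].
  have [z' zE _] := norm_div.
  pose Y := \prod_i s i y.
  have Ax : - x \in Aint by rewrite rpredN; case: Ox.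
  have [X AX XE] := nrm_cong s p Ax.
  have e1 : nrm s alpha * Y = 1 + p%:R * X.
    rewrite -XE /nrm -big_split; apply: eq_bigr => i _ /=.
    by rewrite -rmorphM; congr (s i _); rewrite -[alpha * y](addKr (p%:R * x)) -e mulrN addrC.
  have /negP[] := Aint_inv_prime p_prime.
  have -> : p%:R^-1 = z'%:~R * Y - X.
    apply: (mulfI pC0); rewrite divff // mulrBr mulrA.
    have -> : p%:R * z'%:~R = nrm s alpha.
      by rewrite nrmE zE rmorphM mulrC.
    by rewrite e1; ring.
  rewrite rpredB ?rpredM ?rpred_int //.
  by apply: rpred_prod => i _; rewrite Aint_aut; case: Oy.
exists P; split=> //; first exact: JP (MJ _ Mp).
apply: JP; exists 0, 1; rewrite mulr1 add0r; split=> //; last exact: int1.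
by case: iM.
Qed.

Section AtPrime.
Variables (P : set algC) (PP : prime_ideals E P) (Pp : P p%:R).
Variables (nu0 : {rmorphism algC -> algC}) (Palpha : P (nu0 alpha)).
Let iP : ideal E P. Proof. by case: PP. Qed.

(** [b] is the conjugate of the cofactor [nrm s alpha / alpha]: multiplied by [nu0 alpha] it gives
    the norm, which is [p] times an integer prime to [p]. *)
Lemma norm_uniformizer : uniformizer kapE p P (nu0 alpha).
Proof.
have [i0 i0P] := s_id s_all; have [Fa Aa] := Oalpha.
have [z' zE pz'] := norm_div.
have z0 : nrm s alpha != 0.
  rewrite nrmE intr_eq0; apply: contraNneq zp2 => ->.
  by rewrite dvdn0.
have a0 : alpha != 0.
  apply: contraNneq z0 => a0; rewrite /nrm (bigD1 i0) //= i0P // a0 mul0r //.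
split=> //; first exact/(int_normal nkapE)/intF_E.
exists (nu0 (nrm s alpha / alpha)), (z'%:~R); split.
- apply/(int_normal nkapE)/intF_E; split.
    apply: (subM FP); last exact: (subV FP).
    by rewrite nrmE; apply: (sub_int FP).
  rewrite /nrm (bigD1 i0) //= i0P // mulrC mulKf //.
  by apply: rpred_prod => i _; rewrite Aint_aut.
- exact: int_int.
- move=> Pz; move/negP: pz'; apply.
  exact: (prime_int_dvd (kapE := kapE) p_prime PP Pp).
- by rewrite -rmorphM mulrC divfK // nrmE zE rmorph_int rmorphM mulrC.
Qed.

(** Two distinct conjugates in [P] are two factors of the norm; clearing them with the multiplier
    would make the norm divisible by [p ^ 2]. *)
Lemma norm_conj nu : nu kapF != nu0 kapF -> ~ P (nu alpha).
Proof.
move=> nuF Pnu; have [Fa Aa] := Oalpha.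
have [i0 i0E] := s_allF s_all nu0.
have [i iE] := s_allF s_all nu.
have ii0 : i != i0.
  by apply: contraNneq nuF => e; rewrite iE ?i0E ?e //; apply: Fix_gen.
have [z' zE pz'] := norm_div.
have [t [Ot Pt tP]] := multiplier AkapE p_prime radp PP Pp.
have [x Ox xE] := tP _ Palpha; have [y Oy yE] := tP _ Pnu.
pose c := \prod_(j | (j != i0) && (j != i)) s j alpha.
have Oc : O c.
  apply: (int_prod EP) => j _; apply: int_normal => //; exact: intF_E.
have NE : nrm s alpha = nu0 alpha * (nu alpha * c).
  by rewrite /nrm (bigD1 i0) //= -i0E // (bigD1 i) //= -iE.
have : P (t ^+ 2 * z'%:~R).
  apply: (prime_p_mul (kapE := kapE) PP Pp (y := x * y * c)).
    by apply: intM => //; apply: intM.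
  apply: (mulfI pC0).
  have -> : p%:R * (t ^+ 2 * z'%:~R) = t ^+ 2 * (z' * p%:Z)%:~R by rewrite rmorphM; ring.
  rewrite -zE -nrmE NE.
  have -> : t ^+ 2 * (nu0 alpha * (nu alpha * c)) = (t * nu0 alpha) * (t * nu alpha) * c by ring.
  by rewrite xE yE; ring.
have Oz : O z'%:~R by apply: int_int.
apply: (prime_mulN PP) => //; first exact: intX.
  exact: (prime_expN PP).
move=> /(prime_int_dvd p_prime PP Pp); exact/negP.
Qed.

End AtPrime.
End NormUniformizer.

(** * The wreath product extension *)

Section FiniteBasis.
Variables (k L : set algC).

(** [basis_over] for an arbitrary finite index type, since bases of towers are indexed by pairs. *)
Definition basis_fin (T : finType) (b : T -> algC) : Prop :=
  [/\ forall i, L (b i),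
      forall x, L x -> exists2 a : T -> algC, (forall i, k (a i)) & x = \sum_i a i * b i
    & forall a : T -> algC, (forall i, k (a i)) -> \sum_i a i * b i = 0 ->
        forall i, a i = 0].

Lemma basis_fin_bij (T U : finType) (f : T -> U) (b : U -> algC) :
  bijective f -> basis_fin b -> basis_fin (b \o f).
Proof.
move=> bij_f; have [g fK gK] := bij_f => -[Lb span free]; split=> [i|x Lx|a ka e i].
- exact: Lb.
- have [a ka ->] := span x Lx; exists (a \o f) => [i|]; first exact: ka.
  by rewrite (reindex f) //; apply: onW_bij.
- rewrite -[i]fK; apply: (free (a \o g)) => [j|]; first exact: ka.
  rewrite (reindex f) /=; last exact: onW_bij.
  by rewrite -[RHS]e; apply: eq_bigr => j _; rewrite fK.
Qed.

Lemma basis_fin_integral (T : finType) (b : T -> algC) : subfield k -> subfield L ->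
  k `<=` L -> basis_fin b ->
  exists b' : T -> algC, basis_fin b' /\ forall i, b' i \in Aint.
Proof.
move=> kP LP kL [Lb span free].
have NP i : {N : nat | (0 < N)%N /\ N%:R * b i \in Aint} by apply/cid/Aint_scale.
pose N i := sval (NP i).
have N0 i : (N i)%:R != 0 :> algC.
  by rewrite pnatr_eq0 -lt0n /N; case: (NP i) => ? [].
exists (fun i => (N i)%:R * b i); split; last by move=> i; rewrite /N; case: (NP i) => ? [].
split=> [i|x Lx|a ka e i].
- by apply: (subM LP) => //; apply: (sub_nat LP).
- have [a ka ->] := span x Lx; exists (fun i => a i / (N i)%:R) => [i|].
    by apply: (subM kP) => //; apply: (subV kP); apply: (sub_nat kP).
  by apply: eq_bigr => i _; rewrite mulrA divfK.
- apply: (mulIf (N0 i)); rewrite mul0r.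
  apply: (free (fun i => a i * (N i)%:R)) => [j|].
    by apply: (subM kP) => //; apply: (sub_nat kP).
  by rewrite -[RHS]e; apply: eq_bigr => j _; rewrite mulrA.
Qed.

End FiniteBasis.

Lemma basis_fin_tower (k K L : set algC) (T U : finType) (b : T -> algC) (c : U -> algC) :
  subfield L -> k `<=` K -> subfield K -> K `<=` L -> basis_fin k K b -> basis_fin K L c ->
  basis_fin k L (fun ij : T * U => b ij.1 * c ij.2).
Proof.
move=> LP kK KP KL [Kb spanK freeK] [Lc spanL freeL]; split=> [[i j] /=|x Lx|a ka e].
- by apply: (subM LP) => //; apply: KL.
- have [A KA ->] := spanL x Lx.
  have aP j : {a : T -> algC | (forall i, k (a i)) /\ A j = \sum_i a i * b i}.
    by apply: cid; have [a ? ?] := spanK _ (KA j); exists a.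
  exists (fun ij => sval (aP ij.2) ij.1) => [[i j] /=|].
    by case: (aP j) => ? [].
  rewrite -(pair_big xpredT xpredT (fun i j => sval (aP j) i * (b i * c j))) exchange_big.
  apply: eq_bigr => j _ /=; case: (aP j) => a [_ /= ->]; rewrite mulr_suml.
  by apply: eq_bigr => i _; rewrite mulrA.
- have H j : \sum_i a (i, j) * b i = 0.
    apply: (freeL (fun j => \sum_i a (i, j) * b i)) => [j'|].
      by apply: (sub_sum KP) => i _; apply: (subM KP) => //; apply: kK.
    rewrite -[RHS]e [RHS](eq_bigr (fun ij => a (ij.1, ij.2) * (b ij.1 * c ij.2))); last by case.
    rewrite -(pair_big xpredT xpredT (fun i j => a (i, j) * (b i * c j))) exchange_big.
    apply: eq_bigr => j' _ /=; rewrite mulr_suml.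
    by apply: eq_bigr => i _; rewrite mulrA.
  by move=> [i j]; apply: (freeK (fun i => a (i, j))).
Qed.

Section NormalClosure.
Variables (kapk kapL : algC) (kL : Fix kapL kapk).
Local Notation k := (Fix kapk).
Local Notation L := (Fix kapL).
Variables (T : finType) (e : T -> {rmorphism algC -> algC}).
Hypothesis e_k : forall i, e i kapk = kapk.

Lemma aut_embedding nu M : nu kapk = kapk -> embedding k M nu.
Proof.
move=> nuk; split=> [x|x y _ _|x y _ _]; rewrite ?rmorphD ?rmorphM //.
by rewrite in_setE; apply.
Qed.

Lemma normal_aut_mem nu M x : nu kapk = kapk -> normal_extension k M -> M x -> M (nu x).
Proof.
by move=> nuk [_ _ /(_ nu (aut_embedding M nuk)) e0] Mx; rewrite -e0; exists x.
Qed.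

(** The normal closure contains the field generated by k and the images of L under the [e i]. There
    [sig] is an embedding, and [embedding_aut] replaces it by an automorphism of [algC]. Conversely,
    automorphisms of [algC] over k preserve the normal closure. *)
Lemma normal_closure_aut (t : T -> T) :
  (exists2 sig, automorphism k (normal_closure k L) sig &
     forall i, {in L, forall x, sig (e i x) = e (t i) x}) <->
  exists2 nu : {rmorphism algC -> algC}, nu kapk = kapk & forall i x, L x -> nu (e i x) = e (t i) x.
Proof.
have LP := Fix_subfield kapL; have kP := Fix_subfield kapk.
split=> [[sig [esig sigN] sigE]|[nu nuk nuE]]; last first.
  exists nu; last by move=> i x; rewrite in_setE; apply: nuE.
  split; first exact: aut_embedding.
  have [nu' [K1 K2]] := aut_inv nu.
  have nu'k : nu' kapk = kapk by rewrite -{1}nuk K1.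
  apply/seteqP; split=> [_ [x Nx <-] M MP|y Ny]; last first.
    by exists (nu' y) => // M MP; apply: normal_aut_mem => //; [case: MP|apply: Ny].
  by apply: normal_aut_mem => //; [case: MP|apply: Nx].
have [kapN AkN [kapNF fixN]] := primitive_element (kapk :: [seq e i kapL | i <- enum T]).
have LM M : normal_extension k M -> L `<=` M -> Fix kapN `<=` M.
  move=> nM LM; have [MP kM _] := nM.
  have [D [s [s_inj s_all]]] := Fix_embeddings kapN.
  move=> x /(Fix_repr s_inj s_all)[a [aQ ->]].
  apply: (sub_sum MP) => j _; apply: (subM MP); first exact: (sub_Crat MP).
  apply: (subX MP); apply: kapNF => // y; rewrite inE => /predU1P[->|/mapP[i _ ->]].
    by apply: kM; apply: Fix_gen.
  by apply: normal_aut_mem => //; apply: LM; apply: Fix_gen.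
have NN : Fix kapN `<=` normal_closure k L by move=> x Nx M [nM sLM]; apply: (LM M).
have kN : k `<=` Fix kapN.
  move=> x kx nu /fixN nuN; apply: kx; apply: nuN; exact: mem_head.
have eN i x : L x -> Fix kapN (e i x).
  move=> Lx nu /fixN nuN; apply: (aut_eq_Fix (nu := nu \o e i : {rmorphism _ -> _}) Lx).
  by apply: nuN; rewrite inE; apply/orP; right; apply/mapP; exists i; rewrite ?mem_enum.
have [|nu nuE] := @embedding_aut k kapN sig kP kN.
  have [s1 s2 s3] := esig; split=> // x y; rewrite !in_setE => Nx Ny; [apply: s2|apply: s3];
    by rewrite in_setE; apply: NN.
have kapkk : kapk \in k by rewrite in_setE; apply: Fix_gen.
exists nu.
  rewrite -nuE; last by rewrite in_setE; apply: kN; apply: Fix_gen.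
  by case: esig => + _ _; apply.
move=> i x Lx; rewrite -nuE; last by rewrite in_setE; apply: eN.
by apply: sigE; rewrite in_setE.
Qed.

End NormalClosure.

Lemma ordS_pow (l : nat) (c : nat) (a : 'I_l) :
  val ((perm (@ordS_inj l) ^+ c)%g a) = ((a + c) %% l)%N.
Proof.
elim: c => [|c IH]; first by rewrite expg0 perm1 addn0 modn_small.
by rewrite expgSr permM permE /= IH -addn1 modnDml addn1 addnS.
Qed.

Section DetBlock.
Variable R : comNzRingType.

(** [M] has indices in [nat] so that the induction on [n] can shift the index of the block. *)
Lemma det_block (n l : nat) (M : nat -> nat -> nat -> R) : (0 < l)%N ->
  \det (\matrix_(x < n * l, y < n * l)
          if (x %/ l == y %/ l)%N then M (x %/ l)%N (x %% l)%N (y %% l)%N else 0) =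
  \prod_(i < n) \det (\matrix_(a < l, c < l) M i a c).
Proof.
move=> l0; elim: n M => [|n IH] M; first by rewrite big_ord0 -[RHS](det_mx00 (0 : 'M[R]_0));
  congr (\det _); apply/matrixP => -[].
rewrite big_ord_recl -[X in \det X](@submxK _ l (n * l) l (n * l)).
have -> : dlsubmx (\matrix_(x < l + n * l, y < l + n * l)
   if (x %/ l == y %/ l)%N then M (x %/ l)%N (x %% l)%N (y %% l)%N else 0) = 0.
  apply/matrixP=> x y; rewrite !mxE /= divnDl ?dvdnn // divnn l0.
  by rewrite [(y %/ l)%N]divn_small.
rewrite det_ublock; congr (_ * _).
  congr (\det _); apply/matrixP=> x y; rewrite !mxE /=.
  by rewrite !divn_small // eqxx !modn_small.
rewrite -(IH (fun i => M i.+1)); congr (\det _); apply/matrixP=> x y; rewrite !mxE /=.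
by rewrite !divnDl ?dvdnn // divnn l0 eqn_add2l !modnDl add1n.
Qed.

Lemma det_reindex (m m' : nat) (f : 'I_m -> 'I_m') (A : 'M[R]_m') :
  bijective f -> \det (\matrix_(x, y) A (f x) (f y)) = \det A.
Proof.
move=> bij_f; have mm' : m = m' by have := bij_eq_card bij_f; rewrite !card_ord.
subst m'; pose s := perm (bij_inj bij_f).
have -> : \matrix_(x, y) A (f x) (f y) = row_perm s (col_perm s A).
  by apply/matrixP=> x y; rewrite !mxE !permE.
rewrite row_permE col_permE !det_mulmx !det_perm odd_permV.
by rewrite mulrC -mulrA -signr_addb addbb mulr1.
Qed.

(** The bijection exchanging quotient and remainder turns this matrix into one with [l] equal
    diagonal blocks, without changing the determinant. *)
Lemma det_kron_id (n l : nat) (B : nat -> nat -> R) : (0 < n)%N -> (0 < l)%N ->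
  \det (\matrix_(x < n * l, y < n * l)
          if (x %% l == y %% l)%N then B (x %/ l)%N (y %/ l)%N else 0) =
  \det (\matrix_(i < n, j < n) B i j) ^+ l.
Proof.
move=> n0 l0.
have ltf (x : 'I_(n * l)) : ((x %% l) * n + x %/ l < l * n)%N.
  have h1 : (x %/ l < n)%N by rewrite ltn_divLR.
  have h2 : (x %% l < l)%N by rewrite ltn_pmod.
  by rewrite (@leq_trans ((x %% l).+1 * n)) ?leq_mul2r ?h2 ?orbT // mulSn addnC ltn_add2r.
pose f (x : 'I_(n * l)) : 'I_(l * n) := Ordinal (ltf x).
have fdiv x : (f x %/ n = x %% l)%N.
  by rewrite /= divnMDl // divn_small ?addn0 // ltn_divLR.
have fmod x : (f x %% n = x %/ l)%N.
  by rewrite /= modnMDl modn_small // ltn_divLR.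
have bij_f : bijective f.
  apply: inj_card_bij; last by rewrite !card_ord mulnC.
  move=> x y e; apply: val_inj; rewrite /= (divn_eq x l) (divn_eq y l).
  by rewrite -!fdiv -!fmod e.
have := @det_block l n (fun _ => B) n0; rewrite prodr_const card_ord => <-.
rewrite -(det_reindex _ bij_f); congr (\det _); apply/matrixP=> x y; rewrite !mxE.
by rewrite !fdiv !fmod.
Qed.

End DetBlock.

Definition pair_of_index (n l : nat) (l0 : (0 < l)%N) (x : 'I_(n * l)) : 'I_n * 'I_l :=
  (Ordinal (etrans (ltn_divLR x n l0) (ltn_ord x)), Ordinal (ltn_pmod x l0)).

Lemma pair_of_index_bij (n l : nat) (l0 : (0 < l)%N) : bijective (@pair_of_index n l l0).
Proof.
apply: inj_card_bij; last by rewrite card_prod !card_ord.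
move=> x y [e1 e2]; apply: val_inj; rewrite /= (divn_eq x l) (divn_eq y l).
by rewrite e1 e2.
Qed.

Fixpoint autX nu (i : nat) : {rmorphism algC -> algC} :=
  if i is i'.+1 then (nu \o autX nu i' : {rmorphism algC -> algC}) else idfun.

Lemma autX_fix nu x i : nu x = x -> autX nu i x = x.
Proof. by move=> nux; elim: i => //= i ->. Qed.

Section WreathExtension.
Variables (kapk kapK kapF kapE zeta : algC) (l : nat) (l_prime : prime l).
Hypothesis z_prim : l.-primitive_root zeta.
Hypothesis FK : forall nu, nu kapF = kapF <-> nu kapK = kapK /\ nu zeta = zeta.
Hypothesis AkapE : kapE \in Aint.
Hypothesis nkapE : forall nu, Fix kapE (nu kapE).
Hypothesis FE : Fix kapE kapF.
Hypothesis kK : Fix kapK kapk.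
Variables (n : nat) (mu : 'I_n -> {rmorphism algC -> algC}).
Hypothesis mu_k : forall i, mu i kapk = kapk.
Hypothesis mu_inj : injective (fun i => mu i kapK).
Hypothesis mu_all : forall nu, nu kapk = kapk -> exists i, nu kapK = mu i kapK.

Local Notation k := (Fix kapk).
Local Notation K := (Fix kapK).
Local Notation F := (Fix kapF).
Local Notation E := (Fix kapE).
Local Notation O := (integers E).
Let EP : subfield E := Fix_subfield kapE.
Let KP : subfield K := Fix_subfield kapK.
Let l0 : (0 < l)%N. Proof. exact: prime_gt0. Qed.
Let l1 : (1 < l)%N. Proof. exact: prime_gt1. Qed.

Variables (D : nat) (s : 'I_D -> {rmorphism algC -> algC}).
Hypothesis s_all : forall nu, exists i, nu kapF = s i kapF.

Local Notation Delta := (@Delta kapK zeta l).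
Local Notation nub := (@nub kapK zeta l).
Local Notation gam := (@gam kapK zeta l).
Local Notation eps := (@eps kapK zeta l).
Local Notation nual := (@nual kapK zeta l).
Local Notation emx := (@emx kapK zeta l).
Local Notation one_l := (one_l l_prime).

Lemma E_fixes nu : nu kapE = kapE -> nu kapK = kapK /\ nu zeta = zeta.
Proof. by move=> nuE; apply/FK; apply: FE. Qed.

Lemma conj_fixes nu mu0 mu' : nu kapE = kapE -> cancel mu0 mu' -> cancel mu' mu0 ->
  (mu' \o nu \o mu0 : {rmorphism _ -> _}) kapE = kapE.
Proof. by move=> nuE K1 K2 /=; rewrite (nkapE mu0 nuE) K1. Qed.

(** The right-hand side is the Kummer element over F, so that [gam alpha 1] is the radical
    generating L F. *)
Lemma gam_l alpha : gam alpha 1 ^+ l = \prod_(b | Delta b) nub b alpha ^+ b.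
Proof.
rewrite /gam -prodrXl; apply: eq_bigr => b Db.
by rewrite mul1n modn_small // exprAC rhoX.
Qed.

Section Alpha.
Variables (alpha : algC) (Oalpha : integers F alpha).
Variables (z : int) (nrmE : nrm s alpha = z%:~R) (z0 : z != 0).
Hypothesis alpha1 : exists2 y, y \in Aint & alpha = 1 + (l ^ 2)%:R * y.
Variables (p : nat) (p_prime : prime p) (radp : radical E (mult E p%:R)).
Hypotheses (zp : (p %| `|z|)%N) (zp2 : ~~ (p ^ 2 %| `|z|)%N).

Let Falpha : F alpha. Proof. by case: Oalpha. Qed.

Lemma alpha_neq0 : alpha != 0.
Proof.
have [i0 i0P] := s_id s_all.
apply: contraNneq z0 => a0; rewrite -(intr_eq0 algC) -nrmE /nrm (bigD1 i0) //=.
by rewrite a0 rmorph0 mul0r.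
Qed.
Let a0 := alpha_neq0.

Lemma nual_neq0 : nual alpha != 0.
Proof. by apply/prodf_neq0 => b _; rewrite fmorph_eq0. Qed.

Lemma det_emx_neq0 : \det (emx alpha) != 0.
Proof.
have e := det_emx kapK l_prime z_prim a0.
by have : \det (emx alpha) ^+ 2 != 0; [rewrite e expf_neq0 // nual_neq0 | rewrite sqrf_eq0].
Qed.

(* The action of an automorphism over E on the n conjugates of the cyclic extension. *)
Definition shifts nu (v : 'I_n -> nat) := nu kapE = kapE /\ forall i,
  (forall a, nu (mu i (eps alpha a)) = mu i (eps alpha (a + v i))) /\
  (forall j, nu (mu i (gam alpha j)) = mu i (zeta ^+ (j * v i) * gam alpha j)).

Lemma shifts_ex nu : nu kapE = kapE -> exists v, shifts nu v.
Proof.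
move=> nuE.
suff tP i : {t : nat | (forall a, nu (mu i (eps alpha a)) = mu i (eps alpha (a + t))) /\
  (forall j, nu (mu i (gam alpha j)) = mu i (zeta ^+ (j * t) * gam alpha j))}.
  by exists (fun i => sval (tP i)); split=> // i; case: (tP i).
apply: cid; have [mu' [K1 K2]] := aut_inv (mu i).
have [nuK nuz] := E_fixes (conj_fixes nuE K1 K2).
have [t [tE tG]] := eps_action l_prime z_prim FK Falpha a0 nuK.
exists t; split=> [a|j]; first by rewrite -tE /= K2.
by rewrite -(tG nuz) /= K2.
Qed.

Lemma shifts_mod nu v v' : (forall i, v i = v' i %[mod l])%N -> shifts nu v -> shifts nu v'.
Proof.
move=> vv' [nuE nuS]; split=> // i; have [e g] := nuS i; split=> [a|j].
  by rewrite e -(eps_mod _ z_prim) -modnDmr vv' modnDmr (eps_mod _ z_prim).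
by rewrite g (eq_zeta z_prim (b := j * v' i)) // -modnMmr vv' modnMmr.
Qed.

Lemma shifts0 : shifts idfun (fun=> 0%N).
Proof. by split=> // i; split=> [a|j] /=; rewrite ?addn0 // muln0 expr0 mul1r. Qed.

Lemma shiftsD nu nu' v v' : shifts nu v -> shifts nu' v' ->
  shifts (nu \o nu' : {rmorphism _ -> _}) (fun i => v' i + v i)%N.
Proof.
move=> [nuE nuS] [nuE' nuS']; split=> [|i]; first by rewrite /= nuE'.
have [e g] := nuS i; have [e' g'] := nuS' i; split=> [a|j] /=.
  by rewrite e' e addnA.
have muz : nu (mu i zeta) = mu i zeta.
  have [mu' [K1 K2]] := aut_inv (mu i).
  have [_ nuz] := E_fixes (conj_fixes nuE K1 K2).
  by apply: (can_inj K2); rewrite K1; exact: nuz.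
rewrite g' rmorphM rmorphM g rmorphXn rmorphXn muz mulnDr exprD.
by rewrite !rmorphM !rmorphXn mulrA.
Qed.

Lemma conj_distinct i0 i b mu' : cancel (mu i0) mu' -> cancel mu' (mu i0) -> Delta b ->
  mu' (mu i (nub b kapF)) = kapF -> i = i0 /\ b = one_l.
Proof.
move=> K1 K2 Db e.
have [bK bz] := nubP Db.
have /FK[eK ez] : (mu' \o mu i \o nub b : {rmorphism _ -> _}) kapF = kapF by [].
have ii0 : i = i0.
  by apply: mu_inj; rewrite /= -[LHS]K2; congr (mu i0 _); rewrite -[RHS]eK /= bK.
split=> //; apply: (nub_inj z_prim FK Db (Delta1 kapK zeta l_prime)).
have -> : nub one_l kapF = kapF by apply: (nub1 l_prime FK); apply: Fix_gen.
by rewrite -[RHS]e ii0 K1.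
Qed.

(* Otherwise the product [y] of powers of the conjugates of [gam 1] would belong to E, although
   the valuation of [y ^+ l] at a prime above [p] dividing [alpha] is prime to [l]. *)
Lemma independence (c : 'I_n -> nat) : (exists i, ~~ (l %| c i)%N) ->
  exists nu v, shifts nu v /\ ~~ (l %| \sum_i c i * v i)%N.
Proof.
move=> [i0 ci0]; apply: contrapT => /forallNP H.
have rP i : {rr : nat * nat | [/\ mu i zeta = zeta ^+ rr.1, coprime rr.1 l & (rr.1 * rr.2 = 1
  %[mod l])%N]}.
  by apply: cid; have [r [r' rP]] := aut_zeta l_prime z_prim (mu i); exists (r, r').
pose r i := (sval (rP i)).1; pose r' i := (sval (rP i)).2.
have muz i : mu i zeta = zeta ^+ r i by rewrite /r; case: (rP i) => /= ? [].
have cr i : coprime (r i) l by rewrite /r; case: (rP i) => /= ? [].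
have rr' i : (r i * r' i = 1 %[mod l])%N by rewrite /r /r'; case: (rP i) => /= ? [].
(* The exponent [r' i] undoes the effect of [mu i] on [zeta], so that an automorphism with shifts
   [v] multiplies [y] by [zeta] to the power [\sum_i c i * v i]. *)
pose y := \prod_i mu i (gam alpha 1) ^+ (c i * r' i).
have Ey : E y.
  move=> nu nuE; have [v vP] := shifts_ex nuE.
  have lcv : (l %| \sum_i c i * v i)%N.
    by apply: contrapT => /negP lcv; apply: (H nu); exists v.
  have [_ vS] := vP.
  rewrite /y rmorph_prod /= (eq_bigr (fun i => zeta ^+ (c i * v i) * mu i (gam alpha 1) ^+ (c i *
    r' i))).
    rewrite big_split /= prodrXr -(zeta_modn z_prim) (eqP lcv) expr0 mul1r //.
  move=> i _; rewrite rmorphXn (vS i).2 mul1n rmorphM rmorphXn muz -exprM exprMn -exprM.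
  congr (_ * _); apply: (eq_zeta z_prim).
  have -> : (r i * v i * (c i * r' i) = (r i * r' i) * (c i * v i))%N by ring.
  by rewrite -modnMml rr' modnMml mul1n.
have [mu' [K1 K2]] := aut_inv (mu i0).
have Ey' : E (mu' y) by apply: Fix_normal.
have [P [PP Pp Pa]] := prime_over AkapE FE p_prime Oalpha nrmE zp zp2.
have ua := norm_uniformizer nkapE FE s_all p_prime Oalpha nrmE zp zp2 PP Pp (nu0 := idfun) Pa.
pose f (ib : 'I_n * 'I_l) := mu' (mu ib.1 (nub ib.2 alpha)) ^+ (ib.2 * (c ib.1 * r' ib.1)).
have yl : mu' y ^+ l = \prod_(ib | Delta ib.2) f ib.
  rewrite /y -rmorphXn -prodrXl rmorph_prod.
  rewrite (eq_bigr (fun i => \prod_(b | Delta b) f (i, b))) => [|i _].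
    by rewrite pair_big_dep.
  rewrite exprAC -rmorphXn gam_l -!rmorphXn -prodrXl !rmorph_prod.
  by apply: eq_bigr => b Db; rewrite -exprM !rmorphXn.
have iE : f (i0, one_l) = alpha ^+ (c i0 * r' i0) by rewrite /f /= mul1n (nub1 l_prime FK) // K1.
(* After the application of [mu'], the factor of index [(i0, one_l)] is a power of [alpha] itself,
   while all the others are powers of different conjugates of [alpha], which are outside [P]. *)
rewrite (bigD1 (i0, one_l)) /= ?Delta1 // in yl.
rewrite iE in yl.
set w := \prod_(_ | _) _ in yl.
have Of i b : O (mu' (mu i (nub b alpha))).
  by do 3![apply: (int_normal nkapE)]; apply: (intF_E FE).
have Ow : O w by apply: (int_prod EP) => ib _; apply: (intX EP).
apply: (uniformizer_val AkapE p_prime radp PP Pp (s := 1) (w := w) (e := (c i0 * r' i0)%N) l_prime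
  ua Ey' (int1 EP) _ Ow _ _).
- by case: PP.
- apply: (prime_prodN EP PP) => [ib|[i b] /= /andP[Db ib0]]; first by apply: (intX EP).
  apply: (prime_expN PP) => //.
  apply: (norm_conj AkapE nkapE FE s_all p_prime radp Oalpha nrmE zp zp2 PP Pp (nu0 := idfun) Pa
    (nu := mu' \o mu i \o nub b : {rmorphism _ -> _})).
  apply: contraNneq ib0 => /(conj_distinct K1 K2 Db)[-> ->]; exact: eqxx.
- rewrite Euclid_dvdM // negb_or ci0; apply/negP => lr.
  by have := rr' i0; rewrite (eqP (dvdn_mull _ lr)) modn_small.
- by rewrite mulr1 yl.
Qed.

(* The shifts modulo [l] form a subspace annihilated by no nonzero linear form. *)
Lemma shifts_all (v : 'I_n -> nat) : exists nu, shifts nu v.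
Proof.
pose S : {set 'rV['F_l]_n} := [set w : 'rV['F_l]_n | `[< exists nu v, shifts nu v /\
  forall i, (v i)%:R = w 0 i >]]%SET.
have SP (w : 'rV['F_l]_n) : reflect (exists nu v, shifts nu v /\ forall i, (v i)%:R = w 0 i) (w
  \in S).
  by rewrite inE; apply: asboolP.
have eqF (x y : nat) : x%:R = y%:R :> 'F_l -> (x = y %[mod l])%N.
  by move=> e; rewrite -(val_Fp_nat l_prime x) -(val_Fp_nat l_prime y) e.
have S0 : 0 \in S.
  by apply/SP; exists idfun, (fun=> 0%N); split=> [|i]; [apply: shifts0|rewrite mxE].
have SD w w' : w \in S -> w' \in S -> w + w' \in S.
  move=> /SP[nu [u [nuS uE]]] /SP[nu' [u' [nuS' uE']]]; apply/SP.
  exists (nu \o nu' : {rmorphism _ -> _}), (fun i => u' i + u i)%N.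
  by split=> [|i]; [apply: shiftsD|rewrite mxE natrD uE uE' addrC].
have SZ (a : 'F_l) w : w \in S -> a *: w \in S.
  move=> Sw; rewrite -[a]natr_Zp scaler_nat.
  by elim: (val a) => [|m IH]; rewrite ?mulr0n // mulrS; apply: SD.
pose W := \matrix_(r < #|S|) (enum_val r : 'rV['F_l]_n).
have WS w : (w <= W)%MS -> w \in S.
  move=> /submxP[u ->]; rewrite mulmx_sum_row; apply: (big_ind (fun w => w \in S)) => // r _.
  by apply: SZ; rewrite rowK; apply: enum_valP.
have SW w : w \in S -> (w <= W)%MS.
  by move=> Sw; rewrite -(enum_rankK_in Sw Sw) -(rowK (fun r => enum_val r : 'rV_n)) row_sub.
pose w0 : 'rV['F_l]_n := \row_i (v i)%:R.
have [/WS/SP[nu [u [nuS uE]]]|] := boolP (w0 <= W)%MS.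
  exists nu; apply: shifts_mod nuS => i; apply: eqF.
  by rewrite uE mxE.
rewrite submxE => w0W.
(* A column of the cokernel of [W] is a linear form that vanishes on all shifts but not on [w0]; its
   coefficients are the [c i] to which [independence] is applied. *)
have [j wj] : exists j, (w0 *m cokermx W) 0 j != 0.
  apply: contrapT => /forallNP H; move/negP: w0W; apply; apply/eqP/rowP => j.
  by rewrite [RHS]mxE; apply: contrapT => /eqP; apply: H.
pose c i : nat := cokermx W i j.
have cE i : (c i)%:R = cokermx W i j by rewrite natr_Zp.
have lE m : (l %| m)%N = (m%:R == 0 :> 'F_l) by rewrite (dvdn_pcharf (pchar_Fp l_prime)).
have [|nu [u [nuS]]] := independence (c := c).
  apply: contrapT => /forallNP H; move/negP: wj; apply; rewrite mxE.
  apply/eqP/big1 => i _; suff -> : cokermx W i j = 0 by rewrite mulr0.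
  by rewrite -cE; apply/eqP; rewrite -lE; apply: contrapT => /negP; apply: H.
rewrite lE => /negP[]; pose w : 'rV['F_l]_n := \row_i (u i)%:R.
have : w \in S by apply/SP; exists nu, u; split=> // i; rewrite mxE.
move=> /SW; rewrite submxE => /eqP/rowP/(_ j); rewrite !mxE => e.
apply/eqP; rewrite -[RHS]e natr_sum; apply: eq_bigr => i _.
by rewrite mxE natrM cE mulrC.
Qed.

(** The automorphism shifting every conjugate by 1 is carried back by the [mu i] that is the
    identity on K. This [mu i] may move [zeta], which is harmless: by normality of E the conjugated
    automorphism still fixes E. *)
Lemma generator_ex : exists tau : {rmorphism algC -> algC},
  tau kapE = kapE /\ forall a, tau (eps alpha a) = eps alpha a.+1.
Proof.
have [i iK] := mu_all (erefl (idfun kapk)).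
have [mu' [K1 K2]] := aut_inv (mu i).
have [nu [nuE nuS]] := shifts_all (fun=> 1%N).
exists (mu' \o nu \o mu i : {rmorphism _ -> _}); split; first exact: conj_fixes.
by move=> a /=; rewrite (nuS i).1 K1 addn1.
Qed.

Section Generator.
Variables (tau : {rmorphism algC -> algC}) (tauE : tau kapE = kapE).
Hypothesis tau_eps : forall a, tau (eps alpha a) = eps alpha a.+1.

Lemma tauX_eps i a : autX tau i (eps alpha a) = eps alpha (a + i).
Proof. by elim: i => [|i IH]; rewrite ?addn0 //= IH tau_eps addnS. Qed.

Lemma tauX_E i x : E x -> autX tau i x = x.
Proof. by move=> Ex; apply: autX_fix; apply: Ex. Qed.

Lemma F_E x : F x -> E x.
Proof. by move=> Fx; apply: (F_sub_E FE). Qed.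

Lemma K_F x : K x -> F x.
Proof. by move=> Kx nu /FK[nuK _]; apply: Kx. Qed.

Lemma k_K x : k x -> K x.
Proof. by move=> kx nu nuK; apply: kx; apply: kK. Qed.

Lemma tauX_K i x : K x -> autX tau i x = x.
Proof. by move=> Kx; apply/tauX_E/F_E/K_F. Qed.

Lemma KkapK : K kapK. Proof. exact: Fix_gen. Qed.

Lemma eps_inj a b : eps alpha a = eps alpha b -> (a = b %[mod l])%N.
Proof.
move=> e; pose a' : 'I_l := Ordinal (ltn_pmod a l0); pose b' : 'I_l := Ordinal (ltn_pmod b l0).
have [[ab]//|ab] := eqVneq a' b'.
have : \det (emx alpha) == 0; last by rewrite (negPf det_emx_neq0).
apply/eqP; apply: (determinant_alternate ab) => j; rewrite !mxE /=.
rewrite -(eps_mod _ z_prim) modnDml (eps_mod _ z_prim) -tauX_eps e tauX_eps.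
by rewrite -(eps_mod _ z_prim) -modnDml (eps_mod _ z_prim).
Qed.

Variables (kapL : algC).
Hypothesis kapLP : forall nu, nu kapL = kapL <->
  nu kapK = kapK /\ forall a, nu (eps alpha a) = eps alpha a.
Local Notation L := (Fix kapL).
Let LP : subfield L := Fix_subfield kapL.

Lemma K_L x : K x -> L x.
Proof. by move=> Kx nu /kapLP[nuK _]; apply: Kx. Qed.

Lemma k_L : k `<=` L. Proof. by move=> x /k_K/K_L. Qed.

Lemma eps_L a : L (eps alpha a).
Proof. by move=> nu /kapLP[_]. Qed.

Lemma L_eq nu nu' x : L x -> nu kapK = nu' kapK ->
  (forall a, nu (eps alpha a) = nu' (eps alpha a)) -> nu x = nu' x.
Proof.
have [mu' [K1 K2]] := aut_inv nu' => Lx eK ee.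
have fL : (mu' \o nu : {rmorphism _ -> _}) kapL = kapL.
  by apply/kapLP; split=> [|a] /=; rewrite ?eK ?ee K1.
by apply: (can_inj K2); rewrite K1; apply: (Lx (mu' \o nu : {rmorphism _ -> _})).
Qed.

Lemma L_shift nu : nu kapK = kapK -> exists t, forall x, L x -> nu x = autX tau t x.
Proof.
move=> nuK; have [t [tE _]] := eps_action l_prime z_prim FK Falpha a0 nuK.
exists t => x Lx; apply: (L_eq Lx) => [|a]; first by rewrite tauX_K // KkapK.
by rewrite tE tauX_eps.
Qed.

Lemma tauX_mod a b x : L x -> (a = b %[mod l])%N -> autX tau a x = autX tau b x.
Proof.
move=> Lx ab; apply: (L_eq Lx) => [|c]; first by rewrite !tauX_K //; apply: KkapK.
by rewrite !tauX_eps -(eps_mod _ z_prim) -modnDmr ab modnDmr (eps_mod _ z_prim).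
Qed.

Lemma tauX_add a b x : autX tau a (autX tau b x) = autX tau (a + b) x.
Proof. by elim: a => //= a ->. Qed.

Lemma tauX_L a x : L x -> L (autX tau a x).
Proof.
move=> Lx nu /kapLP[nuK nue].
apply: (L_eq (nu := nu \o autX tau a : {rmorphism _ -> _}) Lx) => [|b] /=.
  by rewrite (tauX_K a KkapK).
by rewrite (tauX_eps a b) nue.
Qed.

Definition basisL (c : 'I_l) := eps alpha c.

Lemma det_tau : \det (\matrix_(i, j < l) autX tau i (basisL j)) != 0.
Proof.
suff -> : \matrix_(i, j < l) autX tau i (basisL j) = emx alpha by exact: det_emx_neq0.
by apply/matrixP=> i j; rewrite !mxE tauX_eps addnC.
Qed.

Lemma basisLP : basis_fin K L basisL.
Proof.
split=> [c|x Lx|a Ka e c].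
- exact: eps_L.
- have [|a [aK aE]] := @cramer_fixed (fun nu => nu kapK = kapK) l (fun i :
  'I_l => autX tau i) basisL x det_tau.
    move=> nu nuK i'; have [t tE] := L_shift nuK.
    (* [l - t %% l] stands for the opposite of [t] modulo [l]. *)
    exists (Ordinal (ltn_pmod (i' + (l - t %% l)) l0)) => /=.
    have modE : (t + (i' + (l - t %% l)) %% l = i' %[mod l])%N.
      rewrite modnDmr addnCA -modnDmr -[X in (_ + X)%N]modnDml.
      by rewrite subnKC ?modnn ?addn0 // ltnW // ltn_pmod.
    split=> [|j]; rewrite tE ?tauX_add; try exact: tauX_mod modE; try exact: tauX_L.
    - by apply: tauX_mod => //; apply: eps_L.
    - by apply: tauX_L; apply: eps_L.
  exists a => [c|]; first by move=> nu nuK; apply: aK.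
  exact: aE (Ordinal l0).
- have H : emx alpha *m \col_j a j = 0.
    apply/colP=> i; rewrite !mxE.
    transitivity (autX tau i (\sum_j a j * basisL j)); last by rewrite e rmorph0.
    rewrite rmorph_sum; apply: eq_bigr => j _.
    by rewrite !mxE rmorphM tauX_K // tauX_eps mulrC addnC.
  have uM : emx alpha \in unitmx by rewrite unitmxE unitfE det_emx_neq0.
  have /colP/(_ c) : \col_j a j = 0 by rewrite -(mulKmx uM (\col_j a j)) H mulmx0.
  by rewrite !mxE.
Qed.

Definition embL (ia : 'I_n * 'I_l) : {rmorphism algC -> algC} := mu ia.1 \o autX tau ia.2.

Lemma kapk_K : K kapk. Proof. exact: kK. Qed.

Lemma embL_k ia : embL ia kapk = kapk.
Proof. by rewrite /= (tauX_K ia.2 kapk_K). Qed.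

Lemma embL_K ia x : K x -> embL ia x = mu ia.1 x.
Proof. by move=> Kx; rewrite /= (tauX_K ia.2 Kx). Qed.

Lemma embL_all nu : nu kapk = kapk -> exists ia, forall x, L x -> nu x = embL ia x.
Proof.
move=> nuk; have [i iK] := mu_all nuk; have [mu' [K1 K2]] := aut_inv (mu i).
have nuK' : (mu' \o nu : {rmorphism _ -> _}) kapK = kapK by rewrite /= iK K1.
have [t tE] := L_shift nuK'.
exists (i, Ordinal (ltn_pmod t l0)) => x Lx /=.
by rewrite (@tauX_mod _ t) ?modn_mod // -(tE x Lx) /= K2.
Qed.

Lemma embL_inj ia jb : (forall x, L x -> embL ia x = embL jb x) -> ia = jb.
Proof.
case: ia jb => [i a] [j b] e.
have ij : i = j.
  by apply: mu_inj; have := e _ (K_L KkapK); rewrite /= (tauX_K a KkapK) (tauX_K b KkapK).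
subst j; congr (_, _); apply: val_inj.
have /fmorph_inj : mu i (eps alpha a) = mu i (eps alpha b).
  by have := e _ (eps_L 0); rewrite /= (tauX_eps a 0) (tauX_eps b 0) !add0n.
by move/eps_inj; rewrite !modn_small.
Qed.

Lemma embL_enumerates : enumerates_embeddings k L (fun ia => embL ia : algC -> algC).
Proof.
split=> [ia|ia jb e|sg sgP].
- exact: aut_embedding (embL_k ia).
- by apply: embL_inj => x Lx; apply: e; rewrite in_setE.
- have [nu nuE] := embedding_aut (Fix_subfield kapk) k_L sgP.
  have nuk : nu kapk = kapk.
    rewrite -nuE; last by rewrite in_setE; apply: k_L; apply: Fix_gen.
    by case: sgP => + _ _; apply; rewrite in_setE; apply: Fix_gen.
  have [ia iaE] := embL_all nuk; exists ia => x Lx.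
  by rewrite nuE // iaE // -in_setE.
Qed.

Variable H : {group 'S_n}.
Hypothesis galH : forall t : 'S_n, t \in H <->
  exists2 nu : {rmorphism algC -> algC}, nu kapk = kapk &
    forall i x, K x -> nu (mu i x) = mu (t i) x.

(** An automorphism over k permutes the blocks and, by [L_shift], translates inside each of them.
    Conversely, one inducing [h] on K translates the blocks by uncontrolled amounts [b i];
    [shifts_all] provides an automorphism over E, trivial on the conjugates of K, that corrects them
    to [c i]. *)
Lemma wreath_aut (t : {perm 'I_n * 'I_l}) : t \in wreath (cyclic_perm_group l) H <->
  exists2 nu : {rmorphism algC -> algC}, nu kapk = kapk &
    forall ia x, L x -> nu (embL ia x) = embL (t ia) x.
Proof.
split=> [/wreathP[h hH [f fC tE]]|[nu nuk nuE]]; last first.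
  have hP i : {j | nu (mu i kapK) = mu j kapK}.
    apply: cid; apply: (mu_all (nu := nu \o mu i : {rmorphism _ -> _})).
    by rewrite /= mu_k.
  pose h i := sval (hP i).
  have hE i : nu (mu i kapK) = mu (h i) kapK by rewrite /h; case: (hP i).
  have h_inj : injective h.
    by move=> i j e; apply/mu_inj/(fmorph_inj nu); rewrite !hE e.
  have t1 i a : (t (i, a)).1 = h i.
    apply: mu_inj; rewrite -hE -(embL_K (t (i, a)) KkapK) -nuE; last exact: K_L KkapK.
    by rewrite embL_K //; apply: KkapK.
  pose o0 : 'I_l := Ordinal l0.
  pose c i : nat := (t (i, o0)).2.
  have t2 i (a : 'I_l) : (t (i, a)).2 = ((a + c i) %% l)%N :> nat.
    rewrite -[LHS](modn_small (ltn_ord (t (i, a)).2)); apply: eps_inj.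
    apply: (fmorph_inj (mu (h i))).
    have := nuE (i, a) _ (eps_L 0).
    rewrite /embL /= (tauX_eps a 0) (tauX_eps (t (i, a)).2 0) !add0n t1 => <-.
    have := nuE (i, o0) _ (eps_L a).
    by rewrite /embL /= (tauX_eps (t (i, o0)).2 a) t1.
  apply/wreathP; exists (perm h_inj).
    apply/galH; exists nu => // i x Kx; rewrite permE.
    exact: (aut_eq_Fix (nu := nu \o mu i : {rmorphism _ -> _}) Kx (hE i)).
  exists [ffun i => (perm (@ordS_inj l) ^+ c i)%g] => [i|[i a]].
    by rewrite ffunE mem_cycle.
  rewrite /= permE ffunE [t (i, a)]surjective_pairing t1; congr (_, _).
  by apply: val_inj; rewrite ordS_pow; apply: t2.
have [nu1 nu1k nu1E] := (galH h).1 hH.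
have cP i : {c | f i = (perm (@ordS_inj l) ^+ c)%g}.
  by apply: cid; apply/cycleP; apply: fC.
pose c i := sval (cP i).
have fE i : f i = (perm (@ordS_inj l) ^+ c i)%g by rewrite /c; case: (cP i).
have bP i : {b | forall x, L x -> nu1 (mu i x) = mu (h i) (autX tau b x)}.
  apply: cid; have [mu' [K1 K2]] := aut_inv (mu (h i)).
  have nK : (mu' \o nu1 \o mu i : {rmorphism _ -> _}) kapK = kapK.
    by rewrite /= nu1E ?K1 //; apply: KkapK.
  have [b bE] := L_shift nK; exists b => x Lx.
  by rewrite -bE //= K2.
pose b i := sval (bP i).
have bE i x : L x -> nu1 (mu i x) = mu (h i) (autX tau (b i) x) by rewrite /b;
  case: (bP i) => ? /=; apply.
(* This is [c - b] modulo [l], moved by [h] because the correction acts after [nu1], when block [i]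
   has become block [h i]. *)
pose v j := (c ((h^-1)%g j) + (l - b ((h^-1)%g j) %% l))%N.
have [nu2 [nu2E nu2S]] := shifts_all v.
exists (nu2 \o nu1 : {rmorphism _ -> _}).
  by rewrite /= nu1k; apply: (F_E (K_F kapk_K)).
have muE j : E (mu j kapK) by apply: Fix_normal => //; apply/F_E/K_F/KkapK.
move=> [i a] x Lx.
apply: (L_eq (nu := nu2 \o nu1 \o embL (i, a) : {rmorphism _ -> _}) Lx) => [|a'].
  rewrite /= (tauX_K a KkapK) (nu1E i kapK KkapK) (muE (h i) nu2 nu2E) tE /=.
  by rewrite (tauX_K (f i a) KkapK).
rewrite /= (tauX_eps a a') (bE i _ (eps_L _)) (tauX_eps (b i)).
rewrite (nu2S (h i)).1 tE /= (tauX_eps (f i a) a') fE ordS_pow; congr (mu _ _).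
rewrite -(eps_mod _ z_prim) -[RHS](eps_mod _ z_prim); congr (eps _ _).
rewrite modnDmr /v permK -!addnA -modnDmr -[in RHS]modnDmr; congr ((_ + _) %% l)%N.
rewrite -modnDmr -[in RHS]modnDmr; congr ((_ + _) %% l)%N.
rewrite addnCA -modnDmr -[X in (_ + X)%N]modnDml.
by rewrite subnKC ?modnn ?addn0 // ltnW // ltn_pmod.
Qed.

Lemma L_has_galois_group (bK : 'I_n -> algC) : basis_fin k K bK ->
  has_galois_group k L (wreath (cyclic_perm_group l) H).
Proof.
move=> bKP; split.
  have bLP := basis_fin_tower LP k_K KP K_L bKP basisLP.
  have := basis_fin_bij (@enum_val_bij ('I_n * 'I_l)%type) bLP.
  by exists ((fun ij => bK ij.1 * basisL ij.2) \o enum_val).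
exists (fun ia => embL ia : algC -> algC); first exact: embL_enumerates.
move=> t; rewrite wreath_aut; apply: iff_sym.
have kapkL : L kapk by apply/K_L/kapk_K.
have := @normal_closure_aut kapk kapL _ embL embL_k (fun ia => t ia).
exact.
Qed.

(** The discriminant formula for the tower: the matrix of conjugates of the products [bK j * eps c]
    is a block diagonal matrix of conjugates of the [eps], times the Kronecker product of the matrix
    of K/k with an identity matrix. *)
Lemma L_discriminant (bK : 'I_n -> algC) : basis_fin k K bK -> (forall i, bK i \in Aint) ->
  discriminant k L ((\prod_i mu i (nual alpha)) ^+ l.-1 *
    ((\det (\matrix_(i, j) mu i (bK j))) ^+ 2) ^+ l).
Proof.
move=> bKP AbK; apply: sub_generated.
have n0 : (0 < n)%N by have [[i lti] _] := mu_all (erefl (idfun kapk)); apply: leq_ltn_trans lti.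
pose pr := @pair_of_index n l l0; have bij_pr : bijective pr := pair_of_index_bij n l0.
have bLP := basis_fin_tower LP k_K KP K_L bKP basisLP.
pose bL (ij : 'I_n * 'I_l) := bK ij.1 * basisL ij.2.
exists (n * l)%N, (bL \o pr), (fun x => embL (pr x)); split.
- exact: basis_fin_bij bij_pr bLP.
- by move=> j; apply: rpredM => //; apply: (Aint_eps kapK l_prime z_prim alpha1).
- have [e1 e2 e3] := embL_enumerates; split=> [i|i j /e2|s' /e3[ia iaE]].
  + exact: e1.
  + exact: (bij_inj bij_pr).
  + by have [g _ gK] := bij_pr; exists (g ia); rewrite gK.
(* The value 0 outside the range extends the entries to indices in [nat], as [det_block] and
   [det_kron_id] require. *)
pose M (i a c : nat) := oapp (fun i' : 'I_n => mu i' (eps alpha (a + c))) 0 (insub i).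
pose B (i j : nat) := oapp (fun i' : 'I_n => oapp (fun j' :
  'I_n => mu i' (bK j')) 0 (insub j)) 0 (insub i).
pose A1 := \matrix_(x < n * l, y < n * l)
   if (x %/ l == y %/ l)%N then M (x %/ l)%N (x %% l)%N (y %% l)%N else 0.
pose A2 := \matrix_(x < n * l, y < n * l)
   if (x %% l == y %% l)%N then B (x %/ l)%N (y %/ l)%N else 0.
have -> : \matrix_(i, j) embL (pr i) ((bL \o pr) j) = A1 *m A2.
  have [g gK Kg] := bij_pr.
  apply/matrixP=> x y; rewrite !mxE [(bL \o pr) y]/=.
  have v1 u ij : pr u = ij -> (u %/ l = ij.1)%N by move=> <-.
  have v2 u ij : pr u = ij -> (u %% l = ij.2)%N by move=> <-.
  case xE: (pr x) => [i a]; case yE: (pr y) => [j c].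
  have zE : pr (g (i, c)) = (i, c) by rewrite Kg.
  rewrite (bigD1 (g (i, c))) //= big1 => [|w wz].
    rewrite !mxE (v1 _ _ zE) (v2 _ _ zE) (v1 _ _ xE) (v2 _ _ xE) (v1 _ _ yE) (v2 _ _ yE).
    rewrite !eqxx addr0 /M /B !valK /= rmorphM /= (tauX_K a (_ : K (bK j))); last by case: bKP.
    by rewrite /basisL (tauX_eps a c) rmorphM mulrC addnC.
  rewrite !mxE; case: eqP => [e1|]; last by rewrite mul0r.
  case: eqP => [e2|]; last by rewrite mulr0.
  case/eqP: wz; rewrite -(gK w); congr (g _).
  rewrite [pr w]surjective_pairing; congr (_, _); apply: val_inj.
    by rewrite /= -e1 (v1 _ _ xE).
  by rewrite /= e2 (v2 _ _ yE).
rewrite det_mulmx det_block // det_kron_id // [RHS]exprMn; congr (_ * _).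
  rewrite -[LHS]prodrXl -[RHS]prodrXl; apply: eq_bigr => i _.
  rewrite -rmorphXn -(det_emx kapK l_prime z_prim a0) rmorphXn -det_map_mx.
  by congr (\det _ ^+ 2); apply/matrixP=> a c; rewrite !mxE /M valK.
rewrite [RHS]exprAC.
suff -> : \matrix_(i < n, j < n) mu i (bK j) = \matrix_(i, j) B i j by [].
by apply/matrixP=> i j; rewrite !mxE /B !valK.
Qed.

(* At [pk] the discriminant of the basis [eps] of L over K is congruent to 1, so [trace_radical]
   shows that the ideal extended to L is radical. *)
Lemma L_unramified (pk : set algC) (m : nat) : kapK \in Aint -> kapL \in Aint ->
  prime_ideals k pk -> unramified K pk -> (0 < m)%N -> pk m%:R ->
  (exists2 y, y \in Aint & alpha = 1 + m%:R * y) -> unramified L pk.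
Proof.
move=> AkapK AkapL pkP [Ps [uPs PsP pkE]] m0 pkm [y Ay alphaE].
have kP := Fix_subfield kapk.
have [ipk _ _ _] := pkP; have [pkO _ _ _] := ipk.
pose I := ideal_generated K pk.
have pkI : pk `<=` I by exact: sub_generated.
have pkOK : pk `<=` integers K by move=> x /pkO[/k_K Kx Ax].
have iI : ideal K I by apply: ideal_generated_ideal.
have rI : radical K I by rewrite /I pkE; apply: prod_primes_radical.
pose R := ideal_generated L I.
have IOL : I `<=` integers L by case: iI => IO _ _ _ x /IO[/K_L].
have iR : ideal L R by apply: ideal_generated_ideal.
have IR : I `<=` R by exact: sub_generated.
have trK x : L x -> K (\sum_(i < l) autX tau i x).
  move=> Lx nu nuK; have [t tE] := L_shift nuK.
  rewrite rmorph_sum /=.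
  pose f (i : 'I_l) : 'I_l := Ordinal (ltn_pmod (t + i) l0).
  have f_inj : injective f.
    move=> i j [/eqP]; rewrite eqn_modDl !modn_small // => /eqP e; exact: val_inj.
  rewrite [RHS](reindex_inj f_inj); apply: eq_bigr => i _.
  rewrite (tE _ (tauX_L i Lx)) (tauX_add t i); apply: tauX_mod => //.
  by rewrite /= modn_mod.
have trO x : integers L x -> integers K (\sum_(i < l) autX tau i x).
  by move=> [Lx Ax]; split; [apply: trK|apply: rpred_sum => i _; rewrite Aint_aut].
(* Traces of multiples of elements of [R] lie in [I]. Since [eps 0] has trace 1 by [sum_eps], an
   integer [t] of K is the trace of [t * eps 0], which gives the contraction property [contr]. *)
have R_tr : R `<=` [set x | integers L x /\
    forall b, integers L b -> I (\sum_(i < l) autX tau i (x * b))].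
  have [IO I0 ID IM] := iI.
  apply: generated_least => [|x Ix]; last first.
    split=> [|b Ob]; first exact: IOL.
    have -> : \sum_(i < l) autX tau i (x * b) = (\sum_(i < l) autX tau i b) * x.
      rewrite mulr_suml; apply: eq_bigr => i _.
      by rewrite rmorphM (tauX_K i) 1?mulrC //; case: (IO x Ix).
    by apply: (IM) => //; apply: trO.
  split.
  - by move=> x [].
  - split=> [|b Ob]; first exact: int0.
    by rewrite big1 // => i _; rewrite mul0r rmorph0.
  - move=> x x' [Ox Hx] [Ox' Hx']; split=> [|b Ob]; first exact: intD.
    under eq_bigr do rewrite mulrDl rmorphD.
    by rewrite big_split; apply: (ID); [apply: Hx|apply: Hx'].
  - move=> x x' Ox [Ox' Hx']; split=> [|b Ob]; first exact: intM.
    under eq_bigr do rewrite mulrAC mulrC.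
    by apply: Hx'; apply: intM.
have contr t : integers K t -> R t -> I t.
  move=> [Kt At] /R_tr[_ /(_ (eps alpha 0))].
  have -> : \sum_(i < l) autX tau i (t * eps alpha 0) = t.
    rewrite -[RHS]mulr1 -(sum_eps kapK l_prime z_prim alpha) mulr_sumr.
    by apply: eq_bigr => i _; rewrite rmorphM (tauX_K i Kt) (tauX_eps i 0).
  by apply; split; [apply: eps_L|apply: (Aint_eps kapK l_prime z_prim alpha1)].
have Rm : R m%:R by exact: (IR _ (pkI _ pkm)).
have mC0 : m%:R != 0 :> algC by rewrite pnatr_eq0 -lt0n.
have [y' Oy' y'E] : exists2 y', integers K y' & nual alpha ^+ l.-1 = 1 + m%:R * y'.
  pose c1 x := exists2 Y, Y \in Aint & x = 1 + m%:R * Y.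
  have c11 : c1 1 by exists 0; rewrite ?mulr0 ?addr0 // rpred0.
  have c1M x x' : c1 x -> c1 x' -> c1 (x * x').
    move=> [Y AY ->] [Y' AY' ->]; exists (Y + Y' + m%:R * (Y * Y')); last by ring.
    by rewrite rpredD ?rpredD // rpredM ?rpred_nat // rpredM.
  have [Y AY YE] : c1 (nual alpha ^+ l.-1).
    elim: l.-1 => [|i IH]; rewrite ?expr0 // exprS; apply: (c1M) => //.
    apply: (big_ind c1) => // b _; exists (nub b y); first by rewrite Aint_aut.
    by rewrite alphaE rmorphD rmorph1 rmorphM rmorph_nat.
  exists Y => //; split=> //.
  have -> : Y = (nual alpha ^+ l.-1 - 1) / m%:R by rewrite YE addrAC subrr add0r mulrC mulKf.
  have Kn : K (nual alpha) by move=> nu nuK; apply: (nual_fixed l_prime z_prim FK Falpha).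
  apply: (subM KP); last by apply: (subV KP); apply: (sub_nat KP).
  by apply: (subB KP); [apply: (subX KP)|apply: (sub1 KP)].
have rR : radical L R.
  move=> x Ox Rx.
  have RN : R (nual alpha ^+ l.-1 * x).
    have := @trace_radical K L KP LP K_L l (fun i : 'I_l => autX tau i) basisL.
    have -> : (\det (\matrix_(i, j < l) autX tau i (basisL j))) ^+ 2 = nual alpha ^+ l.-1.
      rewrite -(det_emx kapK l_prime z_prim a0); congr (\det _ ^+ 2).
      by apply/matrixP=> i j; rewrite !mxE (tauX_eps i) addnC.
    apply=> //.
    - by move=> i u Ku; apply: tauX_K.
    - by move=> i u Lu; apply: tauX_L.
    - by move=> j; split; [apply: eps_L|apply: (Aint_eps kapK l_prime z_prim alpha1)].
    - by move=> u Lu; have [_ /(_ u Lu)[a Ka ->] _] := basisLP; exists a.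
  have -> : x = nual alpha ^+ l.-1 * x - m%:R * (y' * x) by rewrite y'E; ring.
  apply: (idealB LP iR) => //; apply: (idealMr iR) => //.
  by apply: intM => //; case: Oy' => /K_L.
have -> : unramified L pk = unramified L I.
  rewrite /unramified; suff -> : ideal_generated L pk = ideal_generated L I by [].
  apply/seteqP; split; first by apply: generated_least => //; apply: subset_trans IR.
  have pkOL : pk `<=` integers L by move=> x /pkI/IOL.
  have iG := ideal_generated_ideal LP pkOL; have [GO G0 GD GM] := iG.
  apply: (generated_least iG) => x Ix.
  suff : I `<=` [set x | integers K x /\ ideal_generated L pk x] by move=> /(_ x Ix)[].
  apply: generated_least => [|u pku]; last by split; [apply: pkOK|apply: sub_generated].
  split.
  - by move=> u [].
  - by split=> //; apply: int0.
  - by move=> u v [Ou Gu] [Ov Gv]; split; [apply: intD|apply: GD].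
  - move=> u v Ou [Ov Gv]; split; first exact: intM.
    by apply: GM => //; case: Ou => /K_L.
have [Qs [uQs QsP QsE]] := radical_factorization AkapL m0 iR rR Rm.
by exists Qs.
Qed.

End Generator.
End Alpha.
End WreathExtension.

(** * Distinct extensions *)

(** Induction on [n = n' * p]: squarefreeness makes [n'] and [p] coprime, and a Bezout relation
    combines [x / p] and [x / n']. *)
Lemma Aint_squarefree_div (n : nat) (x : algC) : (0 < n)%N ->
  (forall p, prime p -> (p %| n)%N -> ~~ (p ^ 2 %| n)%N) ->
  (forall p, prime p -> (p %| n)%N -> x / p%:R \in Aint) ->
  x \in Aint -> x / n%:R \in Aint.
Proof.
have [N] := ubnP n; elim: N n => // N IH n ltN n0 sqf xp Ax.
have [n1|n1] := leqP n 1.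
  by have -> : n = 1%N; [lia | rewrite divr1].
pose p := pdiv n; have pp : prime p := pdiv_prime n1.
have /dvdnP[n' nE] : (p %| n)%N := pdiv_dvd n.
have pn : (p %| n)%N := pdiv_dvd n.
have n'0 : (0 < n')%N by move: n0; rewrite nE muln_gt0 => /andP[].
have p0 := prime_gt0 pp; have p1 := prime_gt1 pp.
have cop : coprime n' p.
  rewrite coprime_sym prime_coprime //; apply/negP => pn'.
  by have := sqf p pp pn; rewrite nE expnS expn1 dvdn_mul.
have Ax' : x / n'%:R \in Aint.
  apply: IH => //; first by rewrite nE in ltN; nia.
    move=> q qp qn'; have qn : (q %| n)%N by rewrite nE dvdn_mulr.
    by apply: contra (sqf q qp qn) => q2; rewrite nE dvdn_mulr.
  by move=> q qp qn'; apply: xp => //; rewrite nE dvdn_mulr.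
have [uv uvE] : exists uv : int * int, uv.1 * n'%:Z + uv.2 * p%:Z = 1.
  by apply/coprimezP.
have n'C0 : n'%:R != 0 :> algC by rewrite pnatr_eq0 -lt0n.
have pC0 : p%:R != 0 :> algC by rewrite pnatr_eq0 -lt0n.
have uvC : uv.1%:~R * n'%:R + uv.2%:~R * p%:R = 1 :> algC.
  by rewrite -[n'%:R]/((n'%:Z)%:~R) -[p%:R]/((p%:Z)%:~R) -!intrM -intrD uvE.
have -> : x / n%:R = uv.1%:~R * (x / p%:R) + uv.2%:~R * (x / n'%:R).
  have nR : n%:R = n'%:R * p%:R :> algC by rewrite [in LHS]nE natrM.
  rewrite -[LHS]mul1r -[X in X * _]uvC nR; field.
  by rewrite n'C0 pC0.
by rewrite rpredD // rpredM ?rpred_int // xp.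
Qed.

Lemma ndvdn_add_pred (l b : nat) : (1 < b)%N -> (b < l)%N -> ~~ (l %| b + l.-1)%N.
Proof.
move=> b1 bl; have -> : (b + l.-1 = b.-1 + l)%N by lia.
by rewrite dvdn_addl ?dvdnn // gtnNdvd //; lia.
Qed.

Lemma radical_mem_primes kap (p : nat) x : kap \in Aint -> (0 < p)%N ->
  radical (Fix kap) (mult (Fix kap) p%:R) -> integers (Fix kap) x ->
  (forall P, prime_ideals (Fix kap) P -> P p%:R -> P x) -> mult (Fix kap) p%:R x.
Proof.
move=> Akap p0 radp Ox xP; have EP := Fix_subfield kap.
have iM := ideal_mult EP (int_nat EP p).
have Mp : mult (Fix kap) p%:R p%:R by exists 1; rewrite ?mulr1 //; apply: int1.
have [Ps [uPs PsP ME]] := radical_factorization Akap p0 iM radp Mp.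
have iPs : {in Ps, forall P, ideal (Fix kap) P} by move=> P /PsP[].
rewrite ME; apply: prod_primes_mem => // P PPs; apply: xP; first exact: PsP.
by apply: (foldr_sub EP iPs PPs); rewrite -ME.
Qed.

Section Distinct.
Variables (kapK kapF kapE zeta : algC) (l : nat) (l_prime : prime l).
Hypothesis z_prim : l.-primitive_root zeta.
Hypothesis FK : forall nu, nu kapF = kapF <-> nu kapK = kapK /\ nu zeta = zeta.
Hypothesis AkapE : kapE \in Aint.
Hypothesis nkapE : forall nu, Fix kapE (nu kapE).
Hypothesis FE : Fix kapE kapF.
Local Notation F := (Fix kapF).
Local Notation E := (Fix kapE).
Local Notation O := (integers E).
Let EP : subfield E := Fix_subfield kapE.
Let FP : subfield F := Fix_subfield kapF.
Let l0 : (0 < l)%N. Proof. exact: prime_gt0. Qed.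
Let l1 : (1 < l)%N. Proof. exact: prime_gt1. Qed.

Variables (D : nat) (s : 'I_D -> {rmorphism algC -> algC}).
Hypothesis s_all : forall nu, exists i, nu kapF = s i kapF.

Local Notation Delta := (@Delta kapK zeta l).
Local Notation nub := (@nub kapK zeta l).
Local Notation gam := (@gam kapK zeta l).
Local Notation one_l := (one_l l_prime).

Variables (alpha alpha' : algC) (Oa : integers F alpha) (Oa' : integers F alpha').
Variables (z z' : int) (nrmE : nrm s alpha = z%:~R) (nrmE' : nrm s alpha' = z'%:~R).
Hypothesis z0 : z != 0.
Hypothesis sqf : forall p, prime p -> (p %| `|z|)%N ->
  radical E (mult E p%:R) /\ ~~ (p ^ 2 %| `|z|)%N.
Hypothesis sqf' : forall p, prime p -> (p %| `|z'|)%N -> ~~ (p ^ 2 %| `|z'|)%N.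
Hypothesis common_shift : forall nu, nu kapE = kapE -> exists t : nat,
  nu (gam alpha 1) = zeta ^+ t * gam alpha 1 /\ nu (gam alpha' 1) = zeta ^+ t * gam alpha' 1.

Let OE x : integers F x -> O x. Proof. exact: (intF_E FE). Qed.

(* The l-th powers of the two [gam 1] differ by an l-th power of E, so the primes of E occur in them
   with the same exponents modulo [l]; the exponent at a prime dividing [nub b alpha] is [b], and
   is 1 only at the primes dividing [alpha] itself. *)
Lemma common_prime p P : prime p -> (p %| `|z|)%N -> prime_ideals E P -> P p%:R ->
  P alpha -> P alpha'.
Proof.
move=> pp zp PP Pp Pa; have [radp zp2] := sqf pp zp.
have [iP _ _ _] := PP; have [PO P0 PD PM] := iP.
have ua := norm_uniformizer nkapE FE s_all pp Oa nrmE zp zp2 PP Pp (nu0 := idfun) Pa.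
(* Up to an l-th power this is the quotient of the two radicals; the exponent [l.-1] in place of -1
   keeps its l-th power integral, and the common shift cancels. *)
pose y := gam alpha' 1 * gam alpha 1 ^+ l.-1.
have Ey : E y.
  move=> nu /common_shift[t [e e']]; rewrite rmorphM rmorphXn e e' exprMn.
  have -> : zeta ^+ t * gam alpha' 1 * ((zeta ^+ t) ^+ l.-1 * gam alpha 1 ^+ l.-1) =
    (zeta ^+ t) ^+ l.-1.+1 * y by rewrite exprS /y; ring.
  by rewrite prednK // exprAC (prim_expr_order z_prim) expr1n mul1r.
have Onub x b : integers F x -> O (nub b x) by move=> /OE; apply: int_normal.
pose u := \prod_(b | Delta b && (b != one_l)) nub b alpha ^+ b.
have Ou : O u by apply: (int_prod EP) => b _; apply: (intX EP); apply: Onub.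
have n1F : nub one_l kapF = kapF by apply: (nub1 l_prime FK); apply: Fix_gen.
have Pu : ~ P u.
  apply: (prime_prodN EP PP) => [b|b /andP[Db b1]]; first by apply/(intX EP)/Onub.
  apply: (prime_expN PP); first exact: Onub.
  apply: (norm_conj AkapE nkapE FE s_all pp radp Oa nrmE zp zp2 PP Pp (nu0 := idfun) Pa).
  apply: contraNneq b1 => /= e; apply/eqP.
  by apply: (nub_inj z_prim FK Db (Delta1 kapK zeta l_prime)); rewrite n1F.
have ul1 : ~ P (u ^+ l.-1) by apply: (prime_expN PP).
have bE : gam alpha 1 ^+ l = alpha * u.
  rewrite (gam_l _ _ l_prime) (bigD1 one_l) /=; last exact: (Delta1 kapK zeta l_prime).
  by rewrite expr1 (nub1 l_prime FK) //; case: Oa.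
pose be' := \prod_(b | Delta b) nub b alpha' ^+ b.
have ylE : y ^+ l = alpha ^+ l.-1 * (be' * u ^+ l.-1).
  by rewrite exprMn (gam_l _ _ l_prime) -/be' exprAC bE exprMn; ring.
(* The exponent of [P] in [y ^+ l] is [l.-1] if no [nub b alpha'] lies in [P], and [b + l.-1] if
   some [nub b alpha'] does. It has to be a multiple of [l], which leaves [b = 1]. *)
have [[b [Db Pb]]|noP] := pselect (exists b, Delta b /\ P (nub b alpha')); last first.
  exfalso; have Obe : O be' by apply: (int_prod EP) => b _; apply/(intX EP)/Onub.
  have Pbe : ~ P be'.
    apply: (prime_prodN EP PP) => [b|b Db]; first by apply/(intX EP)/Onub.
    by apply: (prime_expN PP); [apply: Onub|move=> Pb; apply: noP; exists b].
  apply: (uniformizer_val AkapE pp radp PP Pp (s := 1) (w := be' * u ^+ l.-1) (e := l.-1) l_prime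
    ua Ey (int1 EP)).
  - by case: PP.
  - by apply: (intM EP) => //; apply: (intX EP).
  - by apply: (prime_mulN PP) => //; apply: (intX EP).
  - by rewrite gtnNdvd ?ltn_predL // -ltnS prednK.
  - by rewrite mulr1 ylE.
have zp' : (p %| `|z'|)%N.
  apply: (prime_int_dvd pp PP Pp); rewrite -nrmE' /nrm.
  have [i iE] := s_allF s_all (nub b).
  apply: (ideal_prod EP iP (i := i)) => [j||]; first exact/(int_normal nkapE)/OE.
    by rewrite mem_index_enum.
  by rewrite -iE //; case: Oa'.
have zp2' := sqf' pp zp'.
have ua' := norm_uniformizer nkapE FE s_all pp Oa' nrmE' zp' zp2' PP Pp Pb.
have [b1|b1] := eqVneq b one_l; first by rewrite -(nub1 l_prime FK (x := alpha')) -?b1 //;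
  case: Oa'.
exfalso.
have [s1 [w [Os1 Ow Ps1 Pw s1E]]] := uniformizer_assoc AkapE pp radp PP Pp ua ua'.
pose u' := \prod_(b' | Delta b' && (b' != b)) nub b' alpha' ^+ b'.
have Ou' : O u' by apply: (int_prod EP) => b' _; apply/(intX EP)/Onub.
have Pu' : ~ P u'.
  apply: (prime_prodN EP PP) => [b'|b' /andP[Db' bb']]; first by apply/(intX EP)/Onub.
  apply: (prime_expN PP); first exact: Onub.
  apply: (norm_conj AkapE nkapE FE s_all pp radp Oa' nrmE' zp' zp2' PP Pp Pb).
  apply: contraNneq bb' => e; apply/eqP.
  exact: (nub_inj z_prim FK Db' Db).
have be'E : be' = nub b alpha' ^+ b * u' by rewrite /be' (bigD1 b).
apply: (uniformizer_val AkapE pp radp PP Pp (s := s1 ^+ b) (w := w ^+ b * (u' * u ^+ l.-1)) (e :=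
  (b + l.-1)%N) l_prime ua Ey).
- exact: (intX EP).
- exact: (prime_expN PP).
- by apply: (intM EP); [apply: (intX EP)|apply: (intM EP) => //; apply: (intX EP)].
- apply: (prime_mulN PP); [exact: (intX EP)| |exact: (prime_expN PP)|].
    by apply: (intM EP) => //; apply: (intX EP).
  by apply: (prime_mulN PP) => //; apply: (intX EP).
- have := Delta_coprime l_prime z_prim Db; rewrite (coprime_ord l_prime) => lb.
  have b0 : (0 < b)%N by rewrite lt0n; apply: contraNneq lb => ->; rewrite dvdn0.
  have b2 : (b != 1 :> nat)%N by rewrite -val_eqE in b1.
  by apply: ndvdn_add_pred => //; rewrite ltn_neqAle eq_sym b2 b0.
- rewrite ylE be'E /=.
  have -> : alpha ^+ l.-1 * (nub b alpha' ^+ b * u' * u ^+ l.-1) * s1 ^+ b =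
    alpha ^+ l.-1 * (s1 * nub b alpha') ^+ b * (u' * u ^+ l.-1) by rewrite exprMn; ring.
  by rewrite s1E exprMn exprD /=; ring.
Qed.

(** The quotient is [alpha' * as_ / z], with [as_] the cofactor of [alpha] in its norm [z]. A prime
    of E above a prime divisor of [z] contains [as_] or [alpha], and in the second case [alpha'] by
    [common_prime]. As [z] is squarefree, division by its prime factors one at a time suffices. *)
Lemma common_div : alpha' / alpha \in Aint.
Proof.
have [i0 i0P] := s_id s_all.
have [Fa Aa] := Oa; have [Fa' Aa'] := Oa'.
have a0 : alpha != 0.
  apply: contraNneq z0 => a0; rewrite -(intr_eq0 algC) -nrmE /nrm (bigD1 i0) //=.
  by rewrite a0 rmorph0 mul0r.
have zC0 : z%:~R != 0 :> algC by rewrite intr_eq0.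
pose as_ := nrm s alpha / alpha.
have Oas : integers F as_.
  split.
    apply: (subM FP); last exact: (subV FP).
    by rewrite nrmE; apply: (sub_int FP).
  rewrite /as_ /nrm (bigD1 i0) //= i0P // mulrC mulKf //.
  by apply: rpred_prod => i _; rewrite Aint_aut.
have Ox : integers F (alpha' * as_) by apply: intM.
have e : alpha' / alpha = alpha' * as_ / z%:~R.
  by rewrite /as_ nrmE; field; rewrite a0 zC0.
have dvd p : prime p -> (p %| `|z|)%N -> alpha' * as_ / p%:R \in Aint.
  move=> pp zp; have [radp _] := sqf pp zp.
  have pC0 : p%:R != 0 :> algC by rewrite pnatr_eq0 -lt0n prime_gt0.
  have [|v [_ Av] <-] := radical_mem_primes AkapE (prime_gt0 pp) radp (OE Ox); last first.
    by rewrite mulrC mulKf.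
  move=> P PP Pp; have [iP _ _ _] := PP; have [PO P0 PD PM] := iP.
  have : P (alpha * as_).
    rewrite /as_ mulrC divfK // nrmE.
    have /dvdzP[q ->] : (p %| z)%Z by rewrite dvdzE.
    by rewrite rmorphM; apply: (PM) => //; apply: int_int.
  case/(prime_mul PP); [exact: OE|exact: OE| |]; last by move=> Pas; apply: (PM) => //; apply: OE.
  by move=> /(common_prime pp zp PP Pp) Pa'; apply: (idealMr iP) => //; apply: OE.
have nz : (0 < `|z|)%N by rewrite absz_gt0.
have := Aint_squarefree_div nz (fun p pp pz => (sqf pp pz).2) dvd Ox.2.
rewrite e; have [z_ge0|z_lt0] := leP 0 z.
  by rewrite -[X in _ / X]/((`|z|%N : int)%:~R) gez0_abs.
by rewrite -[X in _ / X]/((`|z|%N : int)%:~R) ltz0_abs // rmorphN invrN mulrN rpredN.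
Qed.

End Distinct.

(** * The squarefree sieve *)

Lemma card_exists_le (X Y : finType) (B : Y -> pred X) :
  (#|[pred x | [exists i, B i x]]| <= \sum_i #|B i|)%N.
Proof.
rewrite -sum1_card big_mkcond /=.
rewrite [leqRHS](eq_bigr (fun i => \sum_x (B i x : nat)))%N => [|i _]; last first.
  by rewrite -sum1_card big_mkcond; apply: eq_bigr => x _; rewrite unfold_in; case: (B i x).
rewrite exchange_big; apply: leq_sum => x _; case: ifP => // /existsP[i Bix].
by rewrite (bigD1 i) //= Bix.
Qed.

(** The inverse of [p ^ 2] is at most [1 / (p - 1) - 1 / p], and the sum telescopes; the sharper
    bound with [- 1 / M] carries the induction. *)
Lemma sum_inv_sq (Z M : nat) : (0 < Z)%N ->
  \sum_(p < M.+1 | (Z < p)%N) ((p%:R : rat) ^+ 2)^-1 <= Z%:R^-1.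
Proof.
move=> Z0; suff H : \sum_(p < M.+1 | (Z < p)%N) ((p%:R : rat) ^+ 2)^-1 <=
    if (Z <= M)%N then Z%:R^-1 - M%:R^-1 else 0.
  apply: le_trans H _; case: ifP => _; last by rewrite invr_ge0 ler0n.
  by rewrite gerBl invr_ge0 ler0n.
elim: M => [|M IH].
  by rewrite big_mkcond big_ord_recl big_ord0 /= addr0 leqNgt Z0.
rewrite big_mkcond big_ord_recr -big_mkcond /=.
have [ltZ|leM] := ltnP Z M.+1; last first.
  rewrite addr0 (le_trans IH) //; case: ifP => [h|_].
    by have := leq_trans leM h; rewrite ltnn.
  case: ifP => // h; have -> : Z = M.+1 by apply/eqP; rewrite eqn_leq h leM.
  by rewrite subrr lexx.
have leZM : (Z <= M)%N by [].
have M0 : 0 < M%:R :> rat by rewrite ltr0n; lia.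
rewrite leZM in IH; rewrite (leq_trans leZM (leqnSn _)).
have -> : Z%:R^-1 - M.+1%:R^-1 = Z%:R^-1 - M%:R^-1 + (M%:R^-1 - M.+1%:R^-1) :> rat by ring.
apply: lerD => //; rewrite -natr1.
have M1 : 0 < M%:R + 1 :> rat by rewrite addr_gt0.
have -> : M%:R^-1 - (M%:R + 1)^-1 = (M%:R * (M%:R + 1))^-1 :> rat.
  by field; rewrite !gt_eqF.
by rewrite lef_pV2 ?posrE ?mulr_gt0 ?exprn_gt0 // expr2 ler_pM2r // lerDl ler01.
Qed.

Section Cells.
Variables (D T s : nat) (s0 : (0 < s)%N).

(* Each cell of side [s] contains at most one point of [A]. *)
Lemma card_cells (A : {pred {ffun 'I_D -> 'I_T}}) :
  (forall x y, x \in A -> y \in A ->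
    (forall j, `|(x j : nat)%:Z - (y j : nat)%:Z| < s%:Z :> int) -> x = y) ->
  (#|A| <= (T %/ s).+1 ^ D)%N.
Proof.
move=> inj; pose f (x : {ffun 'I_D -> 'I_T}) : {ffun 'I_D -> 'I_(T %/ s).+1} :=
  [ffun j => inord (x j %/ s)].
have f_inj : {in A &, injective f}.
  move=> x y Ax Ay e; apply: inj => // j.
  have lt u : (u < T)%N -> (u %/ s < (T %/ s).+1)%N.
    by move=> uT; rewrite ltnS leq_div2r // ltnW.
  have := congr1 (fun h : {ffun 'I_D -> 'I_(T %/ s).+1} => val (h j)) e.
  rewrite /= !ffunE !inordK ?lt // => e'.
  have h1 := divn_eq (x j) s; have h2 := divn_eq (y j) s.
  have h3 : (x j %% s < s)%N by rewrite ltn_pmod.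
  have h4 : (y j %% s < s)%N by rewrite ltn_pmod.
  rewrite e' in h1; move: h1 h2 h3 h4.
  generalize (y j %/ s * s)%N (x j %% s)%N (y j %% s)%N => q r1 r2 -> -> r1s r2s.
  by clear -r1s r2s; lia.
have := max_card (f @: A); rewrite card_in_imset // card_ffun !card_ord.
exact.
Qed.

End Cells.

(** [s] is maximal with [(c * s) ^ D < p ^ 2]: norms of differences within a cell stay below
    [p ^ 2], while the volume of a cell is [p ^ 2] up to a constant. When [s] exceeds [T] there is a
    single cell, whence the summand [p ^ 2]. *)
Lemma cell_size (c D p : nat) : (0 < c)%N -> (0 < D)%N -> (c ^ D < p ^ 2)%N ->
  exists s, [/\ (0 < s)%N, ((c * s) ^ D < p ^ 2)%N &
    forall T, ((T %/ s).+1 ^ D * p ^ 2 <= (4 * c * T) ^ D + p ^ 2)%N].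
Proof.
move=> c0 D0 cp.
have ub s : ((c * s) ^ D < p ^ 2)%N -> (s <= p ^ 2)%N.
  move=> h; apply: leq_trans (ltnW h).
  case: s {h} => // s; apply: leq_trans (leq_pmull _ c0) _.
  by rewrite -[leqLHS]expn1 leq_pexp2l ?muln_gt0 ?c0.
have ex : exists s, ((c * s) ^ D < p ^ 2)%N by exists 1; rewrite muln1.
have [s sP smax] := ex_maxnP ex ub.
have s0 : (0 < s)%N by apply: smax; rewrite muln1.
exists s; split=> // T.
have sS : (p ^ 2 <= (c * s.+1) ^ D)%N.
  by rewrite leqNgt; apply/negP => /smax; rewrite ltnn.
have [leT|ltT] := leqP s T; last by rewrite divn_small // exp1n mul1n leq_addl.
apply: leq_trans (leq_addr _ _); apply: (leq_trans (leq_mul (leqnn _) sS)).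
rewrite -expnMn leq_exp2r //.
have := leq_trunc_div T s; move: (T %/ s)%N => q qs.
have h1 : (q.+1 * s.+1 <= 4 * T)%N by nia.
by rewrite mulnCA [(4 * c)%N]mulnC -[leqRHS]mulnA leq_mul2l h1 orbT.
Qed.

Section Sieve.
Variables (kapF kapE : algC) (AkapF : kapF \in Aint) (AkapE : kapE \in Aint).
Hypothesis nkapE : forall nu, Fix kapE (nu kapE).
Hypothesis FE : Fix kapE kapF.
Variables (D : nat) (s : 'I_D -> {rmorphism algC -> algC}).
Hypothesis s_inj : injective (fun i => s i kapF).
Hypothesis s_all : forall nu, exists i, nu kapF = s i kapF.
Local Notation F := (Fix kapF).
Local Notation E := (Fix kapE).
Local Notation O := (integers E).
Let EP : subfield E := Fix_subfield kapE.
Let FP : subfield F := Fix_subfield kapF.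
Let OE x : integers F x -> O x. Proof. exact: (intF_E FE). Qed.

Lemma prime_exists p : prime p -> exists2 P, prime_ideals E P & P p%:R.
Proof.
move=> pp; have p0 := prime_gt0 pp.
have pC0 : p%:R != 0 :> algC by rewrite pnatr_eq0 -lt0n.
have iM := ideal_mult EP (int_nat EP p).
have Mp : mult E p%:R p%:R by exists 1; rewrite ?mulr1 //; apply: int1.
have [|P PP MP] := maximal_exists AkapE p0 iM Mp; last by exists P => //; apply: MP.
move=> [y [_ Ay] yE]; have /negP[] := Aint_inv_prime pp.
by have -> : p%:R^-1 = y by apply: (mulfI pC0); rewrite divff // yE.
Qed.

Section Class.
Variables (p m : nat) (p_prime : prime p) (pm : ~~ (p %| m)%N).
Variables (P : set algC) (PP : prime_ideals E P) (Pp : P p%:R).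
Variables (t : algC) (Ot : O t) (Pt : ~ P t).
Hypothesis tP : forall x, P x -> exists2 y, O y & t * x = p%:R * y.

Let pC0 : p%:R != 0 :> algC.
Proof. by rewrite pnatr_eq0 -lt0n prime_gt0. Qed.
Let iP : ideal E P. Proof. by case: PP. Qed.

(* If [p^2] divides the norm of [x], then either one conjugate of [x] is divisible by [P^2], which is
   expressed by means of [t], or two conjugates are divisible by [P]. *)
Definition cls (ij : 'I_D * 'I_D) (x : algC) : Prop :=
  if ij.1 == ij.2 then exists v, P v /\ t * s ij.1 x = p%:R * v
  else P (s ij.1 x) /\ P (s ij.2 x).

Let Os i x : integers F x -> O (s i x).
Proof. by move=> /OE; apply: int_normal. Qed.

Lemma prime_prod_ex (I : finType) (f : I -> algC) :
  (forall i, O (f i)) -> P (\prod_i f i) -> exists i, P (f i).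
Proof.
move=> Of Pf; apply: contrapT => /forallNP H.
by apply: (prime_prodN EP PP (p := xpredT) Of (fun i _ => H i) Pf).
Qed.

Lemma cls_cover x (z : int) : integers F x -> nrm s x = z%:~R -> (p ^ 2 %| `|z|)%N ->
  exists ij, cls ij x.
Proof.
move=> Ox nE pz; have /dvdzP[q zE] : ((p ^ 2)%N %| z)%Z by rewrite dvdzE.
have zC : z%:~R = p%:R * (p%:R * q%:~R) :> algC.
  have pE : ((p ^ 2)%N : int)%:~R = p%:R ^+ 2 :> algC by rewrite -natrX.
  by rewrite zE intrM pE; ring.
have Oq : O q%:~R by apply: int_int.
have : P (\prod_i s i x).
  have -> : \prod_i s i x = z%:~R by [].
  rewrite zC; apply: (idealMr iP) => //; apply: intM => //; exact: int_nat.
move=> /(prime_prod_ex (fun i => Os i Ox))[i Pi].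
have [[j [ji Pj]]|noj] := pselect (exists j, j != i /\ P (s j x)).
  by exists (i, j); rewrite /cls /= eq_sym (negPf ji).
exists (i, i); rewrite /cls /= eqxx.
have [w Ow wE] := tP Pi; exists w; split=> //.
pose u := \prod_(j | j != i) s j x.
have Ou : O u by apply: (int_prod EP) => j _; apply: Os.
have Pu : ~ P u.
  apply: (prime_prodN EP PP) => [j|j ji Pj]; first exact: Os.
  by apply: noj; exists j.
have e : w * u = t * (p%:R * q%:~R).
  apply: (mulfI pC0); rewrite mulrA -wE -mulrA.
  have -> : s i x * u = z%:~R by rewrite -nE /nrm [RHS](bigD1 i).
  by rewrite zC; ring.
have : P (w * u).
  rewrite e; case: iP => _ _ _ PM; apply: (PM) => //; apply: (idealMr iP) => //.
by case/(prime_mul PP).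
Qed.

(** Each class is stable under differences and [m] is a unit at [P], so [eta] inherits the condition
    defining the class; this puts two factors [p] in its norm. *)
Lemma cls_diff ij x y (eta : algC) (q : int) : integers F x -> integers F y ->
  integers F eta -> x - y = m%:R * eta -> nrm s eta = q%:~R ->
  cls ij x -> cls ij y -> (p ^ 2 %| `|q|)%N.
Proof.
move=> Ox Oy Oeta xyE nE cx cy.
have Pm : ~ P m%:R.
  by move=> Pm; move/negP: pm; apply; apply: (prime_int_dvd p_prime PP Pp (z := m)).
have OmC : O m%:R by apply: int_nat.
have sxy i : m%:R * s i eta = s i x - s i y by rewrite -rmorphB xyE rmorphM rmorph_nat.
have PsE i : P (s i x - s i y) -> P (s i eta).
  by rewrite -sxy => /(prime_mul PP)[] //; exact: Os.
have dvdP (q' : int) : P q'%:~R -> exists q'', q' = q'' * p%:Z.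
  by move=> Pq; apply/dvdzP; rewrite dvdzE; apply: (prime_int_dvd p_prime PP Pp).
have dvd2 : (exists2 r, q = r * p%:Z & P r%:~R) -> (p ^ 2 %| `|q|)%N.
  move=> [r -> /dvdP[r' ->]]; rewrite !abszM expnS expn1 -mulnA.
  exact: dvdn_mull.
have Opr (A : pred 'I_D) : O (\prod_(k | A k) s k eta).
  by apply: (int_prod EP) => k _; apply: Os.
case: ij cx cy => i j; rewrite /cls /=; case: eqVneq => [_|ij].
  move=> [v [Pv vE]] [v' [Pv' vE']].
  have Pvv : P (v - v') by apply: (idealB EP iP).
  have [PO _ _ _] := iP.
  have e : m%:R * (t * s i eta) = p%:R * (v - v').
    by rewrite mulrCA sxy mulrBr vE vE' mulrBr.
  have Pi : P (s i eta).
    have : P (m%:R * (t * s i eta)).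
      by rewrite e; apply: (idealMr iP) => //; apply: PO.
    case/(prime_mul PP) => //; first by apply: intM => //; apply: Os.
    by case/(prime_mul PP) => //; apply: Os.
  have [w Ow wE] := tP Pi.
  have Pw : P w.
    have : P (m%:R * w).
      have -> // : m%:R * w = v - v'.
      by apply: (mulfI pC0); rewrite -e wE mulrCA.
    by case/(prime_mul PP).
  have qE : q%:~R = s i eta * \prod_(k | k != i) s k eta by rewrite -nE /nrm (bigD1 i).
  have [r rE] : exists r, q = r * p%:Z by apply: dvdP; rewrite qE; apply: (idealMr iP).
  apply: dvd2; exists r => //.
  have : P (t * r%:~R).
    have -> : t * r%:~R = w * \prod_(k | k != i) s k eta.
      apply: (mulfI pC0); rewrite [RHS]mulrA -wE -[RHS]mulrA -qE rE intrM.
      by rewrite -[(p : int)%:~R]/(p%:R); ring.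
    exact: (idealMr iP).
  by case/(prime_mul PP) => //; apply: int_int.
move=> [Pix Pjx] [Piy Pjy].
have Pi : P (s i eta) by apply/PsE/(idealB EP iP).
have Pj : P (s j eta) by apply/PsE/(idealB EP iP).
have [u Ou uE] := tP Pi; have [v Ov vE] := tP Pj.
pose c := \prod_(k | (k != i) && (k != j)) s k eta.
have qE : q%:~R = s i eta * (s j eta * c).
  by rewrite -nE /nrm (bigD1 i) //= (bigD1 j) 1?eq_sym.
have Oc : O c by apply: Opr.
have [r rE] : exists r, q = r * p%:Z.
  by apply: dvdP; rewrite qE; apply: (idealMr iP) => //; apply: intM => //; apply: Os.
apply: dvd2; exists r => //.
have : P (t ^+ 2 * r%:~R).
  have -> : t ^+ 2 * r%:~R = p%:R * (u * v * c).
    apply: (mulfI pC0).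
    have -> : p%:R * (t ^+ 2 * r%:~R) = t ^+ 2 * q%:~R by rewrite rE intrM -[(p :
      int)%:~R]/(p%:R); ring.
    have -> : p%:R * (p%:R * (u * v * c)) = (p%:R * u) * (p%:R * v) * c by ring.
    by rewrite -uE -vE qE; ring.
  by apply: (idealMr iP) => //; do !apply: intM => //.
case/(prime_mul PP) => //; [exact: intX|exact: int_int|].
by move=> /(prime_X EP PP Ot).
Qed.

End Class.

Lemma nrm_cong_ndvd (m p : nat) y (z : int) : y \in Aint -> nrm s (1 + m%:R * y) = z%:~R ->
  prime p -> (p %| `|z|)%N -> ~~ (p %| m)%N.
Proof.
move=> Ay; have [X AX ->] := nrm_cong s m Ay => e pp pz.
apply/negP => /dvdnP[m' mE]; have /negP := Aint_inv_prime pp; apply.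
have /dvdzP[q zE] : (p %| z)%Z by rewrite dvdzE.
have pC0 : p%:R != 0 :> algC by rewrite pnatr_eq0 -lt0n prime_gt0.
have -> : p%:R^-1 = q%:~R - m'%:R * X.
  apply: (mulfI pC0); rewrite divff // mulrBr.
  have -> : p%:R * q%:~R = 1 + m%:R * X :> algC.
    by rewrite e zE intrM -[(p : int)%:~R]/(p%:R) mulrC.
  by rewrite mE natrM; ring.
by rewrite rpredB ?rpredM ?rpred_int ?rpred_nat.
Qed.

Definition lattice_point (T : nat) (x : {ffun 'I_D -> 'I_T}) : algC :=
  \sum_j (x j)%:R * kapF ^+ j.

(* The shift by [C * T] makes all the conjugates comparable with [m * C * T]. *)
Definition alphax (m C T : nat) (x : {ffun 'I_D -> 'I_T}) : algC :=
  1 + m%:R * ((C * T)%:R + lattice_point x).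

Lemma int_comb (a : 'I_D -> int) : integers F (\sum_j (a j)%:~R * kapF ^+ j).
Proof.
apply: (int_sum FP) => j _; apply: (intM FP); first exact: (int_int FP).
by apply: (intX FP); split=> //; apply: Fix_gen.
Qed.

Lemma int_lattice T x : integers F (@lattice_point T x).
Proof. exact: (int_comb (fun j => (x j : int))). Qed.

Lemma int_alphax m C T x : integers F (@alphax m C T x).
Proof.
apply: (intD FP); first exact: (int1 FP).
apply: (intM FP); first exact: (int_nat FP).
by apply: (intD FP); [apply: (int_nat FP)|apply: int_lattice].
Qed.

Lemma int_comb_eq0 (a : 'I_D -> int) : \sum_j (a j)%:~R * kapF ^+ j = 0 :> algC ->
  forall j, a j = 0.
Proof.
move=> e j; have [C CP] := coord_bound s_inj.
have := CP (fun j => (a j)%:~R) 0 _ (lexx _) _ j.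
rewrite mulr0 normr_le0 intr_eq0 => H; apply/eqP/H => [j'|i].
  by rewrite rpred_int.
by rewrite e rmorph0 normr0.
Qed.

Lemma alphaxB m C T (x y : {ffun 'I_D -> 'I_T}) : alphax m C x - alphax m C y =
  m%:R * \sum_j ((x j : nat)%:Z - (y j : nat)%:Z)%:~R * kapF ^+ j.
Proof.
rewrite /alphax opprD addrACA subrr add0r -mulrBr; congr (_ * _).
rewrite opprD addrACA subrr add0r /lattice_point -sumrB; apply: eq_bigr => j _.
by rewrite -mulrBl rmorphB.
Qed.

(** Two points in the same class and the same cell differ by [m * eta], where [p ^ 2] divides the
    norm of [eta] and also exceeds it; so [eta] is 0. It remains to count cells, for each of the
    [D ^ 2] classes. *)
Lemma bad_count : exists2 c : nat, (0 < c)%N & forall (m p C T : nat)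
  (A : {pred {ffun 'I_D -> 'I_T}}), prime p -> ~~ (p %| m)%N ->
  radical E (mult E p%:R) -> (c ^ D < p ^ 2)%N ->
  (forall x, x \in A -> exists2 z : int, nrm s (alphax m C x) = z%:~R & (p ^ 2 %| `|z|)%N) ->
  (#|A| * p ^ 2 <= D ^ 2 * ((4 * c * T) ^ D + p ^ 2))%N.
Proof.
have [C2 C2P] := pow_bound s_all.
exists C2.+1 => // m p C T A pp pm radp cp AP.
have [r [r0 rP rT]] := cell_size (ltn0Sn C2) (D_gt0 s_all) cp.
have [P PP Pp] := prime_exists pp.
have [t [Ot Pt tP]] := multiplier AkapE pp radp PP Pp.
have m0 : m%:R != 0 :> algC by rewrite pnatr_eq0; apply: contraNneq pm => ->.
pose A_ (ij : 'I_D * 'I_D) : pred {ffun 'I_D -> 'I_T} :=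
  [pred x | (x \in A) && `[< cls p P t ij (alphax m C x) >]].
have cardA ij : (#|A_ ij| <= (T %/ r).+1 ^ D)%N.
  apply: card_cells => // x y; rewrite !inE => /andP[Ax /asboolP cx] /andP[Ay /asboolP cy] xy.
  pose a j : int := (x j : nat)%:Z - (y j : nat)%:Z.
  pose eta : algC := \sum_j (a j)%:~R * kapF ^+ j.
  have Oeta : integers F eta by apply: int_comb.
  have /intrP[q qE] := nrm_int s_inj s_all Oeta.
  have qp := cls_diff pp pm PP Pp Ot Pt tP (int_alphax m C x) (int_alphax m C y) Oeta (alphaxB m C
    x y) qE cx cy.
  have q_le : (`|q| <= (C2.+1 * r) ^ D)%N.
    have : `|nrm s eta| <= (C2%:R * r%:R) ^+ D.
      apply: nrm_le => i; apply: C2P => [j||j]; rewrite ?rpred_int ?ler0n //.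
      by rewrite -intr_norm -[r%:R]/((r : int)%:~R) ler_int ltW // xy.
    rewrite qE -intr_norm -natrM -natrX -[X in _ <= X]/((((C2 * r) ^ D)%N : int)%:~R) ler_int => h.
    rewrite -lez_nat abszE (le_trans h) // lez_nat.
    by case: (D) => // D'; rewrite leq_exp2r // leq_mul2r leqnSn orbT.
  have q0 : q = 0.
    apply/eqP; rewrite -absz_eq0 -leqn0 leqNgt; apply/negP => q0.
    by have := leq_trans (dvdn_leq q0 qp) q_le; rewrite leqNgt rP.
  have eta0 : eta = 0 by apply: (@nrm_eq0 _ s); rewrite qE q0.
  apply/ffunP => j; apply: val_inj; have := int_comb_eq0 eta0 j.
  by rewrite /a => /eqP; rewrite subr_eq0 eqz_nat => /eqP.
have cover : (#|A| <= D ^ 2 * (T %/ r).+1 ^ D)%N.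
  apply: (@leq_trans #|[pred x | [exists ij, A_ ij x]]|).
    apply/subset_leq_card/fintype.subsetP => x Ax; have [z zE zp] := AP x Ax.
    have [ij ijP] := cls_cover pp PP Pp Ot tP (int_alphax m C x) zE zp.
    by rewrite inE; apply/existsP; exists ij; apply/andP; split=> //; apply/asboolP.
  apply: (leq_trans (card_exists_le _)).
  apply: (@leq_trans (\sum_(ij : 'I_D * 'I_D) (T %/ r).+1 ^ D)); first exact: leq_sum.
  by rewrite sum_nat_const card_prod card_ord.
apply: (leq_trans (leq_mul cover (leqnn _))).
by rewrite -mulnA leq_mul2l rT orbT.
Qed.

Lemma alphax_bound : exists2 C : nat, (0 < C)%N & forall (m T : nat) x nu, (0 < T)%N ->
  `|nu (@alphax m C T x) - (m * C * T)%:R| * 8 <= (m * C * T)%:R + 8 :> algC.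
Proof.
have [C2 C2P] := pow_bound s_all.
(* The factor 8 bounds the conjugates of the lattice point by an eighth of the centre [C * T]; the 8
   on the right-hand side accounts for the summand 1 of [alphax]. *)
exists (8 * C2.+1)%N => // m T x nu T0.
have -> : nu (alphax m (8 * C2.+1) x) - (m * (8 * C2.+1) * T)%:R = 1 + m%:R * nu (lattice_point x).
  by rewrite /alphax rmorphD rmorph1 rmorphM rmorph_nat rmorphD rmorph_nat !natrM; ring.
have h : `|nu (lattice_point x)| <= C2%:R * T%:R.
  apply: C2P => [j||j]; rewrite ?ler0n ?rpred_nat //.
  by rewrite normr_nat ler_nat ltnW.
apply: (@le_trans _ _ ((1 + m%:R * (C2%:R * T%:R)) * 8)).
  rewrite ler_wpM2r ?ler0n // (le_trans (ler_normD _ _)) // normr1 lerD2l normrM normr_nat.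
  by rewrite ler_wpM2l ?ler0n.
by rewrite -!natrM -[1]/(1%:R) -natrD -!natrM -natrD ler_nat; clear; nia.
Qed.

End Sieve.

Lemma sqrt_bound (N : nat) : exists M : nat, (M ^ 2 <= N)%N /\ forall p, (p ^ 2 <= N -> p <= M)%N.
Proof.
have ex : exists p, (p ^ 2 <= N)%N by exists 0.
have ub p : (p ^ 2 <= N)%N -> (p <= N)%N.
  by apply: leq_trans; rewrite expnS expn1; case: p => // p; rewrite leq_pmull.
have [M MP Mmax] := ex_maxnP ex ub.
by exists M.
Qed.

Section ManyGood.
Variables (kapF kapE : algC) (AkapF : kapF \in Aint) (AkapE : kapE \in Aint).
Hypothesis nkapE : forall nu, Fix kapE (nu kapE).
Hypothesis FE : Fix kapE kapF.
Variables (D : nat) (s : 'I_D -> {rmorphism algC -> algC}).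
Hypothesis s_inj : injective (fun i => s i kapF).
Hypothesis s_all : forall nu, exists i, nu kapF = s i kapF.
Local Notation F := (Fix kapF).
Local Notation E := (Fix kapE).
Variables (m0 : nat) (m0_gt0 : (0 < m0)%N).
Hypothesis rad_m0 : forall p, prime p -> ~~ (p %| m0)%N -> radical E (mult E p%:R).

(** The condition [1 < |z|] excludes units: it provides the prime at which [independence] is
    tested. *)
Definition good (m : nat) (alpha : algC) := [/\ integers F alpha,
  exists2 y, integers F y & alpha = 1 + m%:R * y &
  exists z : int, [/\ nrm s alpha = z%:~R, (1 < `|z|)%N &
    forall p, prime p -> (p %| `|z|)%N ->
      radical E (mult E p%:R) /\ ~~ (p ^ 2 %| `|z|)%N]].

(* The modulus [m] is divisible by all primes up to [Z], and so the norms to be discarded are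
   divisible by the square of some prime beyond [Z]: by [sum_inv_sq] these are few. *)
Lemma many_good : exists m C T0 : nat, [/\ (0 < m)%N, (m0 %| m)%N, (0 < C)%N &
  forall T, (T0 <= T)%N -> exists A : seq algC,
    [/\ uniq A, (T ^ D <= 2 * size A)%N, (64 <= m * C * T)%N &
      {in A, forall alpha, good m alpha /\
        forall nu, `|nu alpha - (m * C * T)%:R| * 4 <= (m * C * T)%:R :> algC}]].
Proof.
have [c c0 cP] := bad_count AkapF AkapE nkapE FE s_inj s_all.
have [C C0 CP] := alphax_bound s_all.
have D0 := D_gt0 s_all.
(* The first term makes the main part of the sieve bound at most a quarter of [T ^ D], see [h4]; the
   second ensures the hypothesis [c ^ D < p ^ 2] of [bad_count]; the third makes [Z] positive. *)
pose Z := (4 * D ^ 2 * (4 * c) ^ D + c ^ D + 1)%N.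
have Z0 : (0 < Z)%N by rewrite /Z addn1.
pose m := (m0 * Z`!)%N.
have m_gt0 : (0 < m)%N by rewrite muln_gt0 m0_gt0 fact_gt0.
have pZ p : prime p -> ~~ (p %| m)%N -> (Z < p)%N.
  move=> pp; apply: contraNT; rewrite -leqNgt => leZ.
  by rewrite dvdn_mull // dvdn_fact // leZ prime_gt0.
have pm0 p : ~~ (p %| m)%N -> ~~ (p %| m0)%N.
  by apply: contra => pm0; rewrite dvdn_mulr.
(* A prime whose square divides a norm is at most [M], about the square root of
   [(2 * m * C * T) ^ D]. The first term makes the remaining part [D ^ 2 * M.+1] of the sieve bound
   at most another quarter of [T ^ D], see [h5]; the second gives [64 <= m * C * T]. *)
pose T0 := (64 * D ^ 4 * (2 * m * C) ^ D + 64)%N.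
exists m, C, T0; split=> //; first exact: dvdn_mulr.
move=> T TT0; have T_gt0 : (0 < T)%N by apply: leq_trans TT0; rewrite /T0 addn_gt0 orbT.
have TD : (T <= T ^ D)%N by rewrite -{1}[T]expn1 leq_pexp2l.
have Y64 : (64 <= m * C * T)%N.
  apply: (@leq_trans T); first by apply: leq_trans TT0; apply: leq_addl.
  by rewrite leq_pmull // muln_gt0 m_gt0.
pose X : finType := {ffun 'I_D -> 'I_T}.
pose al (x : X) := alphax kapF m C x.
have zP (x : X) : {z : int | nrm s (al x) = z%:~R}.
  apply: cid; have /intrP[z zE] := nrm_int s_inj s_all (int_alphax AkapF m C x).
  by exists z.
pose z x := sval (zP x).
have zE x : nrm s (al x) = (z x)%:~R by rewrite /z; case: (zP x).
have Y0 : 0 < (m * C * T)%:R :> algC by rewrite ltr0n (leq_trans _ Y64).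
have alB x nu : `|nu (al x) - (m * C * T)%:R| * 4 <= (m * C * T)%:R :> algC.
  have := CP m T x nu T_gt0; rewrite -/(al x) => h.
  have h8 : (8 : algC) <= (m * C * T)%:R by rewrite ler_nat (leq_trans _ Y64).
  have e8 : 4 * 2 = 8 :> algC by rewrite -natrM.
  rewrite -(@ler_pM2r _ 2) // -mulrA e8.
  have -> : (m * C * T)%:R * 2 = (m * C * T)%:R + (m * C * T)%:R :> algC by ring.
  by rewrite (le_trans h) // lerD2l.
have alub x nu : `|nu (al x)| <= (2 * (m * C * T))%:R.
  rewrite -[nu _](subrK (m * C * T)%:R) (le_trans (ler_normD _ _)) //.
  have -> : (2 * (m * C * T))%:R = (m * C * T)%:R + (m * C * T)%:R :> algC.
    by rewrite mul2n -addnn natrD.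
  rewrite normr_nat lerD2r.
  apply: le_trans (alB x nu); rewrite -[leLHS]mulr1 ler_wpM2l ?normr_ge0 //.
  by rewrite -[1]/(1%:R) ler_nat.
have allb x nu : 2 <= `|nu (al x)|.
  have h := alB x nu; have h64 : (64 : algC) <= (m * C * T)%:R by rewrite ler_nat.
  have := lerB_dist (m * C * T)%:R ((m * C * T)%:R - nu (al x)).
  rewrite subKr normr_nat distrC => h2.
  apply: le_trans h2; move: h h64; set a := `|_|; set b := (m * C * T)%:R => h h64.
  rewrite lerBrDr -(@ler_pM2r _ 4) // mulrDl.
  have -> : b * 4 = b * 3 + b by ring.
  apply: lerD => //; apply: (@le_trans _ _ (64 * 3)); first by rewrite -!natrM ler_nat.
  by rewrite ler_wpM2r ?ler0n.
have z_ub x : (`|z x| <= (2 * (m * C * T)) ^ D)%N.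
  have : `|nrm s (al x)| <= (2 * (m * C * T))%:R ^+ D by apply: nrm_le => i; apply: alub.
  rewrite zE -intr_norm -natrX -[X in _ <= X]/((((2 * (m * C * T)) ^ D)%N : int)%:~R) ler_int.
  by rewrite -lez_nat abszE.
have z_lb x : (1 < `|z x|)%N.
  have : 2 ^+ D <= `|nrm s (al x)|.
    rewrite /nrm normr_prod -[D in 2 ^+ D]card_ord -prodr_const.
    by apply: ler_prod => i _; rewrite ler0n allb.
  rewrite zE -intr_norm -natrX -[X in X <= _]/(((2 ^ D)%N : int)%:~R) ler_int => h.
  rewrite -ltz_nat abszE; apply: lt_le_trans h; rewrite ltz_nat.
  by rewrite -{1}[1%N](expn0 2) ltn_exp2l.
have [M [M2 Mmax]] := sqrt_bound ((2 * (m * C * T)) ^ D).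
have ndvd x p : prime p -> (p %| `|z x|)%N -> ~~ (p %| m)%N.
  have [y Ay yE] : exists2 y, y \in Aint & al x = 1 + m%:R * y.
    exists ((C * T)%:R + lattice_point kapF x) => //.
    by rewrite rpredD ?rpred_nat //; case: (int_lattice AkapF x).
  by move=> pp; apply: (@nrm_cong_ndvd _ s m p y) => //; rewrite -yE.
pose B (p : 'I_M.+1) : pred X := [pred x | prime p && (p ^ 2 %| `|z x|)%N].
pose bad : pred X := [pred x | [exists p, B p x]].
have goodP x : ~~ bad x -> good m (al x).
  move=> gx; split; first exact: int_alphax.
    exists ((C * T)%:R + lattice_point kapF x) => //.
    by apply: (intD (Fix_subfield kapF)); [apply: (int_nat (Fix_subfield kapF))|apply: int_lattice].
  exists (z x); split=> // p pp pz; split; first by apply/rad_m0/pm0/(ndvd x).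
  apply: contra gx => pz2; apply/existsP.
  have z0 : (0 < `|z x|)%N by apply: ltnW.
  have lt_p : (p < M.+1)%N by rewrite ltnS Mmax // (leq_trans (dvdn_leq z0 pz2)).
  by exists (Ordinal lt_p); rewrite /B /= pp.
have Bcard p : (#|B p|%:R : rat) <= if (Z < p)%N then
    ((D ^ 2)%:R * ((4 * c * T) ^ D)%:R) * (p%:R ^+ 2)^-1 + (D ^ 2)%:R else 0.
  have [[x Bx]|noB] := pselect (exists x, B p x); last first.
    have -> : #|B p| = 0%N by apply: eq_card0 => x; apply/negP => Bx; apply: noB; exists x.
    by case: ifP => _ //; rewrite addr_ge0 ?mulr_ge0 ?ler0n // invr_ge0 exprn_ge0.
  have /andP[pp pz2] := Bx.
  have pz : (p %| `|z x|)%N by apply: dvdn_trans pz2; rewrite expnS expn1 dvdn_mulr.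
  have pm := ndvd x p pp pz; rewrite pZ //.
  have cp : (c ^ D < p ^ 2)%N.
    apply: (@leq_trans p); last by rewrite expnS expn1 leq_pmull ?prime_gt0.
    by apply: leq_trans (pZ p pp pm); rewrite ltnS /Z -addnA addnCA leq_addr.
  have := cP m p C T (B p) pp pm (rad_m0 pp (pm0 _ pm)) cp.
  have HB : forall y, y \in B p -> exists2 z0 : int, nrm s (alphax kapF m C y) = z0%:~R & (p ^ 2
    %| `|z0|)%N.
    by move=> y /andP[_ yz]; exists (z y) => //; apply: zE.
  move=> /(_ HB); rewrite -(ler_nat rat) natrM => h.
  have p20 : 0 < (p%:R : rat) ^+ 2 by rewrite exprn_gt0 // ltr0n prime_gt0.
  rewrite -(ler_pM2r p20) mulrDl divfK ?gt_eqF // -natrX.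
  by apply: (le_trans h); rewrite natrM natrD mulrDr lexx.
have badcard : (#|bad| * 2 <= T ^ D)%N.
  rewrite -(ler_nat rat).
  have h1 : (#|bad|%:R : rat) <= \sum_(p < M.+1) #|B p|%:R.
    by rewrite -natr_sum ler_nat card_exists_le.
  have h2 : \sum_(p < M.+1) (#|B p|%:R : rat) <= \sum_(p < M.+1 | (Z < p)%N)
      (((D ^ 2)%:R * ((4 * c * T) ^ D)%:R) * (p%:R ^+ 2)^-1 + (D ^ 2)%:R).
    rewrite [leRHS]big_mkcond; apply: ler_sum => p _; exact: Bcard.
  have h3 : \sum_(p < M.+1 | (Z < p)%N)
      (((D ^ 2)%:R * ((4 * c * T) ^ D)%:R) * (p%:R ^+ 2)^-1 + (D ^ 2)%:R) <=
      ((D ^ 2)%:R * ((4 * c * T) ^ D)%:R) * Z%:R^-1 + (D ^ 2)%:R * M.+1%:R :> rat.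
    rewrite big_split lerD //=.
      by rewrite -mulr_sumr ler_wpM2l ?mulr_ge0 ?ler0n // sum_inv_sq.
    rewrite sumr_const -[leLHS]mulr_natr ler_wpM2l ?ler0n // ler_nat.
    by rewrite (leq_trans (max_card _)) // card_ord.
  have h4 : ((D ^ 2)%:R * ((4 * c * T) ^ D)%:R) * Z%:R^-1 * 4 <= (T ^ D)%:R :> rat.
    rewrite mulrAC ler_pdivrMr ?ltr0n // -!natrM ler_nat.
    by rewrite expnMn /Z; nia.
  have h5 : (D ^ 2)%:R * M.+1%:R * 4 <= (T ^ D)%:R :> rat.
    rewrite -!natrM ler_nat -leq_sqr.
    have hM : (M.+1 ^ 2 <= 4 * (2 * (m * C * T)) ^ D)%N.
      have N1 : (0 < (2 * (m * C * T)) ^ D)%N by rewrite expn_gt0 3!muln_gt0 m_gt0 C0 T_gt0.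
      by move: M2 N1; move: (_ ^ D)%N => N; clear; case: M => [|M']; nia.
    apply: (@leq_trans (16 * D ^ 4 * (4 * (2 * (m * C * T)) ^ D))).
      have -> : ((D ^ 2 * M.+1 * 4) ^ 2 = 16 * D ^ 4 * M.+1 ^ 2)%N by ring.
      by rewrite leq_mul2l hM orbT.
    have -> : (2 * (m * C * T) = 2 * m * C * T)%N by ring.
    rewrite expnMn [leqRHS]expnS expn1.
    have : (64 * D ^ 4 * (2 * m * C) ^ D <= T ^ D)%N.
      by apply: leq_trans TD; apply: leq_trans TT0; apply: leq_addr.
    move: (T ^ D)%N ((2 * m * C) ^ D)%N (D ^ 4)%N => t w d; clear; nia.
  have := le_trans h1 (le_trans h2 h3); move: h4 h5; rewrite natrM.
  set u := _ * Z%:R^-1; set v := (D ^ 2)%:R * M.+1%:R.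
  by clear; move=> h4 h5 h6; lra.
have al_inj : injective al.
  move=> x y e; apply/ffunP => j; apply: val_inj.
  have mC0 : m%:R != 0 :> algC by rewrite pnatr_eq0 -lt0n.
  have := alphaxB kapF m C x y; rewrite -/(al x) -/(al y) e subrr => /esym/eqP.
  rewrite mulf_eq0 (negPf mC0) /= => /eqP/(int_comb_eq0 s_inj)/(_ j)/eqP.
  by rewrite subr_eq0 eqz_nat => /eqP.
exists [seq al x | x <- enum [pred x | ~~ bad x]]; split=> //.
- by rewrite map_inj_uniq // enum_uniq.
- rewrite size_map -cardE.
  have := cardC bad; rewrite card_ffun !card_ord => e.
  have -> : #|[pred x | ~~ bad x]| = #|[predC bad]| by apply: eq_card => x; rewrite !inE.
  by move: e badcard; lia.
- move=> a /mapP[x]; rewrite mem_enum inE => gx ->; split; first exact: goodP.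
  by move=> nu; apply: alB.
Qed.

End ManyGood.

(** * Counting *)

Lemma counting_ge (R : realType) (T : choiceType) (X : set T) (l : seq T) :
  uniq l -> {in l, forall x, X x} -> ((size l)%:R%:E <= counting X :> \bar R)%E.
Proof.
move=> ul lX; rewrite /counting; case: asboolP => [finX|_]; last by rewrite leey.
rewrite lee_fin ler_nat.
apply: uniq_leq_size => // x xl.
by rewrite in_fset_set // inE; apply: lX.
Qed.

Lemma counting_le (R : realType) (U : Type) (T : choiceType) (f : U -> T) (X : set T) (l : seq U) :
  (forall x, X x -> exists i, x = nth x [seq f u | u <- l] i /\ (i < size l)%N) ->
  (counting X <= (size l)%:R%:E :> \bar R)%E.
Proof.
move=> XP; have Xl x : X x -> x \in [seq f u | u <- l].
  by move=> /XP[i [-> il]]; apply: mem_nth; rewrite size_map.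
have finX : finite_set X.
  by apply: sub_finite_set (finite_seq [seq f u | u <- l]) => x /Xl.
rewrite /counting asboolT // lee_fin ler_nat.
rewrite -(size_map f l); apply: uniq_leq_size => // x.
by rewrite in_fset_set // inE => /Xl.
Qed.

Lemma fibre_bound (X Y : eqType) (f : X -> Y) (l : nat) (A : seq X) (B : seq Y) :
  {in A, forall x, f x \in B} -> (forall y, (count (fun x => f x == y) A <= l)%N) ->
  (size A <= l * size B)%N.
Proof.
move=> AB fl; elim: B A AB fl => [|y B IH] A AB fl.
  by case: A AB fl => // x A /(_ x (mem_head _ _)).
rewrite /= mulnS -(count_predC (fun x => f x == y)) leq_add //.
rewrite -size_filter; apply: IH => [x|y'].
  by rewrite mem_filter => /andP[/= /negPf xy /AB]; rewrite inE xy.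
apply: leq_trans (fl y'); rewrite count_filter; apply: sub_count => x /=.
by case/andP.
Qed.

Section NormBound.
Variables (R : realType) (kap : algC) (Akap : kap \in Aint).
Local Notation F := (Fix kap).
Local Notation O := (integers F).
Let FP : subfield F := Fix_subfield kap.
Variables (D : nat) (s : 'I_D -> {rmorphism algC -> algC}).
Hypothesis s_inj : injective (fun i => s i kap).
Hypothesis s_all : forall nu, exists i, nu kap = s i kap.

(** Each class has a representative [x - d * y] whose conjugates are bounded by a multiple of [B],
    and [small_count] bounds the number of these. As [X] is an arbitrary set, the closure properties
    are read off the intersection defining the generated ideal. *)
Lemma ideal_norm_generated_le : exists C : nat, forall (X : set algC) (d : algC) (B : nat),
  ideal_generated F X d -> O d -> d != 0 -> (0 < B)%N -> (forall i, `|s i d| <= B%:R) ->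
  (ideal_norm R F (ideal_generated F X) <= (C * B ^ D)%:R%:E)%E.
Proof.
have [C1 C1P] := reduce_mod Akap s_inj s_all.
have [C2 C2P] := small_count s_inj s_all.
exists (C2 * C1.+1 ^ D)%N => X d B Jd Od d0 B0 dB.
pose J := ideal_generated F X.
have J0 : J 0 by move=> M [[_ M0 _ _] _].
have JD x y : J x -> J y -> J (x + y).
  by move=> Jx Jy M [iM XM]; case: (iM) => _ _ MD _; apply: (MD); [apply: Jx|apply: Jy].
have JM a x : O a -> J x -> J (a * x).
  by move=> Oa Jx M [iM XM]; case: (iM) => _ _ _ MM; apply: (MM) => //; apply: Jx.
have JN x : J x -> J (- x).
  by move=> Jx; rewrite -mulN1r; apply: (JM) => //; apply: (intN FP); apply: (int1 FP).
have [l [ul lP]] := @listing _ (fun x => O x /\ forall i, `|s i x| <= (C1.+1 * B)%:R)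
    (C2 * (C1.+1 * B) ^ D)%N
    (fun Y => C2P (C1.+1 * B)%N Y (ltac:(by rewrite muln_gt0))).
have sl : (size l <= C2 * C1.+1 ^ D * B ^ D)%N.
  rewrite -mulnA -expnMn; apply: C2P => //; first by rewrite muln_gt0.
  by move=> x /lP.
apply: (@le_trans _ _ (size l)%:R%:E); last by rewrite lee_fin ler_nat.
apply: (@counting_le _ _ _ (fun r => [set r + y | y in J])) => _ [x Ox <-].
have [y Oy yP] := C1P d x B%:R Od d0 Ox dB.
have xl : x - d * y \in l.
  apply/lP; split=> [|i]; first by apply: (intB FP) => //; apply: (intM FP).
  by rewrite (le_trans (yP i)) // -natrM ler_nat leq_mul2r leqnSn orbT.
exists (index (x - d * y) l); rewrite index_mem xl; split=> //.
rewrite (nth_map 0) ?index_mem // nth_index //.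
have Jdy : J (d * y) by rewrite mulrC; apply: (JM).
apply/seteqP; split=> _ [u Ju <-].
  by exists (d * y + u); [apply: (JD)|rewrite addrA subrK].
by exists (u - d * y); [apply: (JD) => //; apply: (JN)|ring].
Qed.

End NormBound.

Section Family.
Variables (kapk kapK kapF kapE zeta : algC) (l : nat) (l_prime : prime l).
Hypothesis z_prim : l.-primitive_root zeta.
Hypothesis FK : forall nu, nu kapF = kapF <-> nu kapK = kapK /\ nu zeta = zeta.
Hypothesis AkapE : kapE \in Aint.
Hypothesis nkapE : forall nu, Fix kapE (nu kapE).
Hypothesis FE : Fix kapE kapF.
Hypothesis kK : Fix kapK kapk.
Hypothesis Akapk : kapk \in Aint.
Hypothesis AkapK : kapK \in Aint.
Variables (n : nat) (mu : 'I_n -> {rmorphism algC -> algC}).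
Hypothesis mu_k : forall i, mu i kapk = kapk.
Hypothesis mu_inj : injective (fun i => mu i kapK).
Hypothesis mu_all : forall nu, nu kapk = kapk -> exists i, nu kapK = mu i kapK.
Variables (D : nat) (s : 'I_D -> {rmorphism algC -> algC}).
Hypothesis s_inj : injective (fun i => s i kapF).
Hypothesis s_all : forall nu, exists i, nu kapF = s i kapF.
Variables (bK : 'I_n -> algC).
Hypothesis bKP : basis_fin (Fix kapk) (Fix kapK) bK.
Hypothesis AbK : forall i, bK i \in Aint.

Local Notation k := (Fix kapk).
Local Notation K := (Fix kapK).
Local Notation F := (Fix kapF).
Local Notation E := (Fix kapE).
Local Notation Delta := (@Delta kapK zeta l).
Local Notation nub := (@nub kapK zeta l).
Local Notation gam := (@gam kapK zeta l).
Local Notation eps := (@eps kapK zeta l).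
Local Notation nual := (@nual kapK zeta l).
Let l0 : (0 < l)%N. Proof. exact: prime_gt0. Qed.
Let KP : subfield K := Fix_subfield kapK.
Let W := \matrix_(i, j) mu i (bK j).

Lemma mu_perm nu : nu kapk = kapk ->
  exists t : {perm 'I_n}, forall i x, K x -> nu (mu i x) = mu (t i) x.
Proof.
move=> nuk.
have tP i : {j | nu (mu i kapK) = mu j kapK}.
  by apply/cid/(mu_all (nu := nu \o mu i : {rmorphism _ -> _})); rewrite /= mu_k.
pose t i := sval (tP i).
have tE i : nu (mu i kapK) = mu (t i) kapK by rewrite /t; case: (tP i).
have t_inj : injective t.
  by move=> i j e; apply: mu_inj; apply: (fmorph_inj nu); rewrite !tE e.
exists (perm t_inj) => i x Kx; rewrite permE.
exact: (aut_eq_Fix (nu := (nu \o mu i : {rmorphism algC -> algC})) Kx (tE i)).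
Qed.

(** The nonsingular Vandermonde matrix of the conjugates of [kapK] factors through [W]. *)
Lemma det_W_neq0 : \det W != 0.
Proof.
have [_ span _] := bKP.
have aP (j : 'I_n) : {a : 'I_n -> algC | (forall i, k (a i)) /\ kapK ^+ j = \sum_i a i * bK i}.
  by apply: cid; have [a ka aE] := span _ (subX KP j (@Fix_gen kapK)); exists a.
have := Fix_det mu_inj; apply: contraNneq => W0.
suff -> : \matrix_(i, j) mu i (kapK ^+ j) = W *m \matrix_(i, j) sval (aP j) i.
  by rewrite det_mulmx W0 mul0r.
apply/matrixP=> i j; rewrite !mxE; have [ka aE] := svalP (aP j).
rewrite aE rmorph_sum; apply: eq_bigr => i' _; rewrite !mxE /= rmorphM mulrC.
by rewrite (ka i' _ (mu_k i)).
Qed.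

Lemma det_W2_k : k (\det W ^+ 2).
Proof.
move=> nu nuk; have [t tE] := mu_perm nuk.
rewrite rmorphXn -det_map_mx.
have -> : map_mx nu W = row_perm t W.
  by apply/matrixP=> i j; rewrite !mxE /= tE //; case: bKP => + _ _; apply.
by rewrite row_permE det_mulmx det_perm exprMn -exprM mulnC exprM sqrrN !expr1n mul1r.
Qed.

Variable Dk : nat.
Variable sk : 'I_Dk -> {rmorphism algC -> algC}.
Hypothesis sk_inj : injective (fun i => sk i kapk).
Hypothesis sk_all : forall nu, exists i, nu kapk = sk i kapk.

(** The composites of the embeddings of k, of K over k and of F over K are distinct on F. In
    [good_norm] this turns the exponent coming from the norm of [disc_gen] into [D * l.-1]. *)
Lemma degree_le : (Dk * (n * #|[pred b | Delta b]|) <= D)%N.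
Proof.
pose f (x : 'I_Dk * ('I_n * {b : 'I_l | Delta b})) :=
  sval (cid (s_all (sk x.1 \o mu x.2.1 \o nub (val x.2.2) : {rmorphism _ -> _}))).
have fE x : s (f x) kapF = sk x.1 (mu x.2.1 (nub (val x.2.2) kapF)).
  by rewrite /f; case: cid => /= ? ->.
have K_F x : K x -> F x by move=> Kx nu /FK[? _]; apply: Kx.
have inF x y : f x = f y -> forall u, F u ->
   sk x.1 (mu x.2.1 (nub (val x.2.2) u)) = sk y.1 (mu y.2.1 (nub (val y.2.2) u)).
  move=> xy u Fu.
  have := aut_eq_Fix (nu := sk x.1 \o mu x.2.1 \o nub (val x.2.2) : {rmorphism _ -> _})
    (mu := sk y.1 \o mu y.2.1 \o nub (val y.2.2) : {rmorphism _ -> _}) Fu.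
  by apply; rewrite /= -!fE xy.
have f_inj : injective f.
  move=> [j [i [b Db]]] [j' [i' [b' Db']]] /inF/= e.
  have [bK1 _] := nubP Db; have [bK2 _] := nubP Db'.
  have jj : j = j'.
    apply: sk_inj; have := e _ (K_F _ kK).
    by rewrite (kK bK1) (kK bK2) !mu_k.
  move: e; rewrite -{}jj => e; have {}e u Fu := fmorph_inj (sk j) (e u Fu).
  have ii : i = i'.
    by apply: mu_inj; have := e _ (K_F _ (@Fix_gen kapK)); rewrite bK1 bK2.
  move: e; rewrite -{}ii => e; have {}e u Fu := fmorph_inj (mu i) (e u Fu).
  have bb := nub_inj z_prim FK Db Db' (e _ (@Fix_gen kapF)).
  by congr (_, (_, _)); apply: val_inj.
have := leq_card f f_inj; rewrite !card_prod !card_ord card_sig.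
by move=> h; rewrite (leq_trans _ h) // !leq_mul.
Qed.

Definition disc_gen (alpha : algC) : algC :=
  (\prod_i mu i (nual alpha)) ^+ l.-1 * \det W ^+ 2 ^+ l.

Lemma disc_gen_int alpha : integers F alpha -> integers k (disc_gen alpha).
Proof.
move=> [Fa Aa]; split.
  apply: (subM (Fix_subfield kapk)); last by apply: (subX (Fix_subfield kapk)); apply: det_W2_k.
  apply: (subX (Fix_subfield kapk)) => nu nuk; have [t tE] := mu_perm nuk.
  rewrite rmorph_prod [RHS](reindex_inj (@perm_inj _ t)) /=; apply: eq_bigr => i _; apply: tE.
  by move=> nu' nuK'; apply: nual_fixed.
rewrite /disc_gen rpredM ?rpredX //.
  apply: rpred_prod => i _; rewrite Aint_aut.
  by apply: rpred_prod => b _; rewrite Aint_aut.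
by apply: Aint_det => i j; rewrite mxE Aint_aut.
Qed.

Lemma disc_gen_neq0 alpha : alpha != 0 -> disc_gen alpha != 0.
Proof.
move=> a0; rewrite mulf_neq0 ?expf_neq0 ?det_W_neq0 //.
apply/prodf_neq0 => i _; rewrite fmorph_eq0.
by apply/prodf_neq0 => b _; rewrite fmorph_eq0.
Qed.

Lemma disc_gen_bound : exists2 C : nat, (0 < C)%N & forall alpha (B : nat),
  (forall nu, `|nu alpha| <= B%:R) ->
  forall j, `|sk j (disc_gen alpha)| <= (C * B ^ (n * #|[pred b | Delta b]| * l.-1))%:R.
Proof.
have [C CP] := nat_bound (fun j => sk j (\det W ^+ 2 ^+ l)).
exists C.+1 => // alpha B aB j.
rewrite rmorphM normrM natrM mulrC ler_pM //.
  by rewrite (le_trans (CP j)) // ler_nat.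
rewrite rmorphXn normrX natrX exprM lerXn2r ?nnegrE ?exprn_ge0 ?ler0n //.
rewrite rmorph_prod normr_prod exprM exprAC -[X in _ <= _ ^+ X]card_ord -prodr_const ler_prod //
  => i _.
rewrite normr_ge0 /= !rmorph_prod normr_prod -prodr_const ler_prod // => b _.
by rewrite normr_ge0 /= (aB (sk j \o mu i \o nub b : {rmorphism _ -> _})).
Qed.

Lemma kapL_ex alpha : exists2 kapL, kapL \in Aint & forall nu, nu kapL = kapL <->
  nu kapK = kapK /\ forall a, nu (eps alpha a) = eps alpha a.
Proof.
have [kapL AL [_ LP]] := primitive_element (kapK :: [seq eps alpha a | a <- iota 0 l]).
exists kapL => // nu; split=> [/LP nuL|[nuK nue]].
  split=> [|a]; first by apply: nuL; rewrite inE eqxx.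
  rewrite -(eps_mod _ z_prim); apply: nuL; rewrite inE; apply/orP; right.
  by apply: map_f; rewrite mem_iota /= ltn_mod.
by apply/LP => x; rewrite inE => /orP[/eqP->//|/mapP[a _ ->]].
Qed.

Definition kapL alpha := sval (cid2 (kapL_ex alpha)).

Lemma AkapL alpha : kapL alpha \in Aint.
Proof. by rewrite /kapL; case: cid2. Qed.

Lemma kapLP alpha nu : nu (kapL alpha) = kapL alpha <->
  nu kapK = kapK /\ forall a, nu (eps alpha a) = eps alpha a.
Proof. by rewrite /kapL; case: cid2. Qed.

Variables (m : nat) (m_gt0 : (0 < m)%N) (lm : (l ^ 2 %| m)%N).
Local Notation good := (good kapF kapE s m).

Lemma good_int alpha : good alpha -> integers F alpha.
Proof. by case. Qed.

Lemma good_cong d alpha : (d %| m)%N -> good alpha ->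
  exists2 y, y \in Aint & alpha = 1 + d%:R * y.
Proof.
move=> /dvdnP[q ->] [_ [y [_ Ay] ->] _]; exists (q%:R * y).
  by rewrite rpredM ?rpred_nat.
by rewrite natrM mulrCA mulrA.
Qed.

Lemma good_prime alpha : good alpha -> exists (z : int) p, [/\ nrm s alpha = z%:~R, z != 0 &
  [/\ prime p, radical E (mult E p%:R), (p %| `|z|)%N & ~~ (p ^ 2 %| `|z|)%N]].
Proof.
case=> _ _ [z [nz z1 zP]]; exists z, (pdiv `|z|).
have pp : prime (pdiv `|z|) by rewrite pdiv_prime.
have [rp p2] := zP _ pp (pdiv_dvd _).
by split=> //; [rewrite -absz_eq0; case: `|z|%N z1|split; rewrite ?pdiv_dvd].
Qed.

Lemma good_tau alpha : good alpha -> exists tau : {rmorphism algC -> algC},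
  tau kapE = kapE /\ forall a, tau (eps alpha a) = eps alpha a.+1.
Proof.
move=> gA; have [z [p [nz z0 [pp rp pz p2]]]] := good_prime gA.
exact: (generator_ex l_prime z_prim FK AkapE nkapE FE mu_inj mu_all s_all (good_int gA) nz z0
  pp rp pz p2).
Qed.

Lemma good_galois alpha (H : {group {perm 'I_n}}) :
  (forall t : {perm 'I_n}, t \in H <-> exists2 nu : {rmorphism algC -> algC}, nu kapk = kapk &
     forall i x, K x -> nu (mu i x) = mu (t i) x) ->
  good alpha -> has_galois_group k (Fix (kapL alpha)) (wreath (cyclic_perm_group l) H).
Proof.
move=> galH gA; have [z [p [nz z0 [pp rp pz p2]]]] := good_prime gA.
have [tau [tauE tauP]] := good_tau gA.
exact: (L_has_galois_group l_prime z_prim FK AkapE nkapE FE kK mu_k mu_inj mu_all s_all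
  (good_int gA) nz z0 pp rp pz p2 tauE tauP (@kapLP alpha) galH bKP).
Qed.

Lemma good_unramified alpha (pk : set algC) (d : nat) : good alpha -> (d %| m)%N ->
  prime_ideals k pk -> unramified K pk -> pk d%:R -> unramified (Fix (kapL alpha)) pk.
Proof.
move=> gA dm pkP unr pkd; have [z [p [nz z0 _]]] := good_prime gA.
have [tau [tauE tauP]] := good_tau gA.
apply: (L_unramified l_prime z_prim FK FE kK s_all (good_int gA) nz z0 (good_cong lm gA)
  tauE tauP (@kapLP alpha) AkapK (AkapL alpha) pkP unr _ pkd (good_cong dm gA)).
by rewrite (dvdn_gt0 m_gt0).
Qed.

Lemma good_neq0 alpha : good alpha -> alpha != 0.
Proof.
move=> gA; have [z [p [nz z0 _]]] := good_prime gA.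
exact: (alpha_neq0 s_all nz z0).
Qed.

Lemma good_norm (R : realType) : exists2 C : nat, (0 < C)%N & forall alpha (B : nat),
  good alpha -> (0 < B)%N -> (forall nu, `|nu alpha| <= B%:R) ->
  (ideal_norm R k (discriminant k (Fix (kapL alpha))) <= (C * B ^ (D * l.-1))%:R%:E)%E.
Proof.
have [C1 C1P] := ideal_norm_generated_le R Akapk sk_inj sk_all.
have [C2 C2_gt0 C2P] := disc_gen_bound.
exists (C1 * C2 ^ Dk).+1 => // alpha B gA B0 aB.
have [z [p [nz z0 _]]] := good_prime gA.
have [tau [tauE tauP]] := good_tau gA.
have dL : discriminant k (Fix (kapL alpha)) (disc_gen alpha).
  exact: (L_discriminant l_prime z_prim FK FE kK mu_k mu_inj mu_all s_all (good_int gA) nz z0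
    (good_cong lm gA) tauE tauP (@kapLP alpha) bKP AbK).
have B1 : (0 < C2 * B ^ (n * #|[pred b | Delta b]| * l.-1))%N by rewrite muln_gt0 C2_gt0 expn_gt0
  B0.
apply: (le_trans (C1P _ (disc_gen alpha) _ dL (disc_gen_int (good_int gA))
  (disc_gen_neq0 (good_neq0 gA)) B1 (C2P _ _ aB))).
rewrite lee_fin ler_nat expnMn mulnA leq_mul // -expnM leq_pexp2l //.
by rewrite mulnAC leq_mul2r mulnC degree_le orbT.
Qed.

Lemma good_shift alpha nu : good alpha -> nu kapK = kapK ->
  exists t, (forall a, nu (eps alpha a) = eps alpha (a + t)) /\
    (nu zeta = zeta -> nu (gam alpha 1) = zeta ^+ t * gam alpha 1).
Proof.
move=> gA nuK; have [t [te tg]] :=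
  eps_action l_prime z_prim FK (proj1 (good_int gA)) (good_neq0 gA) nuK.
by exists t; split=> // /tg ->; rewrite mul1n.
Qed.

Lemma good_eps_inj alpha a b : good alpha -> eps alpha a = eps alpha b -> (a = b %[mod l])%N.
Proof.
move=> gA; have [z [p [nz z0 _]]] := good_prime gA; have [tau [tauE tauP]] := good_tau gA.
exact: (eps_inj l_prime z_prim s_all nz z0 tauP).
Qed.

Lemma autX_shift nu alpha t i a : (forall a, nu (eps alpha a) = eps alpha (a + t)) ->
  autX nu i (eps alpha a) = eps alpha (a + i * t).
Proof.
by move=> nuP; elim: i => [|i IH] /=; rewrite ?addn0 // IH nuP mulSn -addnA (addnC t).
Qed.

(* An automorphism fixing [E] acts on [L] as a power of [tau], so it shifts the [eps] of both
   elements by the same amount. *)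
Lemma good_common_shift (tau : {rmorphism algC -> algC}) alpha0 alpha alpha' t : tau kapE = kapE ->
  (forall a, tau (eps alpha0 a) = eps alpha0 a.+1) ->
  good alpha0 -> good alpha -> good alpha' ->
  Fix (kapL alpha) = Fix (kapL alpha0) -> Fix (kapL alpha') = Fix (kapL alpha0) ->
  (forall a, tau (eps alpha a) = eps alpha (a + t)) ->
  (forall a, tau (eps alpha' a) = eps alpha' (a + t)) ->
  forall nu, nu kapE = kapE -> exists u,
    nu (gam alpha 1) = zeta ^+ u * gam alpha 1 /\ nu (gam alpha' 1) = zeta ^+ u * gam alpha' 1.
Proof.
move=> tauE tau0 g0 gA gA' LA LA' tauA tauA' nu nuE.
have fixE nu' : nu' kapE = kapE -> nu' kapK = kapK /\ nu' zeta = zeta.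
  by move=> /FE/FK.
have [nuK nuz] := fixE _ nuE; have [tauK _] := fixE _ tauE.
have [i [iP _]] := good_shift g0 nuK.
have nuX x : Fix (kapL alpha0) x -> nu x = autX tau i x.
  move=> Lx; apply: (L_eq (@kapLP alpha0) Lx) => [|a]; first by rewrite nuK autX_fix.
  by rewrite iP (tauX_eps tau0).
have shiftP beta : good beta -> Fix (kapL beta) = Fix (kapL alpha0) ->
    (forall a, tau (eps beta a) = eps beta (a + t)) ->
    nu (gam beta 1) = zeta ^+ (i * t) * gam beta 1.
  move=> gB LB tauB; have [u [uP ug]] := good_shift gB nuK.
  rewrite (ug nuz) (eq_zeta z_prim (a := u) (b := (i * t)%N)) //.
  apply: (good_eps_inj gB); rewrite -[u]add0n -uP -[(i * t)%N]add0n -(autX_shift i 0 tauB).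
  by apply: nuX; rewrite -LB; apply: (eps_L (@kapLP beta)).
by exists (i * t)%N; split; apply: shiftP.
Qed.

(* The quotient of the two elements is an algebraic integer, and the conjugates of the quotient
   are at distance less than 1 from 1. *)
Lemma good_eq (tau : {rmorphism algC -> algC}) alpha0 alpha alpha' t (Y : nat) : tau kapE = kapE ->
  (forall a, tau (eps alpha0 a) = eps alpha0 a.+1) ->
  good alpha0 -> good alpha -> good alpha' ->
  Fix (kapL alpha) = Fix (kapL alpha0) -> Fix (kapL alpha') = Fix (kapL alpha0) ->
  (forall a, tau (eps alpha a) = eps alpha (a + t)) ->
  (forall a, tau (eps alpha' a) = eps alpha' (a + t)) ->
  (0 < Y)%N -> (forall nu, `|nu alpha - Y%:R| * 4 <= Y%:R :> algC) ->
  (forall nu, `|nu alpha' - Y%:R| * 4 <= Y%:R :> algC) -> alpha = alpha'.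
Proof.
move=> tauE tau0 g0 gA gA' LA LA' tauA tauA' Y0 aY aY'.
have cs := good_common_shift tauE tau0 g0 gA gA' LA LA' tauA tauA'.
have [_ _ [z [nz z1 zP]]] := gA; have [_ _ [z' [nz' z1' zP']]] := gA'.
have z0 : z != 0 by rewrite -absz_eq0; case: `|z|%N z1.
have zP2 p : prime p -> (p %| `|z'|)%N -> ~~ (p ^ 2 %| `|z'|)%N.
  by move=> pp /(zP' _ pp)[].
have Ad := common_div l_prime z_prim FK AkapE nkapE FE s_all (good_int gA) (good_int gA') nz nz'
  z0 zP zP2 cs.
have FP : subfield F := Fix_subfield kapF.
have a0 := good_neq0 gA.
suff : alpha' / alpha - 1 = 0.
  by move/eqP; rewrite subr_eq0 => /eqP e; rewrite -[alpha'](divfK a0) e mul1r.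
apply: (small_eq0 s_inj s_all) => [|i].
  split; last by rewrite rpredB ?rpred1.
  by apply: (subB FP); [apply: (subM FP); [case: gA' => -[]|apply: (subV FP);
    case: gA => -[]]|exact: (sub1 FP)].
have na0 : s i alpha != 0 by rewrite fmorph_eq0.
rewrite rmorphB rmorph1 fmorph_div -[X in _ - X](divff na0) -mulrBl normrM normfV.
rewrite ltr_pdivrMr ?normr_gt0 // mul1r.
have h1 := aY (s i); have h2 := aY' (s i).
have Y1 : 0 < Y%:R :> algC by rewrite ltr0n.
have le1 : `|s i alpha' - s i alpha| * 4 <= Y%:R + Y%:R.
  have -> : s i alpha' - s i alpha = (s i alpha' - Y%:R) - (s i alpha - Y%:R) by ring.
  rewrite (le_trans _ (lerD h2 h1)) // -mulrDl ler_wpM2r ?ler0n //.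
  exact: ler_normB.
have le2 : Y%:R * 4 - Y%:R <= `|s i alpha| * 4.
  rewrite lerBlDr (le_trans _ (lerD (lexx (`|s i alpha| * 4)) h1)) //.
  rewrite -mulrDl ler_wpM2r ?ler0n // -[X in X <= _]normr_nat.
  have {1}-> : Y%:R = s i alpha - (s i alpha - Y%:R) by ring.
  exact: ler_normB.
rewrite -(ltr_pM2r (x := 4)) ?ltr0n // (le_lt_trans le1) // (lt_le_trans _ le2) //.
by rewrite -subr_gt0 (_ : _ - _ = Y%:R) //; ring.
Qed.

(** A [tau] shifting the [eps alpha0] by 1, for one element [alpha0] of the fibre, shifts the [eps]
    of every other element by some exponent modulo [l]. By [good_eq] this exponent determines the
    element. *)
Lemma good_fibre (A : seq algC) (Y : nat) (L : set algC) : uniq A -> (0 < Y)%N ->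
  {in A, forall alpha, good alpha /\ forall nu, `|nu alpha - Y%:R| * 4 <= Y%:R :> algC} ->
  (count (fun alpha => Fix (kapL alpha) == L) A <= l)%N.
Proof.
move=> uA Y0 AP; rewrite -size_filter.
case E0 : [seq _ <- _ | _] => [//|alpha0 A'].
set A1 := _ :: _ in E0 *; have A1P alpha : alpha \in A1 ->
    [/\ good alpha, forall nu, `|nu alpha - Y%:R| * 4 <= Y%:R :> algC &
        Fix (kapL alpha) = Fix (kapL alpha0)].
  have : alpha0 \in A1 by rewrite mem_head.
  rewrite -E0 !mem_filter => /andP[/eqP-> _] /andP[/eqP-> /AP[]].
  by [].
have [g0 _ _] := A1P _ (mem_head _ _).
have [tau [tauE tau0]] := good_tau g0; have [tauK _] := (FK tau).1 (FE tauE).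
have tP alpha : {t : nat | alpha \in A1 -> forall a, tau (eps alpha a) = eps alpha (a + t)}.
  apply: cid; have [/A1P[gA _ _]|_] := boolP (alpha \in A1); last by exists 0%N.
  by have [t [te _]] := good_shift gA tauK; exists t.
pose f alpha : 'I_l := Ordinal (ltn_pmod (sval (tP alpha)) l0).
have fP alpha a : alpha \in A1 -> tau (eps alpha a) = eps alpha (a + f alpha).
  move=> /(svalP (tP alpha))->; rewrite -(eps_mod _ z_prim) -[RHS](eps_mod _ z_prim).
  by rewrite /f /= modnDmr.
have f_inj : {in A1 &, injective f}.
  move=> alpha alpha' A1a A1a' ff; have [gA aY LA] := A1P _ A1a; have [gA' aY' LA'] := A1P _ A1a'.
  apply: (good_eq tauE tau0 g0 gA gA' LA LA' _ _ Y0 aY aY' (t := f alpha)) => a.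
    exact: fP.
  by rewrite ff; apply: fP.
rewrite -(size_map f) -(card_uniqP _); last by rewrite map_inj_in_uniq // -E0 filter_uniq.
by rewrite -[X in (_ <= X)%N]card_ord max_card.
Qed.

Variables (S : set (set algC)) (SP : S `<=` prime_ideals k).
Hypothesis unrS : forall p, S p -> unramified K p.
Hypothesis mS : forall p, S p -> exists2 d, (d %| m)%N & p d%:R.
Variable H : {group {perm 'I_n}}.
Hypothesis galH : forall t : {perm 'I_n}, t \in H <->
  exists2 nu : {rmorphism algC -> algC}, nu kapk = kapk &
    forall i x, K x -> nu (mu i x) = mu (t i) x.
Variables (Cy T0 : nat).
Hypothesis many : forall T, (T0 <= T)%N -> exists A : seq algC,
  [/\ uniq A, (T ^ D <= 2 * size A)%N, (64 <= m * Cy * T)%N &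
    {in A, forall alpha, good alpha /\
      forall nu, `|nu alpha - (m * Cy * T)%:R| * 4 <= (m * Cy * T)%:R :> algC}].

(** The factor 2 is the loss in the sieve, and [l] bounds the number of elements giving the same
    field. *)
Lemma count_extensions_ge (R : realType) : exists2 C : nat, (0 < C)%N & forall T (x : R),
  (T0 <= T)%N -> (C * T ^ (D * l.-1))%:R <= x ->
  (((T ^ D)%:R / (2 * l)%:R)%:E <= count_extensions k S (wreath (cyclic_perm_group l) H) x)%E.
Proof.
have [C1 C1_gt0 C1P] := good_norm R.
exists (C1 * (2 * m * Cy).+1 ^ (D * l.-1))%N => [|T x TT Tx];
  first by rewrite muln_gt0 C1_gt0 expn_gt0.
have [A [uA TA Y64 AP]] := many TT.
set Y := (m * Cy * T)%N in Y64 AP; have Y0 : (0 < Y)%N by apply: leq_trans Y64.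
pose B := undup [seq Fix (kapL alpha) | alpha <- A].
have AB : (size A <= l * size B)%N.
  apply: (fibre_bound (f := fun alpha => Fix (kapL alpha))) => [alpha aA|L].
    by rewrite mem_undup; apply: (map_f (fun alpha => Fix (kapL alpha))).
  exact: good_fibre uA Y0 AP.
apply: (@le_trans _ _ (size B)%:R%:E).
  rewrite lee_fin ler_pdivrMr ?ltr0n ?muln_gt0 //= -natrM ler_nat.
  by rewrite (leq_trans TA) // mulnCA leq_mul2l /= mulnC.
apply: counting_ge; first exact: undup_uniq.
move=> L; rewrite mem_undup => /mapP[alpha aA ->]; have [gA aY] := AP _ aA.
split.
- exact: Fix_number_field.
- exact: (k_L kK (@kapLP alpha)).
- exact: good_galois.
- move=> p Sp; have [d dm pd] := mS Sp.
  exact: (good_unramified gA dm (SP Sp) (unrS Sp) pd).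
apply: (le_trans (C1P alpha (2 * Y)%N gA _ _)).
- by rewrite muln_gt0.
- move=> nu; rewrite -[nu alpha](subrK Y%:R) (le_trans (ler_normD _ _)) // normr_nat.
  rewrite mul2n -addnn natrD lerD2r (le_trans _ (aY nu)) // ler_peMr ?normr_ge0 //.
  by rewrite ler1n.
rewrite lee_fin (le_trans _ Tx) // ler_nat -mulnA leq_mul2l -expnMn; apply/orP; right.
case: (D * l.-1)%N => // e; rewrite leq_exp2r // /Y !mulnA leq_mul2r leqnSn orbT //.
Qed.

End Family.

(** [T] is the integer part of [y = (x / C) ^ (1 / N)] with [N = D (l - 1)], so that [y ^+ D] is the
    power 1/(l-1) of [x / C]. For large [x] this [T] is at least [y / 2], which costs the constant
    [2 ^+ D]. *)
Lemma asymptotics (R : realType) (C T0 D l : nat) (f : R -> \bar R) :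
  (0 < C)%N -> (0 < D)%N -> prime l ->
  (forall T (x : R), (T0 <= T)%N -> (C * T ^ (D * l.-1))%:R <= x ->
    (((T ^ D)%:R / (2 * l)%:R)%:E <= f x)%E) ->
  exists2 c : R, 0 < c & \forall x \near +oo, ((c * x `^ (l.-1%:R)^-1)%:E <= f x)%E.
Proof.
move=> C0 D0 lp fP; have l0 := prime_gt0 lp.
have l1 : (0 < l.-1)%N by have := prime_gt1 lp; case: (l) => [|[]].
have C0R : 0 < C%:R :> R by rewrite ltr0n.
have lR : 0 < (2 * l)%:R :> R by rewrite ltr0n muln_gt0.
set N := (D * l.-1)%N in fP; have N0 : (0 < N)%N by rewrite muln_gt0 D0.
pose a : R := (l.-1%:R)^-1.
exists (C%:R^-1 `^ a / 2 ^+ D / (2 * l)%:R).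
  by rewrite !divr_gt0 // ?powR_gt0 ?invr_gt0 // exprn_gt0.
near=> x.
have xN : (C * T0.+1 ^ N)%:R <= x by near: x; apply: nbhs_pinfty_ge; rewrite num_real.
have x0 : 0 <= x by rewrite (le_trans _ xN).
pose y := (x / C%:R) `^ (N%:R)^-1; have y0 : 0 <= y := powR_ge0 _ _.
have xC0 : 0 <= x / C%:R by rewrite divr_ge0.
have yN : y ^+ N = x / C%:R.
  by rewrite -powR_mulrn // -powRrM mulVf ?powRr1 // pnatr_eq0 -lt0n.
have yD : y ^+ D = C%:R^-1 `^ a * x `^ a.
  rewrite -powR_mulrn // -powRrM -powRM ?invr_ge0 // mulrC; congr (_ `^ _).
  by rewrite /N natrM invfM mulrAC mulVf ?mul1r // pnatr_eq0 -lt0n.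
have yT : T0.+1%:R <= y.
  rewrite -(ler_pXn2r N0) ?nnegrE // yN ler_pdivlMr // -natrX -natrM mulnC.
have /andP[Ty yT1] : (Num.truncn y)%:R <= y < (Num.truncn y).+1%:R.
  exact: truncn_itv.
set T := Num.truncn y in Ty yT1.
have T0T : (T0 < T)%N.
  by rewrite -ltnS -(ltr_nat R) (le_lt_trans yT).
have half : y / 2 <= T%:R.
  have : 1 <= T%:R :> R by rewrite ler1n (leq_ltn_trans _ T0T).
  by move: yT1; rewrite -addn1 natrD; lra.
apply: le_trans (fP T x (ltnW T0T) _); last first.
  rewrite natrM natrX -(ler_pdivlMl _ _ C0R) [_^-1 * _]mulrC -yN lerXn2r ?nnegrE ?ler0n //.
rewrite lee_fin; have -> : C%:R^-1 `^ a / 2 ^+ D / (2 * l)%:R * x `^ a = (y / 2) ^+ D / (2 * l)%:R.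
  by rewrite expr_div_n yD; ring.
by rewrite ler_wpM2r ?invr_ge0 ?ler0n // natrX lerXn2r ?nnegrE ?divr_ge0.
Unshelve. all: by end_near. Qed.

Theorem theorem8p2 (R : realType) (n : nat) (H : {group 'S_n})
    (transH : [transitive H, on [set: 'I_n]%SET | 'P])
    (k K : set algC) (kP : number_field k) (KP : number_field K)
    (kK : k `<=` K) (galK : has_galois_group k K H)
    (l : nat) (l_prime : prime l)
    (S : set (set algC)) (finS : finite_set S) (SP : S `<=` prime_ideals k)
    (unramS : forall p, S p -> unramified K p) :
  exists2 c : R, 0 < c &
    \forall x \near +oo,
      ((c * x `^ (l.-1%:R)^-1)%:E <=
       count_extensions k S (wreath (cyclic_perm_group l) H) x)%E.
Proof.
have [kapk Akapk kE] := number_field_Fix kP; have [kapK AkapK KE] := number_field_Fix KP.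
rewrite {}KE {}kE in kP KP kK galK SP unramS *.
have kKk : Fix kapK kapk by apply: kK; apply: Fix_gen.
have [[b0 b0P] [e0 [e0emb e0inj e0all] galH]] := galK.
have [bK [bKP AbK]] := basis_fin_integral (Fix_subfield kapk) (Fix_subfield kapK) kK
  (basis_fin_bij (@enum_rank_bij 'I_n) (b0P : basis_fin (Fix kapk) (Fix kapK) b0)).
have muP i := cid (embedding_aut (Fix_subfield kapk) kK (e0emb i)).
pose mu i := sval (muP i).
have muE i x : Fix kapK x -> e0 i x = mu i x.
  by move=> Kx; apply: (svalP (muP i)); apply: mem_set.
have mu_k i : mu i kapk = kapk.
  by rewrite -muE //; case: (e0emb i) => + _ _; apply; apply/mem_set/Fix_gen.
have mu_inj : injective (fun i => mu i kapK).
  move=> i j /= e; apply: e0inj => x /set_mem Kx; rewrite !muE //.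
  exact: aut_eq_Fix Kx e.
have mu_all (nu : {rmorphism algC -> algC}) : nu kapk = kapk -> exists i, nu kapK = mu i kapK.
  move=> nuk; have [i iP] := e0all nu (aut_embedding (Fix kapK) nuk).
  by exists i; rewrite -muE ?iP //; apply/mem_set; apply: Fix_gen.
have galH' (t : {perm 'I_n}) : t \in H <-> exists2 nu : {rmorphism algC -> algC}, nu kapk = kapk &
    forall i x, Fix kapK x -> nu (mu i x) = mu (t i) x.
  rewrite -(normal_closure_aut kapK mu_k t); split=> [/galH|] [sig sigP sige].
    exists sig => // i x /set_mem Kx; rewrite -!muE //; exact/sige/mem_set.
  apply/galH; exists sig => // i x /set_mem Kx; rewrite !muE //; exact/sige/mem_set.
have [zeta z_prim] := C_prim_root_exists (prime_gt0 l_prime).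
have [kapF AkapF [_ FKP]] := primitive_element [:: kapK; zeta].
have FK (nu : {rmorphism algC -> algC}) : nu kapF = kapF <-> nu kapK = kapK /\ nu zeta = zeta.
  rewrite FKP; split=> [nuP|[nuK nuz] x].
    by split; apply: nuP; rewrite !inE eqxx ?orbT.
  by rewrite !inE => /orP[] /eqP->.
have [D [s [s_inj s_all]]] := Fix_embeddings kapF.
(* E is generated by all the conjugates of [kapF]; its normality is [nkapE]. *)
have [kapE AkapE [_ EP]] := primitive_element [seq s i kapF | i : 'I_D].
have fixE (nu : {rmorphism algC -> algC}) : nu kapE = kapE <->
    forall mu0 : {rmorphism algC -> algC}, nu (mu0 kapF) = mu0 kapF.
  rewrite EP; split=> [nuP mu0|nuP _ /mapP[i _ ->]]; last exact: nuP.
  by have [i ->] := s_all mu0; apply: nuP; apply: map_f; rewrite mem_enum.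
have nkapE (nu : {rmorphism algC -> algC}) : Fix kapE (nu kapE).
  move=> mu0 /fixE mu0P; have [nu' [K1 K2]] := aut_inv nu.
  apply: (can_inj K2); rewrite K1.
  have /fixE : forall mu1 : {rmorphism algC -> algC},
      (nu' \o mu0 \o nu : {rmorphism _ -> _}) (mu1 kapF) = mu1 kapF.
    move=> mu1 /=; rewrite -[mu0 _]/(mu0 ((nu \o mu1 : {rmorphism _ -> _}) kapF)).
    by rewrite mu0P /= K1.
  by [].
have FE : Fix kapE kapF by move=> nu /fixE/(_ idfun).
have [Dk [sk [sk_inj sk_all]]] := Fix_embeddings kapk.
have [d d0 dP] := unramified_radical AkapE nkapE.
have [ps psE] := (finite_seqP S).1 finS.
have dpP p : {m : nat | S p -> (0 < m)%N /\ p m%:R}.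
  apply: cid; have [Sp|nSp] := pselect (S p); last by exists 0%N.
  by have [m m0 pm] := prime_int (SP _ Sp); exists m.
(* [l ^ 2] makes the [eps] integral, [d] keeps away the primes at which E may ramify, and the
   product puts a divisor of the modulus in every prime of [S], as [L_unramified] requires. *)
pose m0 := (l ^ 2 * d * \prod_(p <- ps) sval (dpP p))%N.
have m0_gt0 : (0 < m0)%N.
  rewrite !muln_gt0 prime_gt0 // d0 /=; rewrite big_seq_cond prodn_cond_gt0 // => p.
  rewrite andbT => pps; have Sp : S p by rewrite psE.
  by have [] := svalP (dpP p) Sp.
have rad_m0 p : prime p -> ~~ (p %| m0)%N -> radical (Fix kapE) (mult (Fix kapE) p%:R).
  move=> pp pm0; apply: dP => //; apply: contra pm0 => pd.
  by rewrite /m0 mulnAC dvdn_mull.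
have [m [C [T0 [m_gt0 m0m C0 many]]]] :=
  many_good AkapF AkapE nkapE FE s_inj s_all m0_gt0 rad_m0.
have lm : (l ^ 2 %| m)%N by apply: dvdn_trans m0m; rewrite /m0 -mulnA dvdn_mulr.
have mS p : S p -> exists2 d, (d %| m)%N & p d%:R.
  move=> Sp; exists (sval (dpP p)); last by have [] := svalP (dpP p) Sp.
  apply: dvdn_trans m0m; rewrite /m0 dvdn_mull // (big_rem p) /= ?dvdn_mulr //.
  by move: Sp; rewrite psE.
have [C8 C80 C8P] := count_extensions_ge l_prime z_prim FK AkapE nkapE FE kKk Akapk AkapK
  mu_k mu_inj mu_all s_inj s_all bKP AbK sk_inj sk_all m_gt0 lm SP unramS mS galH' many R.
exact: (asymptotics C80 (D_gt0 s_all) l_prime C8P).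
Qed.
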